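(* The following hold: (1) In $\mathbf{ZF}$, each of the following statements implies the one beneath it: (a) $\mathbf{CAC_{LO}}$; (b) $\mathbf{CAC_{DLO}}$; (c) for every infinite linearly orderable set $X$, the spaces $\mathbf{S}(X,[X]^{\leq\omega})$, $\mathbf{S}_{\mathcal{P}}(X,[X]^{\leq\omega})$ and $2^X[[X]^{\leq\omega}]$ are all $P$-spaces; (d) for every infinite linearly orderable set $X$, $\mathbf{S}(X,[X]^{\leq\omega})$ is a $P$-space; (e) $\mathbf{CUC_{DLO}}$; (f) $\mathbf{vDCP}(\omega)\wedge\mathrm{cf}(\aleph_1)=\aleph_1$. (2) (b) does not imply (a) in $\mathbf{ZFA}$.
   Context: $\mathbf{ZFA}$ is $\mathbf{ZF}$ modified to allow atoms. ''$\Phi$ does not imply $\Psi$ in $\mathbf{ZFA}$'' means that there is a model of $\mathbf{ZFA}$ in which $\Phi$ is true and $\Psi$ is false (assuming the consistency of the base theory). A set is denumerable if equipotent to $\omega$, countable if it injects into $\omega$. $[X]^{<\omega}$, $[X]^{\leq\omega}$ are the sets of finite, respectively countable, subsets of $X$. $\mathbf{CAC_{LO}}$: every denumerable family of non-empty linearly orderable sets has a choice function. $\mathbf{CAC_{DLO}}$: for every family $\{\langle X_n,\leq_n\rangle:n\in\omega\}$ of non-empty linearly ordered sets, $\{X_n:n\in\omega\}$ has a choice function. $\mathbf{CUC_{DLO}}$: for every family $\{\langle X_n,\leq_n\rangle:n\in\omega\}$ of non-empty linearly ordered countable sets, $\bigcup_{n\in\omega}X_n$ is countable. $\mathbf{vDCP}(\omega)$: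 for every family $\{\langle X_n,\leq_n\rangle:n\in\omega\}$ of linearly ordered sets each isomorphic to the integers with the standard order, $\{X_n:n\in\omega\}$ has a choice function. $\mathrm{cf}(\aleph_1)=\aleph_1$: $\omega_1$ is regular. For an infinite set $X$, $\mathcal{Z}=[X]^{\leq\omega}$ and $\mathcal{A}\subseteq\mathcal{P}(X)$, $\mathbf{S}_{\mathcal{A}}(X,\mathcal{Z})$ is the set $\mathcal{A}$ with the topology consisting of all $V\subseteq\mathcal{A}$ such that for every $x\in V$ there is $z\in\mathcal{Z}$ with $x\cap z=\emptyset$ and $\{y\in\mathcal{A}:x\subseteq y\subseteq X\setminus z\}\subseteq V$. $\mathbf{S}_{\mathcal{P}}(X,\mathcal{Z})=\mathbf{S}_{\mathcal{P}(X)}(X,\mathcal{Z})$, $\mathbf{S}(X,\mathcal{Z})=\mathbf{S}_{[X]^{<\omega}}(X,\mathcal{Z})$. With $2=\{0,1\}$ and $[p]_X=\{f\in 2^X:p\subseteq f\}$ for $p\in 2^z$, $z\in\mathcal{Z}\setminus\{\emptyset\}$, $2^X[\mathcal{Z}]$ is the set $2^X$ with the topology $\{V\subseteq 2^X:(\forall f\in V)(\exists z\in\mathcal{Z}\setminus\{\emptyset\})(\exists p\in 2^z)\ f\in[p]_X\subseteq V\}$. A $P$-space is a topological space in which every $G_\delta$-set is open. *)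

(* Defs.v *)
From Stdlib Require Import List.

(* First-order logic over the signature {=, mem, atom}.  Variables are de Bruijn
   indices; there are no function symbols, so the only terms are variables and
   substitutions are renamings. *)

Inductive form : Type :=
| f_eq (i j : nat)
| f_mem (i j : nat)
| f_atom (i : nat)
| f_bot
| f_imp (p q : form)
| f_all (p : form).

Definition f_not (p : form) := f_imp p f_bot.
Definition f_and (p q : form) := f_not (f_imp p (f_not q)).
Definition f_or (p q : form) := f_imp (f_not p) q.
Definition f_iff (p q : form) := f_and (f_imp p q) (f_imp q p).
Definition f_ex (p : form) := f_not (f_all (f_not p)).

Definition scons {A : Type} (a : A) (s : nat -> A) (i : nat) : A :=
  match i with 0 => a | S j => s j end.

Fixpoint rename (r : nat -> nat) (p : form) : form :=
  match p with
  | f_eq i j => f_eq (r i) (r j)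
  | f_mem i j => f_mem (r i) (r j)
  | f_atom i => f_atom (r i)
  | f_bot => f_bot
  | f_imp p q => f_imp (rename r p) (rename r q)
  | f_all p => f_all (rename (scons 0 (fun i => S (r i))) p)
  end.

Definition inst (i : nat) (p : form) : form := rename (scons i (fun j => j)) p.

(* Natural deduction for classical first-order logic with equality.  The free
    variables of the axioms of [T] are read universally, so [T] is not shifted
    in the introduction rule for the quantifier. *)
Inductive prv (T : form -> Prop) : list form -> form -> Prop :=
| prv_ax G p : T p -> prv T G p
| prv_hyp G p : In p G -> prv T G p
| prv_impI G p q : prv T (p :: G) q -> prv T G (f_imp p q)
| prv_impE G p q : prv T G (f_imp p q) -> prv T G p -> prv T G q
| prv_raa G p : prv T (f_not p :: G) f_bot -> prv T G p
| prv_allI G p : prv T (map (rename S) G) p -> prv T G (f_all p)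
| prv_allE G p i : prv T G (f_all p) -> prv T G (inst i p)
| prv_refl G i : prv T G (f_eq i i)
| prv_subst G p i j :
    prv T G (f_eq i j) -> prv T G (inst i p) -> prv T G (inst j p).

Definition consistent (T : form -> Prop) : Prop := ~ prv T nil f_bot.

Record structure : Type := {
  dom :> Type;
  dom_inhabited : inhabited dom;
  mem : dom -> dom -> Prop;
  atom : dom -> Prop
}.

Arguments mem {s} _ _.
Arguments atom {s} _.

Fixpoint sat (M : structure) (v : nat -> M) (p : form) : Prop :=
  match p with
  | f_eq i j => v i = v j
  | f_mem i j => mem (v i) (v j)
  | f_atom i => atom (v i)
  | f_bot => False
  | f_imp p q => sat M v p -> sat M v q
  | f_all p => forall a : M, sat M (scons a v) p
  end.

Definition model (T : form -> Prop) (M : structure) : Prop :=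
  forall p, T p -> forall v : nat -> M, sat M v p.

Section Theories.

Local Notation "i =' j" := (f_eq i j) (at level 70).
Local Notation "i ∈' j" := (f_mem i j) (at level 70).
Local Notation "¬' p" := (f_not p) (at level 75, right associativity).
Local Notation "p ∧' q" := (f_and p q) (at level 80, right associativity).
Local Notation "p ∨' q" := (f_or p q) (at level 85, right associativity).
Local Notation "p ⇔' q" := (f_iff p q) (at level 95, no associativity).
Local Notation "p ⇒' q" := (f_imp p q) (at level 99, right associativity).
Local Notation "∀' p" := (f_all p) (at level 99, p at level 200).
Local Notation "∃' p" := (f_ex p) (at level 99, p at level 200).

Definition ax_atoms_no_elements := ∀' f_atom 0 ⇒' ∀' ¬' 0 ∈' 1.

Definition ax_set_of_atoms := ∃' ¬' f_atom 0 ∧' ∀' (0 ∈' 1 ⇔' f_atom 0).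

Definition ax_extensionality :=
  ∀' ∀' ¬' f_atom 1 ⇒' ¬' f_atom 0 ⇒' (∀' (0 ∈' 2 ⇔' 0 ∈' 1)) ⇒' 1 =' 0.

Definition ax_pairing := ∀' ∀' ∃' ∀' (0 ∈' 1 ⇔' 0 =' 3 ∨' 0 =' 2).

Definition ax_union :=
  ∀' ∃' ¬' f_atom 0 ∧' ∀' (0 ∈' 1 ⇔' ∃' 0 ∈' 3 ∧' 1 ∈' 0).

Definition ax_powerset :=
  ∀' ∃' ¬' f_atom 0 ∧'
     ∀' (0 ∈' 1 ⇔' ¬' f_atom 0 ∧' ∀' (0 ∈' 1 ⇒' 0 ∈' 3)).

(* Some w contains the empty set, and the successor of each of its elements. *)
Definition ax_infinity :=
  ∃' (∃' ¬' f_atom 0 ∧' (∀' ¬' 0 ∈' 1) ∧' 0 ∈' 1) ∧'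
     (∀' 0 ∈' 1 ⇒'
        ∃' ¬' f_atom 0 ∧' (∀' (0 ∈' 1 ⇔' 0 ∈' 2 ∨' 0 =' 2)) ∧' 0 ∈' 2).

Definition ax_foundation :=
  ∀' (∃' 0 ∈' 1) ⇒' ∃' 0 ∈' 1 ∧' ¬' ∃' 0 ∈' 1 ∧' 0 ∈' 2.

(* [p] is p(z, params), with z = variable 0; under the three quantifiers the
   bound variables are z = 0, y = 1, x = 2. *)
Definition ax_separation (p : form) :=
  ∀' ∃' ¬' f_atom 0 ∧'
     ∀' (0 ∈' 1 ⇔' 0 ∈' 2 ∧' rename (scons 0 (fun i => i + 3)) p).

(* [p] is p(y, x, params), with y = variable 0 and x = variable 1: if p defines
   a partial class function x |-> y, then the image of every a is a set.
   In the premise the bound variables are y' = 0, y = 1, x = 2;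
   in the conclusion they are x = 0, y = 1, b = 2, a = 3. *)
Definition ax_replacement (p : form) :=
  (∀' ∀' ∀' rename (scons 1 (scons 2 (fun i => i + 3))) p ⇒'
            rename (scons 0 (scons 2 (fun i => i + 3))) p ⇒' 1 =' 0) ⇒'
  ∀' ∃' ¬' f_atom 0 ∧'
     ∀' (0 ∈' 1 ⇔'
         ∃' 0 ∈' 3 ∧' rename (scons 1 (scons 0 (fun i => i + 4))) p).

Definition ax_no_atoms := ∀' ¬' f_atom 0.

End Theories.

Inductive ZFA : form -> Prop :=
| ZFA_atoms_no_elements : ZFA ax_atoms_no_elements
| ZFA_set_of_atoms : ZFA ax_set_of_atoms
| ZFA_extensionality : ZFA ax_extensionality
| ZFA_pairing : ZFA ax_pairing
| ZFA_union : ZFA ax_union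
| ZFA_powerset : ZFA ax_powerset
| ZFA_infinity : ZFA ax_infinity
| ZFA_foundation : ZFA ax_foundation
| ZFA_separation p : ZFA (ax_separation p)
| ZFA_replacement p : ZFA (ax_replacement p).

(* Without atoms, "set" below means every element of the model and the axioms
   become those of the usual ZF in the language {=, mem}. *)
Inductive ZF : form -> Prop :=
| ZF_of_ZFA p : ZFA p -> ZF p
| ZF_no_atoms : ZF ax_no_atoms.

Definition implies_in (T : form -> Prop) (Phi Psi : structure -> Prop) : Prop :=
  forall M : structure, model T M -> Phi M -> Psi M.

Definition not_implies_in (T : form -> Prop) (Phi Psi : structure -> Prop) : Prop :=
  consistent T -> exists M : structure, model T M /\ Phi M /\ ~ Psi M.

(* Everything below is the truth value in [M] of a first-order formula: all
   quantifiers range over elements of [M].  Arguments of type [M -> Prop] and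
   [M -> M -> Prop] only serve as macros for such formulas.  A set described by
   a formula (omega, a product, a topology) is a variable constrained by its
   description, since the language has no terms. *)

Section SetTheory.
Context {M : structure}.
Implicit Types a b c f g h k m n o p q r s t u v w x y z : M.
Implicit Types A F G I T U V W X Y Z : M.

Local Notation "x ∈ y" := (@mem M x y) (at level 70).

(* a is the set {x | P x} *)
Definition is_set_of a (P : M -> Prop) : Prop :=
  ~ atom a /\ forall x, x ∈ a <-> P x.

Definition is_empty a := is_set_of a (fun _ => False).
Definition nonempty a := exists x, x ∈ a.
Definition subset a b := ~ atom a /\ forall x, x ∈ a -> x ∈ b.
Definition is_union U F := is_set_of U (fun x => exists a, a ∈ F /\ x ∈ a).
Definition is_powerset a b := is_set_of a (fun x => subset x b).

Definition is_upair p a b := is_set_of p (fun x => x = a \/ x = b).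

(* Kuratowski pair: p = {{a}, {a, b}} *)
Definition is_opair p a b :=
  exists s t, is_upair s a a /\ is_upair t a b /\ is_upair p s t.

Definition related r x y := exists p, p ∈ r /\ is_opair p x y.

Definition is_fun_on f X :=
  ~ atom f /\
  (forall p, p ∈ f -> exists x y, x ∈ X /\ is_opair p x y) /\
  (forall x, x ∈ X -> exists! y, related f x y).

Definition is_fun f X Y :=
  is_fun_on f X /\ forall x y, related f x y -> y ∈ Y.

Definition is_injection f X Y :=
  is_fun f X Y /\
  forall x x' y, related f x y -> related f x' y -> x = x'.

Definition is_bijection f X Y :=
  is_injection f X Y /\ forall y, y ∈ Y -> exists x, related f x y.

Definition equipotent X Y := exists f, is_bijection f X Y.

Definition is_choice_function f F :=
  is_fun_on f F /\ forall a x, related f a x -> x ∈ a.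

Definition has_choice_function F := exists f, is_choice_function f F.

Definition is_succ s x := is_set_of s (fun y => y ∈ x \/ y = x).

Definition inductive w :=
  (exists e, is_empty e /\ e ∈ w) /\
  (forall x, x ∈ w -> exists s, is_succ s x /\ s ∈ w).

Definition is_omega w :=
  ~ atom w /\ inductive w /\ forall v, inductive v -> subset w v.

Definition finite X := exists w n, is_omega w /\ n ∈ w /\ equipotent X n.
Definition infinite X := ~ atom X /\ ~ finite X.
Definition denumerable X := exists w, is_omega w /\ equipotent X w.
Definition countable X := exists w f, is_omega w /\ is_injection f X w.

Definition linear_order r X :=
  ~ atom r /\
  (forall p, p ∈ r -> exists x y, x ∈ X /\ y ∈ X /\ is_opair p x y) /\
  (forall x, x ∈ X -> related r x x) /\
  (forall x y, related r x y -> related r y x -> x = y) /\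
  (forall x y z, related r x y -> related r y z -> related r x z) /\
  (forall x y, x ∈ X -> y ∈ X -> related r x y \/ related r y x).

Definition linearly_orderable X := ~ atom X /\ exists r, linear_order r X.

Definition order_isomorphic X r Y s :=
  exists f, is_bijection f X Y /\
    forall x x' y y', related f x y -> related f x' y' ->
      (related r x x' <-> related s y y').

(* The integers are coded by ({0} x omega) u ({1} x omega), where <0,n> stands
   for n and <1,n> for -(n+1). *)
Definition is_integers Z :=
  exists w e o, is_omega w /\ is_empty e /\ is_succ o e /\
  is_set_of Z (fun q => exists s n, (s = e \/ s = o) /\ n ∈ w /\ is_opair q s n).

Definition integer_le q q' :=
  exists e o s m t n,
    is_empty e /\ is_succ o e /\ is_opair q s m /\ is_opair q' t n /\
    ((s = e /\ t = e /\ (m ∈ n \/ m = n)) \/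
     (s = o /\ t = e) \/
     (s = o /\ t = o /\ (n ∈ m \/ n = m))).

Definition is_integers_order r Z :=
  is_set_of r (fun p => exists q q',
    q ∈ Z /\ q' ∈ Z /\ is_opair p q q' /\ integer_le q q').

Definition isomorphic_to_integers X r :=
  exists Z s, is_integers Z /\ is_integers_order s Z /\ order_isomorphic X r Z s.

(* G is a function n |-> <X_n, <=_n> on omega, where each <=_n linearly orders
   the set X_n and Q holds of X_n and <=_n; and F = {X_n | n in omega}. *)
Definition sequence_of_linear_orders (Q : M -> M -> Prop) G F :=
  exists w, is_omega w /\ is_fun_on G w /\
  (forall n q, related G n q ->
     exists X r, is_opair q X r /\ ~ atom X /\ linear_order r X /\ Q X r) /\
  is_set_of F (fun X => exists n q r, related G n q /\ is_opair q X r).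

Definition is_ordinal a :=
  ~ atom a /\
  (forall x, x ∈ a -> subset x a) /\
  (forall x y, x ∈ a -> y ∈ a -> x ∈ y \/ x = y \/ y ∈ x) /\
  (forall x y z, x ∈ a -> y ∈ a -> z ∈ a -> x ∈ y -> y ∈ z -> x ∈ z) /\
  (forall x, x ∈ a -> ~ x ∈ x) /\
  (forall s, subset s a -> nonempty s ->
     exists m, m ∈ s /\ forall x, x ∈ s -> m ∈ x \/ m = x).

Definition is_omega1 k :=
  is_ordinal k /\ ~ countable k /\ forall a, a ∈ k -> countable a.

Definition is_cofinal_map f c k :=
  is_fun f c k /\
  forall b, b ∈ k -> exists x y, related f x y /\ (b ∈ y \/ b = y).

Definition is_cofinality c k :=
  is_ordinal c /\ (exists f, is_cofinal_map f c k) /\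
  forall d f, d ∈ c -> ~ is_cofinal_map f d k.

(* A topological space is given by the set Y of its points and the set T of its
   open sets. *)

Definition is_topology T Y :=
  ~ atom T /\
  (forall V, V ∈ T -> subset V Y) /\
  Y ∈ T /\
  (forall F U, subset F T -> is_union U F -> U ∈ T) /\
  (forall V W I, V ∈ T -> W ∈ T ->
     is_set_of I (fun x => x ∈ V /\ x ∈ W) -> I ∈ T).

Definition is_Gdelta G Y T :=
  exists w g, is_omega w /\ is_fun g w T /\
  is_set_of G (fun x => x ∈ Y /\ forall n U, related g n U -> x ∈ U).

Definition P_space Y T :=
  is_topology T Y /\ forall G, is_Gdelta G Y T -> G ∈ T.

Definition is_countable_subsets Z X :=
  is_set_of Z (fun z => subset z X /\ countable z).

Definition is_finite_subsets A X :=
  is_set_of A (fun a => subset a X /\ finite a).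

(* T is the topology of S_A(X, Z) *)
Definition is_S_topology T A X Z :=
  is_set_of T (fun V => subset V A /\
    forall x, x ∈ V -> exists z, z ∈ Z /\ (forall i, ~ (i ∈ x /\ i ∈ z)) /\
      forall y, y ∈ A -> (forall i, i ∈ x -> i ∈ y) ->
        (forall i, i ∈ y -> i ∈ X /\ ~ i ∈ z) -> y ∈ V).

Definition is_two t := exists e o, is_empty e /\ is_succ o e /\ is_upair t e o.

(* C is the set 2^X *)
Definition is_two_power C X :=
  exists t, is_two t /\ is_set_of C (fun f => is_fun f X t).

(* T is the topology of 2^X[Z]; the last line says [p]_X is included in V. *)
Definition is_two_power_topology T C X Z :=
  is_set_of T (fun V => subset V C /\
    forall f, f ∈ V -> exists z p t, z ∈ Z /\ nonempty z /\
      is_two t /\ is_fun p z t /\ subset p f /\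
      forall h, h ∈ C -> subset p h -> h ∈ V).

Definition S_fin_is_P_space X :=
  exists Z A T, is_countable_subsets Z X /\ is_finite_subsets A X /\
    is_S_topology T A X Z /\ P_space A T.

Definition S_pow_is_P_space X :=
  exists Z A T, is_countable_subsets Z X /\ is_powerset A X /\
    is_S_topology T A X Z /\ P_space A T.

Definition two_power_is_P_space X :=
  exists Z C T, is_countable_subsets Z X /\ is_two_power C X /\
    is_two_power_topology T C X Z /\ P_space C T.

End SetTheory.

Definition CAC_LO (M : structure) : Prop :=
  forall F : M, denumerable F ->
    (forall X, mem X F -> nonempty X /\ linearly_orderable X) ->
    has_choice_function F.

Definition CAC_DLO (M : structure) : Prop :=
  forall G F : M, sequence_of_linear_orders (fun X _ => nonempty X) G F ->
    has_choice_function F.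

Definition LO_P_spaces (M : structure) : Prop :=
  forall X : M, infinite X -> linearly_orderable X ->
    S_fin_is_P_space X /\ S_pow_is_P_space X /\ two_power_is_P_space X.

Definition LO_S_fin_P_space (M : structure) : Prop :=
  forall X : M, infinite X -> linearly_orderable X -> S_fin_is_P_space X.

Definition CUC_DLO (M : structure) : Prop :=
  forall G F U : M,
    sequence_of_linear_orders (fun X _ => nonempty X /\ countable X) G F ->
    is_union U F -> countable U.

Definition vDCP_omega (M : structure) : Prop :=
  forall G F : M, sequence_of_linear_orders isomorphic_to_integers G F ->
    has_choice_function F.

Definition omega1_regular (M : structure) : Prop :=
  exists k : M, is_omega1 k /\ is_cofinality k k.

(* Main.v *)
Require Import Defs.
From Stdlib Require Import PeanoNat Lia Bool Setoid.
From Stdlib Require Import ClassicalEpsilon FunctionalExtensionality PropExtensionality.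

(** Part (1) is carried out inside an arbitrary model of ZF, with sets formed
    from predicates that are definable with parameters.  The main point is
    CAC_DLO => P-space: the countable subsets of a linearly ordered set [X]
    need not be linearly orderable, but the partial injections from [X] to
    omega are, by comparing their columns lexicographically; choosing such
    injections yields countable sets together with enumerations, so their union
    is countable.  Conversely, if the disjoint union of the [X_n] gives a
    P-space, then the singleton of the empty set is a G_delta, hence open, which
    forces the disjoint union to be countable.

    For part (2), well-founded trees over the atoms [nat * bool], modulo
    extensional equality, model ZFA, and the hereditarily symmetric ones form
    the second Fraenkel model.  Its group has exponent 2, and an order
    automorphism of order 2 is trivial, so everything in a sequence of linear
    orders has the support of the sequence; whereas the pairs of atoms have no
    choice function. *)

(** Separation and replacement hold in an arbitrary model only for first-order formulas, so every
    set built in part (1) carries a definability obligation. Therefore [definable] is a semantic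
    notion, about predicates of environments, with closure lemmas that follow the shape of a goal;
    the tactic [definability] applies them. In part (1) the epsilon operator of the metatheory only
    names sets that are unique in the model, or junk, so it brings no choice into it. Choosing an
    injection instead of a countable set has a double use: the candidates inherit an order that is
    uniform in the index, as (b) demands, and the enumerations needed for a countable union come
    along with the choice. Uniformity is also the gap between (a) and (b): in the Fraenkel model
    each pair of atoms can be ordered, but with a support that depends on the pair, so the orders
    never form one sequence. For the regularity of omega_1 it comes for free, since membership
    orders all initial segments at once. *)

Local Notation "x ∈ y" := (mem x y) (at level 70).

(** * Definability with parameters *)

Section Definability.
Context {M : structure}.

Lemma sat_ext p : forall v w : nat -> M,
  (forall i, v i = w i) -> sat M v p <-> sat M w p.
Proof.
induction p as [i j|i j|i| |p IHp q IHq|p IHp]; intros v w e; simpl;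
  rewrite ?e; try reflexivity.
- rewrite (IHp v w e), (IHq v w e); reflexivity.
- split; intros H a.
  + apply (IHp (scons a v)); [|apply H]; intros [|i]; simpl; auto.
  + apply (IHp _ (scons a w)); [|apply H]; intros [|i]; simpl; auto.
Qed.

Lemma sat_rename p : forall (r : nat -> nat) (v : nat -> M),
  sat M v (rename r p) <-> sat M (fun i => v (r i)) p.
Proof.
induction p as [i j|i j|i| |p IHp q IHq|p IHp]; intros r v; simpl;
  try reflexivity.
- rewrite IHp, IHq; reflexivity.
- split; intros H a; specialize (H a).
  + apply IHp in H; revert H; apply sat_ext; intros [|i]; reflexivity.
  + apply IHp; revert H; apply sat_ext; intros [|i]; reflexivity.
Qed.

Lemma sat_not v p : sat M v (f_not p) <-> ~ sat M v p.
Proof. reflexivity. Qed.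

Lemma sat_and v p q : sat M v (f_and p q) <-> sat M v p /\ sat M v q.
Proof. simpl; destruct (classic (sat M v p)), (classic (sat M v q)); tauto. Qed.

Lemma sat_or v p q : sat M v (f_or p q) <-> sat M v p \/ sat M v q.
Proof. simpl; destruct (classic (sat M v p)); tauto. Qed.

Lemma sat_iff v p q : sat M v (f_iff p q) <-> (sat M v p <-> sat M v q).
Proof. unfold f_iff; rewrite sat_and; simpl; tauto. Qed.

Lemma sat_all v p : sat M v (f_all p) <-> forall a, sat M (scons a v) p.
Proof. reflexivity. Qed.

Lemma sat_ex v p : sat M v (f_ex p) <-> exists a, sat M (scons a v) p.
Proof.
simpl; split; [|firstorder].
intros H; apply NNPP; firstorder.
Qed.

Definition ev (t : nat + M) (v : nat -> M) : M :=
  match t with inl i => v i | inr a => a end.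

(* Definability with parameters; the predicate depends on the environment,
   and the parameters are the constants [inr a] of the substitution. *)
Definition definable (P : (nat -> M) -> Prop) : Prop :=
  exists (p : form) (s : nat -> nat + M),
    forall v, P v <-> sat M (fun i => ev (s i) v) p.

Lemma definable_equiv P Q :
  (forall v, Q v <-> P v) -> definable P -> definable Q.
Proof. intros e (p & s & H); exists p, s; intros v; rewrite e; apply H. Qed.

(** One substitution both permutes variables and freezes some of them as parameters; the weakening
    and fibre lemmas below are instances. *)
Lemma definable_subst (s : nat -> nat + M) P :
  definable P -> definable (fun v => P (fun i => ev (s i) v)).
Proof.
intros (p & t & H).
exists p, (fun i => match t i with inl j => s j | inr a => inr a end).
intros v; rewrite H; apply sat_ext; intros i; destruct (t i); reflexivity.
Qed.

Lemma definable_var_eq i j : definable (fun v => v i = v j).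
Proof. exists (f_eq i j), inl; reflexivity. Qed.

Lemma definable_var_mem i j : definable (fun v => mem (v i) (v j)).
Proof. exists (f_mem i j), inl; reflexivity. Qed.

Lemma definable_var_atom i : definable (fun v => atom (v i)).
Proof. exists (f_atom i), inl; reflexivity. Qed.

Lemma definable_False : definable (fun _ => False).
Proof. exists f_bot, inl; reflexivity. Qed.

(** The two formulas come with their own substitutions, so their variables are interleaved: even
    ones carry those of [P], odd ones those of [Q]. *)
Lemma definable_imp P Q :
  definable P -> definable Q -> definable (fun v => P v -> Q v).
Proof.
intros (p & s & Hp) (q & t & Hq).
exists (f_imp (rename (fun i => 2 * i) p) (rename (fun i => 2 * i + 1) q)).
exists (fun i => if Nat.even i then s (Nat.div2 i) else t (Nat.div2 i)).
intros v; simpl sat; rewrite !sat_rename, Hp, Hq.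
assert (E1 : sat M (fun i => ev (s i) v) p <-> sat M (fun i => ev
   (if Nat.even (2 * i) then s (Nat.div2 (2 * i)) else t (Nat.div2 (2 * i))) v) p).
{ apply sat_ext; intros i.
  rewrite Nat.even_mul, Nat.div2_double; reflexivity. }
assert (E2 : sat M (fun i => ev (t i) v) q <-> sat M (fun i => ev
   (if Nat.even (2 * i + 1) then s (Nat.div2 (2 * i + 1))
    else t (Nat.div2 (2 * i + 1))) v) q).
{ apply sat_ext; intros i.
  rewrite Nat.add_1_r, Nat.div2_succ_double,
    Nat.even_succ, <- Nat.negb_even, Nat.even_mul;
    reflexivity. }
rewrite E1, E2; reflexivity.
Qed.

Lemma definable_all (Q : (nat -> M) -> M -> Prop) :
  definable (fun v => Q (fun i => v (S i)) (v 0)) ->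
  definable (fun v => forall x : M, Q v x).
Proof.
intros (q & s & H).
(* Several variables of [q] may be sent to the quantified one; these are all merged into index 0,
   and the others are shifted past the binder. *)
exists (f_all (rename (fun i => match s i with inl 0 => 0 | _ => S i end) q)).
exists (fun i => match s i with inl j => inl (pred j) | inr a => inr a end).
intros v; rewrite sat_all.
assert (E : forall x, Q v x <-> sat M (scons x (fun i => ev
    (match s i with inl j => inl (pred j) | inr a => inr a end) v))
  (rename (fun i => match s i with inl 0 => 0 | _ => S i end) q)).
{ intros x; rewrite sat_rename, (H (scons x v)); apply sat_ext; intros i.
  destruct (s i) as [[|j]|a] eqn:e; simpl; rewrite ?e; reflexivity. }
split; intros K x; apply E, K.
Qed.

Lemma definable_not P : definable P -> definable (fun v => ~ P v).
Proof. intros H; apply definable_imp; [exact H|apply definable_False]. Qed.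

Lemma definable_and P Q :
  definable P -> definable Q -> definable (fun v => P v /\ Q v).
Proof.
intros HP HQ; apply (definable_equiv (fun v => ~ (P v -> ~ Q v))).
- intros v; destruct (classic (P v)); tauto.
- apply definable_not, definable_imp; [|apply definable_not]; assumption.
Qed.

Lemma definable_or P Q :
  definable P -> definable Q -> definable (fun v => P v \/ Q v).
Proof.
intros HP HQ; apply (definable_equiv (fun v => ~ P v -> Q v)).
- intros v; destruct (classic (P v)); tauto.
- apply definable_imp; [apply definable_not|]; assumption.
Qed.

Lemma definable_iff P Q :
  definable P -> definable Q -> definable (fun v => P v <-> Q v).
Proof. intros; apply definable_and; apply definable_imp; assumption. Qed.

Lemma definable_ex (Q : (nat -> M) -> M -> Prop) :
  definable (fun v => Q (fun i => v (S i)) (v 0)) ->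
  definable (fun v => exists x : M, Q v x).
Proof.
intros H; apply (definable_equiv (fun v => ~ forall x, ~ Q v x)).
- intros v; split; [firstorder|intros K; apply NNPP; firstorder].
- apply definable_not, (definable_all (fun v x => ~ Q v x)), definable_not, H.
Qed.

(** The language has no terms, so a term counts as definable when its graph is: the value sits in
    variable 0 and the environment is shifted by one. *)
Definition definable_term (t : (nat -> M) -> M) : Prop :=
  definable (fun v => v 0 = t (fun i => v (S i))).

Lemma definable_term_var i : definable_term (fun v => v i).
Proof. apply definable_var_eq. Qed.

Lemma definable_term_const a : definable_term (fun _ => a).
Proof.
apply (definable_subst (fun i => match i with 0 => inl 0 | _ => inr a end)
  (fun v => v 0 = v 1)), definable_var_eq.
Qed.

Lemma definable_term_shift t :
  definable_term t -> definable_term (fun v => t (fun i => v (S i))).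
Proof.
apply (definable_subst (fun i => match i with 0 => inl 0 | S i => inl (S (S i)) end)
  (fun v => v 0 = t (fun i => v (S i)))).
Qed.

(** Eliminates a term inside a predicate by naming its value with an existential quantifier; closure
    under composition rests on this. *)
Lemma definable_let (Q : (nat -> M) -> M -> Prop) t :
  definable_term t -> definable (fun v => Q (fun i => v (S i)) (v 0)) ->
  definable (fun v => Q v (t v)).
Proof.
intros Ht HQ; apply (definable_equiv (fun v => exists x, x = t v /\ Q v x)).
- intros v; split; [eauto|intros (x & -> & K); exact K].
- apply (definable_ex (fun v x => x = t v /\ Q v x)), definable_and; assumption.
Qed.

Lemma definable_eq t u :
  definable_term t -> definable_term u -> definable (fun v => t v = u v).
Proof.
intros Ht Hu; apply (definable_let (fun v x => x = u v) t Ht), Hu.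
Qed.

Lemma definable_mem t u :
  definable_term t -> definable_term u -> definable (fun v => mem (t v) (u v)).
Proof.
intros Ht Hu; apply (definable_let (fun v x => mem x (u v)) t Ht).
apply (definable_let (fun v x => mem (v 0) x)).
- apply definable_term_shift, Hu.
- apply definable_var_mem.
Qed.

Lemma definable_atom t : definable_term t -> definable (fun v => atom (t v)).
Proof.
intros Ht; apply (definable_let (fun v x => atom x) t Ht), definable_var_atom.
Qed.

Lemma definable_fun2 (F : M -> M -> M) :
  definable_term (fun v => F (v 0) (v 1)) ->
  forall t u, definable_term t -> definable_term u ->
  definable_term (fun v => F (t v) (u v)).
Proof.
intros HF t u Ht Hu; unfold definable_term.
apply (definable_let (fun v x => v 0 = F x (u (fun i => v (S i))))).
{ apply definable_term_shift, Ht. }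
apply (definable_let (fun v x => v 1 = F (v 0) x)).
{ apply (definable_term_shift (fun v => u (fun i => v (S i)))).
  apply definable_term_shift, Hu. }
apply (definable_subst (fun i => match i with 0 => inl 2 | 1 => inl 1 | _ => inl 0 end)
  _ HF).
Qed.

Lemma definable_fun1 (F : M -> M) :
  definable_term (fun v => F (v 0)) ->
  forall t, definable_term t -> definable_term (fun v => F (t v)).
Proof.
intros HF t Ht; apply (definable_fun2 (fun x _ => F x)) with (u := t); assumption.
Qed.

Lemma definable_fiber (P : (nat -> M) -> M -> Prop) w :
  definable (fun v => P (fun i => v (S i)) (v 0)) ->
  definable (fun v => P w (v 0)).
Proof.
apply (definable_subst (fun i => match i with 0 => inl 0 | S i => inr (w i) end)).
Qed.

(** Bridge from semantic definability to the axiom schemes, which want the distinguished variables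
    at 0 and 1 and the parameters in the tail of the environment. *)
Lemma definable_sat2 (P : M -> M -> Prop) :
  definable (fun v => P (v 0) (v 1)) ->
  exists p w, forall x y, P x y <-> sat M (scons x (scons y w)) p.
Proof.
intros (p & s & H); destruct (dom_inhabited M) as [d].
(* Variables read from the environment collapse to 0 or 1; each parameter keeps its own slot, and
   [d] only fills slots that are never read. *)
exists (rename (fun i => match s i with inl 0 => 0 | inl _ => 1 | _ => S (S i) end) p).
exists (fun i => match s i with inr a => a | _ => d end).
intros x y; rewrite sat_rename, (H (fun i => match i with 0 => x | _ => y end)).
apply sat_ext; intros i; destruct (s i) as [[|j]|a] eqn:e; simpl; rewrite ?e;
  reflexivity.
Qed.

Lemma definable_sat1 (P : M -> Prop) :
  definable (fun v => P (v 0)) ->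
  exists p w, forall x, P x <-> sat M (scons x w) p.
Proof.
intros H; destruct (definable_sat2 (fun x _ => P x) H) as (p & w & K).
destruct (dom_inhabited M) as [d].
exists p, (scons d w); intros x; apply K.
Qed.

End Definability.

(** * Sets in a model of ZF *)

Section SetOf.
Context {M : structure}.

(** Classically a fixed proposition is true or false, which disposes of every subgoal that does not
    mention the environment. *)
Lemma definable_const (P : Prop) : @definable M (fun _ => P).
Proof.
destruct (classic P) as [H|H].
- apply (definable_equiv (fun v => False -> False)); [tauto|].
  apply definable_imp; apply definable_False.
- apply (definable_equiv (fun v => False)); [tauto|]; apply definable_False.
Qed.

Lemma definable_pred1 (P : M -> Prop) t :
  definable (fun v => P (v 0)) -> definable_term t ->
  definable (fun v => P (t v)).
Proof. intros HP Ht; apply (definable_let (fun v x => P x) t Ht), HP. Qed.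

Lemma definable_pred2 (P : M -> M -> Prop) t u :
  definable (fun v => P (v 0) (v 1)) -> definable_term t -> definable_term u ->
  definable (fun v => P (t v) (u v)).
Proof.
intros HP Ht Hu; apply (definable_let (fun v x => P x (u v)) t Ht).
apply (definable_let (fun v x => P (v 0) x)).
- apply definable_term_shift, Hu.
- apply (definable_subst (fun i => match i with 0 => inl 1 | _ => inl 0 end) _ HP).
Qed.

Definition set_of (P : M -> Prop) : M :=
  epsilon (dom_inhabited M) (fun a => forall x, x ∈ a <-> P x).

Lemma in_set_of (P : M -> Prop) x :
  (exists a, forall x, x ∈ a <-> P x) -> x ∈ set_of P <-> P x.
Proof.
intros H; apply (epsilon_spec (dom_inhabited M) (fun a => forall x, x ∈ a <-> P x) H).
Qed.

Definition sep (a : M) (P : M -> Prop) : M := set_of (fun x => x ∈ a /\ P x).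
Definition image (a : M) (f : M -> M) : M :=
  set_of (fun y => exists x, x ∈ a /\ y = f x).
Definition upair (a b : M) : M := set_of (fun x => x = a \/ x = b).
Definition union (a : M) : M := set_of (fun x => exists y, y ∈ a /\ x ∈ y).
Definition power (a : M) : M := set_of (fun x => forall y, y ∈ x -> y ∈ a).
Definition sing (a : M) : M := upair a a.
Definition emp : M := set_of (fun _ => False).
Definition cup (a b : M) : M := union (upair a b).
Definition succ (a : M) : M := cup a (sing a).
Definition opair (a b : M) : M := upair (sing a) (upair a b).

(* The unique element of [a] satisfying [P]; taking a union makes it definable
   without any uniqueness assumption. *)
Definition the (a : M) (P : M -> Prop) : M := union (sep a P).
Definition pr1 (p : M) : M := the (union p) (fun a => exists b, p = opair a b).
Definition pr2 (p : M) : M := the (union p) (fun b => exists a, p = opair a b).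
Definition ap (f x : M) : M := the (union (union f)) (fun y => opair x y ∈ f).
Definition lam (a : M) (f : M -> M) : M := image a (fun x => opair x (f x)).
Definition cprod (a b : M) : M :=
  union (image a (fun x => image b (fun y => opair x y))).
Definition order_on (a : M) (R : M -> M -> Prop) : M :=
  sep (cprod a a) (fun p => R (pr1 p) (pr2 p)).
Definition omega : M := epsilon (dom_inhabited M) is_omega.
Definition least (a : M) : M :=
  the a (fun n => forall m, m ∈ a -> n ∈ m \/ n = m).

End SetOf.

Existing Class model.

Section Model.
Context {M : structure} {HM : model ZF M}.
Implicit Types a b c x y z : M.

Lemma no_atom a : ~ atom a.
Proof. exact (HM _ ZF_no_atoms (fun _ => a) a). Qed.

Lemma ext_eq a b : (forall x, x ∈ a <-> x ∈ b) -> a = b.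
Proof.
intros H.
apply (HM _ (ZF_of_ZFA _ ZFA_extensionality) (fun _ => a) a b (no_atom a) (no_atom b)).
intros x; rewrite sat_iff; apply H.
Qed.

(** Describes the graph of [set_of]; the second case isolates the predicates without an extension,
    where the value is junk. *)
Lemma set_of_eq a P : a = set_of P <-> (forall x, x ∈ a <-> P x) \/
  (~ (exists b, forall x, x ∈ b <-> P x)) /\ a = set_of P.
Proof.
split.
- intros ->; destruct (classic (exists b, forall x, x ∈ b <-> P x)) as [H|H]; [|auto].
  left; intros x; apply in_set_of, H.
- intros [H|[_ H]]; [|exact H].
  apply ext_eq; intros x; rewrite in_set_of; eauto.
Qed.

Lemma separation (P : M -> Prop) a :
  definable (fun v => P (v 0)) -> exists b, forall x, x ∈ b <-> x ∈ a /\ P x.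
Proof.
intros (p & w & H)%definable_sat1.
pose proof (HM _ (ZF_of_ZFA _ (ZFA_separation p)) w a) as K.
apply sat_ex in K; destruct K as [b K]; exists b.
apply sat_and in K; destruct K as [_ K]; intros x; specialize (K x).
rewrite sat_iff, sat_and, sat_rename in K; simpl in K; rewrite K, H.
apply and_iff_compat_l, sat_ext; intros [|i]; [reflexivity|].
simpl; rewrite Nat.add_comm; reflexivity.
Qed.

Lemma replacement (f : M -> M) a :
  definable_term (fun v => f (v 0)) ->
  exists b, forall y, y ∈ b <-> exists x, x ∈ a /\ y = f x.
Proof.
intros (p & w & H)%(definable_sat2 (fun y x => y = f x)).
assert (K := HM _ (ZF_of_ZFA _ (ZFA_replacement p)) w).
unfold ax_replacement in K; change (sat M w (f_imp ?A ?B)) with (sat M w A -> sat M w B) in K.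
(* Any renaming that makes [p] read [y], [x] and the parameters in the right places expresses
   [y = f x]; this serves both the functionality premise and the conclusion of the axiom. *)
assert (E : forall x y v r, v (r 0) = y -> v (r 1) = x ->
  (forall i, v (r (S (S i))) = w i) -> sat M v (rename r p) <-> y = f x).
{ intros x y v r e0 e1 e2; rewrite H, sat_rename; apply sat_ext.
  intros [|[|i]]; simpl; auto. }
specialize (K ltac:(intros x y y';
  change (sat M (scons y' (scons y (scons x w))) (rename (scons 1 (scons 2 (fun i => i + 3))) p) ->
   sat M (scons y' (scons y (scons x w))) (rename (scons 0 (scons 2 (fun i => i + 3))) p) -> y = y');
  rewrite (E x y), (E x y'); try reflexivity; try congruence;
  intros i; simpl; rewrite Nat.add_comm; reflexivity) a).
apply sat_ex in K; destruct K as [b K]; exists b.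
apply sat_and in K; destruct K as [_ K]; intros y; specialize (K y).
rewrite sat_iff, sat_ex in K; split.
- intros L; apply K in L; destruct L as [x L]; exists x.
  apply sat_and in L; rewrite (E x y) in L; try reflexivity; [exact L|].
  intros i; simpl; rewrite Nat.add_comm; reflexivity.
- intros [x L]; apply K; exists x.
  apply sat_and; rewrite (E x y); try reflexivity; [exact L|].
  intros i; simpl; rewrite Nat.add_comm; reflexivity.
Qed.

Lemma in_sep (P : M -> Prop) a x : definable (fun v => P (v 0)) ->
  x ∈ sep a P <-> x ∈ a /\ P x.
Proof. intros H; apply (in_set_of (fun x => x ∈ a /\ P x)), separation, H. Qed.

Lemma in_image (f : M -> M) a y : definable_term (fun v => f (v 0)) ->
  y ∈ image a f <-> exists x, x ∈ a /\ y = f x.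
Proof. intros H; apply (in_set_of (fun y => exists x, x ∈ a /\ y = f x)), replacement, H. Qed.

Lemma upair_ex a b : exists c, forall x, x ∈ c <-> x = a \/ x = b.
Proof.
pose proof (HM _ (ZF_of_ZFA _ ZFA_pairing) (fun _ => a) a b) as K.
apply sat_ex in K; destruct K as [c K]; exists c; intros x; specialize (K x).
rewrite sat_iff, sat_or in K; exact K.
Qed.

Lemma in_upair a b x : x ∈ upair a b <-> x = a \/ x = b.
Proof. apply (in_set_of (fun x => x = a \/ x = b)), upair_ex. Qed.

Lemma union_ex a : exists c, forall x, x ∈ c <-> exists y, y ∈ a /\ x ∈ y.
Proof.
pose proof (HM _ (ZF_of_ZFA _ ZFA_union) (fun _ => a) a) as K.
apply sat_ex in K; destruct K as [c K]; exists c.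
apply sat_and in K; destruct K as [_ K]; intros x; specialize (K x).
rewrite sat_iff, sat_ex in K; split.
- intros H; apply K in H; destruct H as [y H]; exists y; apply sat_and in H; exact H.
- intros [y H]; apply K; exists y; apply sat_and; exact H.
Qed.

Lemma in_union a x : x ∈ union a <-> exists y, y ∈ a /\ x ∈ y.
Proof. apply (in_set_of (fun x => exists y, y ∈ a /\ x ∈ y)), union_ex. Qed.

Lemma power_ex a : exists c, forall x, x ∈ c <-> forall y, y ∈ x -> y ∈ a.
Proof.
pose proof (HM _ (ZF_of_ZFA _ ZFA_powerset) (fun _ => a) a) as K.
apply sat_ex in K; destruct K as [c K]; exists c.
apply sat_and in K; destruct K as [_ K]; intros x; specialize (K x).
rewrite sat_iff, sat_and in K; split.
- intros H; apply K in H; exact (proj2 H).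
- intros H; apply K; split; [apply no_atom|exact H].
Qed.

Lemma in_power a x : x ∈ power a <-> forall y, y ∈ x -> y ∈ a.
Proof. apply (in_set_of (fun x => forall y, y ∈ x -> y ∈ a)), power_ex. Qed.

Lemma in_sing a x : x ∈ sing a <-> x = a.
Proof. unfold sing; rewrite in_upair; tauto. Qed.

Lemma in_cup a b x : x ∈ cup a b <-> x ∈ a \/ x ∈ b.
Proof.
unfold cup; rewrite in_union; split.
- intros (y & H & K); rewrite in_upair in H; destruct H; subst; auto.
- intros [H|H]; [exists a|exists b]; rewrite in_upair; auto.
Qed.

Lemma in_succ a x : x ∈ succ a <-> x ∈ a \/ x = a.
Proof. unfold succ; rewrite in_cup, in_sing; reflexivity. Qed.

Lemma in_emp x : ~ x ∈ emp.
Proof.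
assert (H : x ∈ emp <-> False); [|tauto].
apply (in_set_of (fun _ => False)); destruct (separation (fun _ => False) x) as [b K].
- apply definable_const.
- exists b; intros y; rewrite K; tauto.
Qed.

Lemma opair_inj a b a' b' : opair a b = opair a' b' -> a = a' /\ b = b'.
Proof.
intros H.
assert (E : forall x, x = sing a \/ x = upair a b <-> x = sing a' \/ x = upair a' b').
{ intros x; rewrite <- !in_upair; fold (opair a b) (opair a' b'); rewrite H; reflexivity. }
assert (S1 : forall c d x, sing c = upair d x -> d = c /\ x = c).
{ intros c d x K; split; apply in_sing; rewrite K, in_upair; auto. }
assert (S2 : forall c d, sing c = sing d -> c = d).
{ intros c d K; apply in_sing; rewrite <- K; apply in_sing; reflexivity. }
assert (e : a = a').
{ destruct (proj1 (E (sing a)) (or_introl eq_refl)) as [K|K]; [auto|].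
  apply S1 in K; symmetry; apply K. }
subst a'; split; [reflexivity|].
destruct (proj1 (E (upair a b)) (or_intror eq_refl)) as [K|K].
- symmetry in K; apply S1 in K; destruct K as [_ ->].
  destruct (proj2 (E (upair a b')) (or_intror eq_refl)) as [L|L].
  + symmetry in L; apply S1 in L; destruct L; auto.
  + assert (I : b' ∈ upair a a) by (rewrite <- L, in_upair; auto).
    rewrite in_upair in I; destruct I; auto.
- assert (I : b ∈ upair a b') by (rewrite <- K, in_upair; auto).
  assert (J : b' ∈ upair a b) by (rewrite K, in_upair; auto).
  rewrite in_upair in I, J; destruct I, J; congruence.
Qed.

(** Existence is asked in every environment, so that extensionality turns the graph of [set_of] into
    a first-order statement about elements. *)
Lemma definable_set_of (P : (nat -> M) -> M -> Prop) :
  (forall v, exists a, forall x, x ∈ a <-> P v x) ->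
  definable (fun v => P (fun i => v (S i)) (v 0)) ->
  definable_term (fun v => set_of (P v)).
Proof.
intros H D.
apply (definable_equiv (fun v => forall x, x ∈ v 0 <-> P (fun i => v (S i)) x)).
- intros v; rewrite set_of_eq; split; [intros [K|[K _]]; [exact K|]|auto].
  destruct (K (H _)).
- apply (definable_all (fun v x => x ∈ v 0 <-> P (fun i => v (S i)) x)).
  apply definable_iff; [apply definable_var_mem|].
  apply (definable_subst (fun i => match i with 0 => inl 0 | S i => inl (S (S i)) end)
    _ D).
Qed.

Lemma definable_sep (t : (nat -> M) -> M) Q :
  definable_term t -> definable (fun v => Q (fun i => v (S i)) (v 0)) ->
  definable_term (fun v => sep (t v) (Q v)).
Proof.
intros Ht HQ; apply definable_set_of.
- intros v; apply separation, definable_fiber, HQ.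
- apply definable_and; [|exact HQ].
  apply definable_mem; [apply definable_term_var|apply definable_term_shift, Ht].
Qed.

Lemma definable_term_fiber (f : (nat -> M) -> M -> M) w :
  definable_term (fun v => f (fun i => v (S i)) (v 0)) ->
  definable_term (fun v => f w (v 0)).
Proof.
apply (definable_subst (fun i => match i with 0 => inl 0 | 1 => inl 1
  | S (S i) => inr (w i) end) (fun v => v 0 = f (fun i => v (S (S i))) (v 1))).
Qed.

Lemma definable_image (t : (nat -> M) -> M) f :
  definable_term t -> definable_term (fun v => f (fun i => v (S i)) (v 0)) ->
  definable_term (fun v => image (t v) (f v)).
Proof.
intros Ht Hf; apply definable_set_of.
- intros v; apply replacement, definable_term_fiber, Hf.
- apply (definable_ex (fun v x => x ∈ t (fun i => v (S i)) /\
      v 0 = f (fun i => v (S i)) x)).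
  apply definable_and.
  + apply definable_mem; [apply definable_term_var|].
    apply (definable_term_shift (fun v => t (fun i => v (S i)))).
    apply definable_term_shift, Ht.
  + apply definable_eq; [apply definable_term_var|].
    apply (definable_subst (fun i => match i with 0 => inl 0 | 1 => inl 1
      | S (S i) => inl (S (S (S i))) end) 
      (fun v => v 0 = f (fun i => v (S (S i))) (v 1)) Hf).
Qed.

Lemma definable_upair t u : @definable_term M t -> definable_term u ->
  definable_term (fun v => upair (t v) (u v)).
Proof.
intros Ht Hu; apply definable_set_of; [intros v; apply upair_ex|].
apply definable_or; (apply definable_eq; [apply definable_term_var|]);
  apply definable_term_shift; assumption.
Qed.

Lemma definable_union t : @definable_term M t ->
  definable_term (fun v => union (t v)).
Proof.
apply definable_fun1.
apply (definable_set_of (fun v x => exists y, y ∈ v 0 /\ x ∈ y)).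
- intros v; apply union_ex.
- apply (definable_ex (fun v y => y ∈ v 1 /\ v 0 ∈ y)).
  apply definable_and; apply definable_var_mem.
Qed.

Lemma definable_power t : @definable_term M t ->
  definable_term (fun v => power (t v)).
Proof.
apply definable_fun1.
apply (definable_set_of (fun v x => forall y, y ∈ x -> y ∈ v 0)).
- intros v; apply power_ex.
- apply (definable_all (fun v y => y ∈ v 0 -> y ∈ v 1)).
  apply definable_imp; apply definable_var_mem.
Qed.

End Model.

(** Follows the syntax of the goal. A hypothesis on the definability of a locally named predicate or
    function is used as it stands, which keeps the local definition folded. *)
Ltac definability_base :=
  cbv beta;
  lazymatch goal with
  | H : ?G |- ?G => exact H
  | |- definable (fun _ => ?P) => apply definable_const
  | |- definable (fun _ => forall x : dom _, _) => apply definable_all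
  | |- definable (fun _ => exists x : dom _, _) => apply definable_ex
  | |- definable (fun _ => exists! x : dom _, _) => unfold unique
  | |- definable (fun _ => ~ _) => apply definable_not
  | |- definable (fun _ => _ /\ _) => apply definable_and
  | |- definable (fun _ => _ \/ _) => apply definable_or
  | |- definable (fun _ => _ <-> _) => apply definable_iff
  | |- definable (fun _ => _ = _) => apply definable_eq
  | |- definable (fun _ => mem _ _) => apply definable_mem
  | |- definable (fun _ => atom _) => apply definable_atom
  | H : definable (fun v => ?P (v 0)) |- definable (fun _ => ?P _) =>
      apply (definable_pred1 P _ H)
  | H : definable (fun v => ?P (v 0) (v 1)) |- definable (fun _ => ?P _ _) =>
      apply (definable_pred2 P _ _ H)
  | |- definable (fun _ => is_set_of _ _) => unfold is_set_of
  | |- definable (fun _ => is_upair _ _ _) => unfold is_upair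
  | |- definable (fun _ => is_opair _ _ _) => unfold is_opair
  | |- definable (fun _ => related _ _ _) => unfold related
  | |- definable (fun _ => subset _ _) => unfold subset
  | |- definable (fun _ => is_fun_on _ _) => unfold is_fun_on
  | |- definable (fun _ => is_fun _ _ _) => unfold is_fun
  | |- definable (fun _ => is_injection _ _ _) => unfold is_injection
  | |- definable (fun _ => is_bijection _ _ _) => unfold is_bijection
  | |- definable (fun _ => is_empty _) => unfold is_empty
  | |- definable (fun _ => is_succ _ _) => unfold is_succ
  | |- definable (fun _ => inductive _) => unfold inductive
  | |- definable (fun _ => is_omega _) => unfold is_omega
  | |- definable (fun _ => countable _) => unfold countable
  | |- definable (fun _ => equipotent _ _) => unfold equipotent
  | |- definable (fun _ => finite _) => unfold finite
  | |- definable (fun _ => nonempty _) => unfold nonempty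
  | |- definable (fun _ => is_ordinal _) => unfold is_ordinal
  | |- definable (fun _ => _ -> _) => apply definable_imp
  | |- definable_term (fun _ => ?a) => apply definable_term_const
  | |- definable_term (fun v => v _) => apply definable_term_var
  | |- definable_term (fun _ => sep _ _) => apply definable_sep
  | |- definable_term (fun _ => image _ _) => apply definable_image
  | |- definable_term (fun _ => upair _ _) => apply definable_upair
  | |- definable_term (fun _ => union _) => apply definable_union
  | |- definable_term (fun _ => power _) => apply definable_power
  | |- definable_term (fun _ => sing _) => unfold sing
  | |- definable_term (fun _ => cup _ _) => unfold cup
  | |- definable_term (fun _ => succ _) => unfold succ
  | |- definable_term (fun _ => opair _ _) => unfold opair
  | |- definable_term (fun _ => the _ _) => unfold the
  | |- definable_term (fun _ => pr1 _) => unfold pr1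
  | |- definable_term (fun _ => pr2 _) => unfold pr2
  | |- definable_term (fun _ => ap _ _) => unfold ap
  | |- definable_term (fun _ => cprod _ _) => unfold cprod
  | |- definable_term (fun _ => order_on _ _) => unfold order_on
  | |- definable_term (fun _ => least _) => unfold least
  | H : definable_term (fun v => ?F (v 0)) |- definable_term (fun _ => ?F _) =>
      apply (definable_fun1 F H)
  end.
Ltac definability := solve [repeat definability_base].

Section DefinableTerms.
Context {M : structure} {HM : model ZF M}.

Lemma definable_opair t u : @definable_term M t -> definable_term u ->
  definable_term (fun v => opair (t v) (u v)).
Proof. apply (definable_fun2 opair); definability. Qed.

Lemma definable_ap t u : @definable_term M t -> definable_term u ->
  definable_term (fun v => ap (t v) (u v)).
Proof. apply (definable_fun2 ap); definability. Qed.

Lemma definable_cprod t u : @definable_term M t -> definable_term u ->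
  definable_term (fun v => cprod (t v) (u v)).
Proof. apply (definable_fun2 cprod); definability. Qed.

Lemma definable_pr1 t : @definable_term M t -> definable_term (fun v => pr1 (t v)).
Proof. apply definable_fun1; definability. Qed.

Lemma definable_pr2 t : @definable_term M t -> definable_term (fun v => pr2 (t v)).
Proof. apply definable_fun1; definability. Qed.

Lemma definable_succ t : @definable_term M t -> definable_term (fun v => succ (t v)).
Proof. apply definable_fun1; definability. Qed.

Lemma definable_least t : @definable_term M t -> definable_term (fun v => least (t v)).
Proof. apply definable_fun1; definability. Qed.

End DefinableTerms.

(** The composite operations now have closure lemmas of their own, tried before [definability_base]
    would unfold them; this keeps the goals small. *)
Ltac definability_step :=
  cbv beta;
  lazymatch goal with
  | H : ?G |- ?G => exact H
  | |- definable_term (fun _ => ?a) => apply definable_term_const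
  | |- definable_term (fun _ => opair _ _) => apply definable_opair
  | |- definable_term (fun _ => ap _ _) => apply definable_ap
  | |- definable_term (fun _ => cprod _ _) => apply definable_cprod
  | |- definable_term (fun _ => pr1 _) => apply definable_pr1
  | |- definable_term (fun _ => pr2 _) => apply definable_pr2
  | |- definable_term (fun _ => succ _) => apply definable_succ
  | |- definable_term (fun _ => least _) => apply definable_least
  | |- _ => definability_base
  end.
Ltac definability ::= solve [repeat definability_step].

(** * Pairs, functions, foundation and the set of natural numbers *)

Section Basics.
Context {M : structure} {HM : model ZF M}.
Implicit Types a b c d f g h k l m n p q r s u w x y z : M.
Implicit Types X Y Z : M.

Lemma the_eq (P : M -> Prop) a x : definable (fun v => P (v 0)) ->
  x ∈ a -> P x -> (forall y, y ∈ a -> P y -> y = x) -> the a P = x.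
Proof.
intros D H1 H2 H3; apply ext_eq; intros z; unfold the.
rewrite in_union; split.
- intros (y & Hy & Hz); rewrite in_sep in Hy by definability.
  rewrite <- (H3 y); tauto.
- intros Hz; exists x; rewrite in_sep by definability; auto.
Qed.

Lemma union_opair a b : union (opair a b) = upair a b.
Proof.
apply ext_eq; intros z; unfold opair; rewrite in_union, in_upair; split.
- intros (y & H & K); rewrite in_upair in H; destruct H; subst y;
    rewrite ?in_sing, ?in_upair in K; tauto.
- intros H; exists (upair a b); rewrite !in_upair; tauto.
Qed.

Lemma pr1_opair a b : pr1 (opair a b) = a.
Proof.
apply the_eq; [definability| | |].
- rewrite union_opair, in_upair; auto.
- exists b; reflexivity.
- intros y _ [c e]; apply opair_inj in e; symmetry; apply e.
Qed.

Lemma pr2_opair a b : pr2 (opair a b) = b.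
Proof.
apply the_eq; [definability| | |].
- rewrite union_opair, in_upair; auto.
- exists a; reflexivity.
- intros y _ [c e]; apply opair_inj in e; symmetry; apply e.
Qed.

Lemma in_cprod a b p :
  p ∈ cprod a b <-> exists x y, x ∈ a /\ y ∈ b /\ p = opair x y.
Proof.
unfold cprod; rewrite in_union; split.
- intros (c & Hc & Hp); rewrite in_image in Hc by definability.
  destruct Hc as (x & Hx & ->).
  rewrite in_image in Hp by definability; destruct Hp as (y & Hy & ->); exists x, y; auto.
- intros (x & y & Hx & Hy & ->).
  exists (image b (fun y => opair x y)); rewrite !in_image by definability.
  split; eexists; split; eauto.
Qed.

Lemma opair_in_cprod a b x y : opair x y ∈ cprod a b <-> x ∈ a /\ y ∈ b.
Proof.
rewrite in_cprod; split; [|firstorder].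
intros (x' & y' & Hx & Hy & e); apply opair_inj in e; destruct e; subst; auto.
Qed.

Lemma ap_eq f x y :
  opair x y ∈ f -> (forall y', opair x y' ∈ f -> y' = y) -> ap f x = y.
Proof.
intros H K; apply the_eq; [definability| |exact H|auto].
(* By Kuratowski's coding both coordinates of a pair in [f] lie in [union (union f)], the set that
   [ap] searches. *)
rewrite in_union; exists (upair x y); rewrite in_upair; split; [|auto].
rewrite in_union; exists (opair x y); split; [exact H|].
unfold opair; rewrite in_upair; auto.
Qed.

Lemma opair_in_lam a (F : M -> M) x y : definable_term (fun v => F (v 0)) ->
  opair x y ∈ lam a F <-> x ∈ a /\ y = F x.
Proof.
intros D; unfold lam; rewrite in_image by definability; split.
- intros (x' & H & e); apply opair_inj in e; destruct e; subst; auto.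
- intros [H ->]; eauto.
Qed.

Lemma ap_lam a (F : M -> M) x : definable_term (fun v => F (v 0)) ->
  x ∈ a -> ap (lam a F) x = F x.
Proof.
intros D H; apply ap_eq.
- rewrite opair_in_lam by assumption; auto.
- intros y'; rewrite opair_in_lam by assumption; tauto.
Qed.

Lemma is_set_of_iff a (P : M -> Prop) :
  is_set_of a P <-> forall x, x ∈ a <-> P x.
Proof. unfold is_set_of; pose proof (no_atom a); tauto. Qed.

Lemma subset_iff a b : subset a b <-> forall x, x ∈ a -> x ∈ b.
Proof. unfold subset; pose proof (no_atom a); tauto. Qed.

Lemma is_upair_iff p a b : is_upair p a b <-> p = upair a b.
Proof.
unfold is_upair; rewrite is_set_of_iff; split.
- intros H; apply ext_eq; intros x; rewrite H, in_upair; reflexivity.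
- intros ->; apply in_upair.
Qed.

Lemma is_opair_iff p a b : is_opair p a b <-> p = opair a b.
Proof.
unfold is_opair; split.
- intros (s & t & Hs & Ht & Hp); rewrite is_upair_iff in Hs, Ht, Hp; subst; reflexivity.
- intros ->; exists (sing a), (upair a b); rewrite !is_upair_iff; auto.
Qed.

Lemma related_iff r x y : related r x y <-> opair x y ∈ r.
Proof.
unfold related; split; [|intros H; exists (opair x y); rewrite is_opair_iff; auto].
intros (p & H & K); rewrite is_opair_iff in K; subst; exact H.
Qed.

Lemma related_ap f X x y : is_fun_on f X -> 
  related f x y <-> x ∈ X /\ y = ap f x.
Proof.
intros (_ & H1 & H2).
assert (K : forall x y, related f x y -> x ∈ X).
{ intros x' y' (p & Hp & e); destruct (H1 p Hp) as (x2 & y2 & Hx & e2).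
  rewrite is_opair_iff in e, e2; subst; apply opair_inj in e2; destruct e2; subst; auto. }
assert (E : x ∈ X -> related f x (ap f x)).
{ intros Hx; destruct (H2 x Hx) as (z & Hz & Uz).
  rewrite (ap_eq f x z); [exact Hz| |].
  - apply related_iff, Hz.
  - intros y' Hy'; symmetry; apply Uz, related_iff, Hy'. }
split.
- intros H; split; [eauto|].
  destruct (H2 x (K _ _ H)) as (z & Hz & Uz).
  rewrite <- (Uz y H); apply Uz, E, (K _ _ H).
- intros [Hx ->]; auto.
Qed.

Lemma is_fun_lam X (F : M -> M) : definable_term (fun v => F (v 0)) ->
  is_fun_on (lam X F) X.
Proof.
intros D; split; [apply no_atom|split].
- intros p; unfold lam; rewrite in_image by definability.
  intros (x & Hx & ->); exists x, (F x); rewrite is_opair_iff; auto.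
- intros x Hx; exists (F x); split.
  + rewrite related_iff, opair_in_lam; auto.
  + intros y; rewrite related_iff, opair_in_lam by assumption.
    intros [_ ->]; reflexivity.
Qed.

Lemma related_lam X (F : M -> M) x y : definable_term (fun v => F (v 0)) ->
  related (lam X F) x y <-> x ∈ X /\ y = F x.
Proof. intros D; rewrite related_iff; apply opair_in_lam, D. Qed.

Lemma is_injection_lam X Y (F : M -> M) : definable_term (fun v => F (v 0)) ->
  (forall x, x ∈ X -> F x ∈ Y) ->
  (forall x y, x ∈ X -> y ∈ X -> F x = F y -> x = y) ->
  is_injection (lam X F) X Y.
Proof.
intros D H K; split; [split; [apply is_fun_lam, D|]|].
- intros x y; rewrite related_lam by assumption; intros [? ->]; auto.
- intros x x' y; rewrite !related_lam by assumption.
  intros [? ->] [? e]; auto.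
Qed.

Lemma is_injection_ap f X Y : is_injection f X Y ->
  (forall x, x ∈ X -> ap f x ∈ Y) /\
  (forall x y, x ∈ X -> y ∈ X -> ap f x = ap f y -> x = y).
Proof.
intros [[H1 H2] H3]; split.
- intros x Hx; apply (H2 x), (related_ap f X); auto.
- intros x y Hx Hy e; apply (H3 x y (ap f x)); apply (related_ap f X); auto.
Qed.

Lemma foundation (P : M -> Prop) a x : definable (fun v => P (v 0)) ->
  x ∈ a -> P x ->
  exists m, m ∈ a /\ P m /\ forall y, y ∈ a -> P y -> ~ y ∈ m.
Proof.
intros D Ha Hx.
pose proof (HM _ (ZF_of_ZFA _ ZFA_foundation) (fun _ => x) (sep a P)) as K.
assert (E : forall y, y ∈ sep a P <-> y ∈ a /\ P y) by (intros; apply in_sep, D).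
change (sat M (scons (sep a P) (fun _ => x)) (f_ex (f_mem 0 1)) ->
  sat M (scons (sep a P) (fun _ => x))
    (f_ex (f_and (f_mem 0 1) (f_not (f_ex (f_and (f_mem 0 1) (f_mem 0 2))))))) in K.
rewrite !sat_ex in K; destruct K as [m K].
- exists x; apply E; auto.
- rewrite sat_and, sat_not, sat_ex in K; destruct K as [H1 H2].
  apply E in H1; exists m; split; [|split]; [tauto|tauto|].
  intros y Hy Py Hm; apply H2; exists y; apply sat_and; split; [exact Hm|].
  apply E; auto.
Qed.

Lemma mem_irrefl a : ~ a ∈ a.
Proof.
intros H; destruct (foundation (fun x => x = a) (sing a) a) as (m & H1 & -> & H3).
- definability.
- apply in_sing; reflexivity.
- reflexivity.
- apply (H3 a); [apply in_sing| |]; auto.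
Qed.

Lemma mem_asym a b : a ∈ b -> ~ b ∈ a.
Proof.
intros H K.
destruct (foundation (fun _ => True) (upair a b) a) as (m & H1 & _ & H3).
- definability.
- apply in_upair; auto.
- exact I.
- rewrite in_upair in H1; destruct H1 as [-> | ->];
    [apply (H3 b)|apply (H3 a)]; rewrite ?in_upair; auto.
Qed.

(** Were they distinct, [a] and [b] would be elements of each other, against foundation. *)
Lemma succ_inj a b : succ a = succ b -> a = b.
Proof.
intros e; apply NNPP; intros n.
assert (H : a ∈ succ b) by (rewrite <- e, in_succ; auto).
assert (K : b ∈ succ a) by (rewrite e, in_succ; auto).
rewrite in_succ in H, K.
destruct H as [H|H]; [|auto]; destruct K as [K|K]; [|auto].
apply (mem_asym _ _ H K).
Qed.

Lemma succ_neq_emp a : succ a <> emp.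
Proof. intros e; apply (in_emp a); rewrite <- e, in_succ; auto. Qed.

Lemma is_empty_iff a : is_empty a <-> a = emp.
Proof.
unfold is_empty; rewrite is_set_of_iff; split.
- intros H; apply ext_eq; intros x; rewrite H; pose proof (in_emp x); tauto.
- intros -> x; pose proof (in_emp x); tauto.
Qed.

Lemma is_succ_iff s a : is_succ s a <-> s = succ a.
Proof.
unfold is_succ; rewrite is_set_of_iff; split.
- intros H; apply ext_eq; intros x; rewrite H, in_succ; reflexivity.
- intros ->; apply in_succ.
Qed.

Lemma inductive_iff a :
  inductive a <-> emp ∈ a /\ forall x, x ∈ a -> succ x ∈ a.
Proof.
unfold inductive; split.
- intros [(e & He & H) K]; rewrite is_empty_iff in He; subst; split; [exact H|].
  intros x Hx; destruct (K x Hx) as (s & Hs & L); rewrite is_succ_iff in Hs.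
  subst; exact L.
- intros [H K]; split.
  + exists emp; rewrite is_empty_iff; auto.
  + intros x Hx; exists (succ x); rewrite is_succ_iff; auto.
Qed.

Lemma inductive_ex : exists w : M, inductive w.
Proof.
destruct (dom_inhabited M) as [d].
pose proof (HM _ (ZF_of_ZFA _ ZFA_infinity) (fun _ => d)) as K.
unfold ax_infinity in K; apply sat_ex in K; destruct K as [w K]; exists w.
rewrite sat_and, sat_ex, sat_all in K; destruct K as [[e K1] K2].
rewrite !sat_and, sat_all in K1; destruct K1 as (_ & K1 & K1').
split.
- exists e; split; [|exact K1'].
  apply is_set_of_iff; intros x; specialize (K1 x); simpl in K1; tauto.
- intros x Hx; specialize (K2 x Hx).
  apply sat_ex in K2; destruct K2 as [s K2]; exists s.
  rewrite !sat_and, sat_all in K2; destruct K2 as (_ & K2 & K3).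
  split; [|exact K3].
  apply is_set_of_iff; intros y; specialize (K2 y).
  rewrite sat_iff, sat_or in K2; exact K2.
Qed.

Lemma omega_ex : exists w : M, is_omega w.
Proof.
destruct inductive_ex as [u Hu].
(* All inductive sets are intersected; the one supplied by the axiom of infinity bounds the
   intersection and makes it a set. *)
exists (sep u (fun n => forall v, inductive v -> n ∈ v)).
assert (D : definable (fun v : nat -> M => forall w, inductive w -> v 0 ∈ w))
  by definability.
split; [apply no_atom|split].
- rewrite inductive_iff; split.
  + rewrite in_sep by assumption; split; [apply inductive_iff, Hu|].
    intros v Hv; apply inductive_iff, Hv.
  + intros x; rewrite !in_sep by assumption; intros [H K].
    split; [apply inductive_iff; assumption|].
    intros v Hv; apply inductive_iff; auto.
- intros v Hv; apply subset_iff; intros x.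
  rewrite in_sep by assumption; intros [_ H]; auto.
Qed.

Lemma is_omega_omega : @is_omega M omega.
Proof. exact (epsilon_spec (dom_inhabited M) (@is_omega M) omega_ex). Qed.

Lemma is_omega_iff w : is_omega w <-> w = omega.
Proof.
split; [|intros ->; apply is_omega_omega].
intros Hw; pose proof is_omega_omega as Ho; apply ext_eq; intros x; split.
- apply subset_iff, Hw, Ho.
- apply subset_iff, Ho, Hw.
Qed.

Lemma omega0 : @mem M emp omega.
Proof. apply inductive_iff, (proj1 (proj2 is_omega_omega)). Qed.

Lemma omegaS n : n ∈ omega -> succ n ∈ omega.
Proof. apply inductive_iff, (proj1 (proj2 is_omega_omega)). Qed.

Lemma omega_ind (P : M -> Prop) : definable (fun v => P (v 0)) ->
  P emp -> (forall n, n ∈ omega -> P n -> P (succ n)) ->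
  forall n, n ∈ omega -> P n.
Proof.
intros D H0 HS n Hn.
assert (K : n ∈ sep omega P).
{ revert n Hn; apply subset_iff, is_omega_omega, inductive_iff.
  split; [|intros x]; rewrite !in_sep by assumption.
  - split; [apply omega0|exact H0].
  - intros []; split; [apply omegaS|apply HS]; assumption. }
rewrite in_sep in K by assumption; apply K.
Qed.

End Basics.

Ltac omega_induction :=
  match goal with
  | |- forall n, n ∈ omega -> @?P n => apply (omega_ind P); cbv beta; [definability| |]
  end.

(** * The order of the natural numbers *)

Section Omega.
Context {M : structure} {HM : model ZF M}.
Implicit Types a b k m n x y : M.

Lemma omega_cases n : n ∈ omega -> n = emp \/ exists m, m ∈ omega /\ n = succ m.
Proof.
revert n; omega_induction; [auto|]; intros n Hn _; right; eauto.
Qed.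

Lemma omega_transitive n m : n ∈ omega -> m ∈ n -> m ∈ omega.
Proof.
intros Hn; revert m; revert n Hn; omega_induction.
- intros m H; destruct (in_emp _ H).
- intros n Hn IH m; rewrite in_succ; intros [H| ->]; auto.
Qed.

Lemma nat_transitive n m k : n ∈ omega -> m ∈ n -> k ∈ m -> k ∈ n.
Proof.
intros Hn; revert m k; revert n Hn; omega_induction.
- intros m k H; destruct (in_emp _ H).
- intros n Hn IH m k; rewrite !in_succ; intros [H| ->] K; left; eauto.
Qed.

Lemma succ_le n m : n ∈ omega -> m ∈ n -> succ m ∈ n \/ succ m = n.
Proof.
intros Hn; revert m; revert n Hn; omega_induction.
- intros m H; destruct (in_emp _ H).
- intros n Hn IH m; rewrite !in_succ; intros [H| ->]; [|auto].
  destruct (IH m H); auto.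
Qed.

Lemma omega_trichotomy m n : m ∈ omega -> n ∈ omega -> m ∈ n \/ m = n \/ n ∈ m.
Proof.
intros Hm; revert n; revert m Hm; omega_induction.
- omega_induction; [auto|].
  intros n Hn [H|[<-|H]]; rewrite in_succ; auto; destruct (in_emp _ H).
- intros m Hm IH n Hn; rewrite !in_succ; destruct (IH n Hn) as [H|[<-|H]]; auto.
  destruct (succ_le n m Hn H); auto.
Qed.

(** Foundation gives a membership-minimal element, and trichotomy makes it the least one. *)
Lemma least_spec a n : (forall m, m ∈ a -> m ∈ omega) -> n ∈ a ->
  least a ∈ a /\ forall m, m ∈ a -> least a ∈ m \/ least a = m.
Proof.
intros Ha Hn.
destruct (foundation (fun _ => True) a n) as (k & Hk & _ & K); auto.
{ definability. }
assert (L : forall m, m ∈ a -> k ∈ m \/ k = m).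
{ intros m Hm; destruct (omega_trichotomy k m) as [|[|H]]; auto.
  destruct (K m Hm I H). }
enough (least a = k) as -> by auto.
apply the_eq; [definability|exact Hk|exact L|].
intros y Hy H; destruct (H k Hk) as [H'|]; [|auto].
destruct (K y Hy I H').
Qed.

End Omega.

(** * Countable sets *)

Section Countable.
Context {M : structure} {HM : model ZF M}.
Implicit Types a b f g h k m n p q r x y z X Y : M.

Lemma countable_iff X : countable X <-> exists f,
  (forall x, x ∈ X -> ap f x ∈ omega) /\
  (forall x y, x ∈ X -> y ∈ X -> ap f x = ap f y -> x = y).
Proof.
split.
- intros (w & f & Hw & Hf); rewrite is_omega_iff in Hw; subst w.
  exists f; apply is_injection_ap, Hf.
- intros (f & H1 & H2); exists omega, (lam X (fun x => ap f x)).
  rewrite is_omega_iff; split; [reflexivity|].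
  apply is_injection_lam; [definability| |]; auto.
Qed.

Lemma countable_of_injection X (F : M -> M) : definable_term (fun v => F (v 0)) ->
  (forall x, x ∈ X -> F x ∈ omega) ->
  (forall x y, x ∈ X -> y ∈ X -> F x = F y -> x = y) -> countable X.
Proof.
intros D H K; exists omega, (lam X F); rewrite is_omega_iff.
split; [reflexivity|apply is_injection_lam; assumption].
Qed.

Lemma countable_subset X Y :
  countable Y -> (forall x, x ∈ X -> x ∈ Y) -> countable X.
Proof.
rewrite !countable_iff; intros (f & H1 & H2) H; exists f; split; auto.
Qed.

Lemma countable_omega : @countable M omega.
Proof.
apply (countable_of_injection _ (fun x => x)); auto; definability.
Qed.

(** An element may have many codes [y]; taking the code with the least number turns a
    surjection-like relation from a countable set into an injection, without choice. *)
Lemma countable_of_relation (R : M -> M -> Prop) X Y :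
  definable (fun v => R (v 0) (v 1)) -> countable Y ->
  (forall x, x ∈ X -> exists y, y ∈ Y /\ R y x) ->
  (forall y x x', y ∈ Y -> x ∈ X -> x' ∈ X -> R y x -> R y x' -> x = x') ->
  countable X.
Proof.
intros D HY HX HR; apply countable_iff in HY; destruct HY as (f & H1 & H2).
set (S x := sep omega (fun n => exists y, y ∈ Y /\ R y x /\ n = ap f y)).
assert (HS : forall x n, n ∈ S x <->
  n ∈ omega /\ exists y, y ∈ Y /\ R y x /\ n = ap f y).
{ intros x n; unfold S; rewrite in_sep by definability; reflexivity. }
assert (L : forall x, x ∈ X -> least (S x) ∈ S x).
{ intros x Hx; destruct (HX x Hx) as (y & Hy & K).
  apply (least_spec (S x) (ap f y)).
  - intros m Hm; apply HS in Hm; apply Hm.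
  - apply HS; split; [auto|exists y; auto]. }
apply (countable_of_injection _ (fun x => least (S x))).
- unfold S; definability.
- intros x Hx; apply (HS x), L, Hx.
- intros x x' Hx Hx' e.
  destruct (proj1 (HS x _) (L x Hx)) as (_ & y & Hy & K & e1).
  destruct (proj1 (HS x' _) (L x' Hx')) as (_ & y' & Hy' & K' & e2).
  assert (y = y') by (apply H2; congruence); subst y'.
  apply (HR y); auto.
Qed.

(** The graph is the smallest relation that contains the starting pair and is closed under the
    recursion step, carved out of [cprod omega A]. *)
Lemma recursion (F : M -> M) A a : definable_term (fun v => F (v 0)) ->
  a ∈ A -> (forall x, x ∈ A -> F x ∈ A) ->
  exists h, ap h emp = a /\
    forall n, n ∈ omega -> ap h n ∈ A /\ ap h (succ n) = F (ap h n).
Proof.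
intros D Ha HF.
set (closed r := opair emp a ∈ r /\
  forall n x, opair n x ∈ r -> opair (succ n) (F x) ∈ r).
assert (Dc : definable (fun v => closed (v 0))) by (unfold closed; definability).
set (H := sep (cprod omega A) (fun p => forall r, closed r -> p ∈ r)).
assert (HH : forall n x, opair n x ∈ H <->
  n ∈ omega /\ x ∈ A /\ forall r, closed r -> opair n x ∈ r).
{ intros n x; unfold H; rewrite in_sep by definability.
  rewrite opair_in_cprod; tauto. }
assert (H0 : opair emp a ∈ H).
{ apply HH; split; [apply omega0|split; [exact Ha|]]; intros r []; assumption. }
assert (HS : forall n x, opair n x ∈ H -> opair (succ n) (F x) ∈ H).
{ intros n x (Hn & Hx & K)%HH; apply HH; split; [apply omegaS, Hn|split; [auto|]].
  intros r Hr; apply Hr, K, Hr. }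
(* Induction along the graph: the pairs of [H] that satisfy [P] form a closed relation, so they
   exhaust [H] by minimality. *)
assert (inv : forall (P : M -> M -> Prop), definable (fun v => P (v 0) (v 1)) ->
  P emp a -> (forall n x, opair n x ∈ H -> P n x -> P (succ n) (F x)) ->
  forall n x, opair n x ∈ H -> P n x).
{ intros P DP P0 PS n x Hnx.
  set (r := sep H (fun p => P (pr1 p) (pr2 p))).
  assert (Hr : forall n x, opair n x ∈ r <-> opair n x ∈ H /\ P n x).
  { intros m y; unfold r; rewrite in_sep by definability.
    rewrite pr1_opair, pr2_opair; reflexivity. }
  apply Hr, HH; [exact Hnx|]; split.
  - apply Hr; auto.
  - intros m y (K1 & K2)%Hr; apply Hr; auto. }
assert (cases : forall n x, opair n x ∈ H ->
  n = emp /\ x = a \/ exists m y, opair m y ∈ H /\ n = succ m /\ x = F y).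
{ apply (inv (fun n x => n = emp /\ x = a \/
    exists m y, opair m y ∈ H /\ n = succ m /\ x = F y)); [definability|auto|].
  intros n x K _; right; exists n, x; auto. }
assert (fn : forall n, n ∈ omega -> 
  exists x, opair n x ∈ H /\ forall y, opair n y ∈ H -> y = x).
{ omega_induction.
  - exists a; split; [exact H0|]; intros y K.
    destruct (cases _ _ K) as [[_ ->]|(m & z & _ & e & _)]; [reflexivity|].
    symmetry in e; destruct (succ_neq_emp _ e).
  - intros n Hn (x & K1 & K2); exists (F x); split; [auto|]; intros y K.
    destruct (cases _ _ K) as [[e _]|(m & z & K' & e & ->)].
    + destruct (succ_neq_emp _ e).
    + apply succ_inj in e; subst m; rewrite (K2 z K'); reflexivity. }
assert (E : forall n, n ∈ omega ->
  opair n (ap H n) ∈ H /\ forall y, opair n y ∈ H -> y = ap H n).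
{ intros n Hn; destruct (fn n Hn) as (x & K1 & K2).
  rewrite (ap_eq H n x); auto. }
exists H; split.
- symmetry; apply E; [apply omega0|exact H0].
- intros n Hn; destruct (E n Hn) as [K1 K2]; split; [apply HH in K1; tauto|].
  symmetry; apply E; [apply omegaS, Hn|auto].
Qed.

(* The pairs are enumerated along the boundaries of the squares [0..k]^2. *)
Lemma countable_omega2 : countable (@cprod M omega omega).
Proof.
(* The walk climbs the column of [m] to the diagonal, follows the row of [n] leftwards to 0, then
   jumps to the foot of the next column. *)
set (step p q := exists m n, p = opair m n /\
  ((n ∈ m /\ q = opair m (succ n)) \/
   (~ n ∈ m /\ m = emp /\ q = opair (succ n) emp) \/
   (~ n ∈ m /\ exists k, m = succ k /\ q = opair k n))).
set (F p := the (cprod omega omega) (step p)).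
assert (Ds : definable (fun v => step (v 0) (v 1))) by (unfold step; definability).
assert (HF : forall p q, q ∈ cprod omega omega -> step p q -> F p = q).
{ intros p q Hq S; apply the_eq; [definability|exact Hq|exact S|].
  intros q' _ (m & n & -> & S'); destruct S as (m' & n' & e & S).
  apply opair_inj in e; destruct e; subst m' n'.
  destruct S as [[H ->]|[(H & -> & ->)|(H & k & -> & ->)]],
    S' as [[H' ->]|[(H' & e & ->)|(H' & k' & e & ->)]]; try tauto.
  - symmetry in e; destruct (succ_neq_emp _ e).
  - destruct (succ_neq_emp _ e).
  - apply succ_inj in e; subst; reflexivity. }
assert (Hs : forall p, p ∈ cprod omega omega -> 
  exists q, q ∈ cprod omega omega /\ step p q).
{ intros p; rewrite in_cprod; intros (m & n & Hm & Hn & ->).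
  destruct (classic (n ∈ m)) as [H|H].
  - exists (opair m (succ n)); rewrite opair_in_cprod; split.
    + split; [exact Hm|apply omegaS, Hn].
    + exists m, n; auto.
  - destruct (omega_cases m Hm) as [-> |(k & Hk & ->)].
    + exists (opair (succ n) emp); rewrite opair_in_cprod; split.
      * split; [apply omegaS, Hn|exact Hm].
      * exists emp, n; split; [reflexivity|]; right; left; auto.
    + exists (opair k n); rewrite opair_in_cprod; split; [auto|].
      exists (succ k), n; split; [reflexivity|]; right; right; eauto. }
assert (DF : definable_term (fun v => F (v 0))) by (unfold F; definability).
destruct (recursion F (cprod omega omega) (opair emp emp)) as (h & h0 & hS).
- definability.
- apply opair_in_cprod; split; apply omega0.
- intros p Hp; destruct (Hs p Hp) as (q & Hq & S).
  rewrite (HF p q Hq S); exact Hq.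
- set (R p := exists n, n ∈ omega /\ ap h n = p).
  assert (DR : definable (fun v => R (v 0))) by (unfold R; definability).
  assert (RS : forall p q, q ∈ cprod omega omega -> R p -> step p q -> R q).
  { intros p q Hq (n & Hn & e) S; exists (succ n); split; [apply omegaS, Hn|].
    destruct (hS n Hn) as [_ ->]; rewrite e; auto. }
  assert (up : forall k, k ∈ omega -> R (opair k emp) ->
    forall n, n ∈ omega -> n ∈ k \/ n = k -> R (opair k n)).
  { intros k Hk Rk; omega_induction; [auto|].
    intros n Hn IH L.
    assert (K : n ∈ k).
    { destruct L as [L| <-]; [|apply in_succ; auto].
      apply (nat_transitive k (succ n)); rewrite ?in_succ; auto. }
    apply (RS (opair k n)).
    - apply opair_in_cprod; auto using omegaS.
    - auto.
    - exists k, n; auto. }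
  assert (left : forall k, k ∈ omega -> R (opair k emp) ->
    forall m, m ∈ omega -> m ∈ k \/ m = k -> R (opair m k)).
  { intros k Hk Rk m Hm L; apply NNPP; intros N.
    apply (fun H => H (up k Hk Rk k Hk (or_intror eq_refl))).
    (* The walk leftwards from [k] to [m] is cast as an ascending induction: if the pair at [m] were
       never reached, neither would be any pair between [m] and [k] on that row, against [up]. *)
    assert (Q : forall j, j ∈ omega -> m ∈ j \/ m = j -> j ∈ k \/ j = k ->
      ~ R (opair j k)).
    { omega_induction.
      - intros [H| ->] _; [destruct (in_emp _ H)|exact N].
      - intros j Hj IH H1 H2 RR.
        assert (Hjk : j ∈ k).
        { destruct H2 as [H2| <-]; [|apply in_succ; auto].
          apply (nat_transitive k (succ j)); rewrite ?in_succ; auto. }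
        destruct H1 as [H1| ->]; [|auto].
        rewrite in_succ in H1.
        apply IH; [destruct H1; auto|auto|].
        apply (RS (opair (succ j) k)).
        + apply opair_in_cprod; auto.
        + exact RR.
        + exists (succ j), k; split; [reflexivity|]; right; right.
          split; [|exists j; auto].
          intros H; apply in_succ in H; destruct H as [H| ->].
          * apply (mem_asym _ _ H Hjk).
          * apply (mem_irrefl _ Hjk). }
    apply Q; auto. }
  assert (all : forall k, k ∈ omega -> R (opair k emp)).
  { omega_induction.
    - exists emp; split; [apply omega0|exact h0].
    - intros k Hk IH; apply (RS (opair emp k)).
      + apply opair_in_cprod; auto using omegaS, omega0.
      + apply (left k Hk IH _ omega0).
        destruct (omega_trichotomy emp k) as [|[|H]]; auto using omega0.
        destruct (in_emp _ H).
      + exists emp, k; split; [reflexivity|]; right; left.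
        split; [apply in_emp|auto]. }
  apply (countable_of_relation (fun n p => p = ap h n) _ omega).
  + definability.
  + apply countable_omega.
  + intros p; rewrite in_cprod; intros (m & n & Hm & Hn & ->).
    assert (K : R (opair m n)); [|destruct K as (i & Hi & e); eauto].
    destruct (omega_trichotomy m n) as [H|[H|H]]; auto.
  + intros; subst; reflexivity.
Qed.

Lemma countable_cup X Y : countable X -> countable Y -> countable (cup X Y).
Proof.
intros (f & f1 & f2)%countable_iff (g & g1 & g2)%countable_iff.
apply (countable_of_relation (fun p x => exists n,
  (p = opair emp n /\ x ∈ X /\ n = ap f x) \/
  (p = opair (succ emp) n /\ x ∈ Y /\ n = ap g x)) _ (cprod omega omega)).
- definability.
- apply countable_omega2.
- intros x; rewrite in_cup; intros [H|H].
  + exists (opair emp (ap f x)); split.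
    * apply opair_in_cprod; auto using omega0.
    * exists (ap f x); auto.
  + exists (opair (succ emp) (ap g x)); split.
    * apply opair_in_cprod; auto using omega0, omegaS.
    * exists (ap g x); auto.
- intros p x x' _ _ _ (n & [(-> & H1 & H2)|(-> & H1 & H2)])
    (n' & [(e & H1' & H2')|(e & H1' & H2')]); apply opair_inj in e.
  + apply f2; intuition congruence.
  + destruct (succ_neq_emp emp); intuition congruence.
  + destruct (succ_neq_emp emp); intuition congruence.
  + apply g2; intuition congruence.
Qed.

Lemma countable_finite X : finite X -> countable X.
Proof.
intros (w & n & Hw & Hn & f & Hf & _); rewrite is_omega_iff in Hw; subst w.
apply is_injection_ap in Hf; destruct Hf as [H1 H2].
apply countable_iff; exists f; split; [|exact H2].
intros x Hx; apply (omega_transitive n); auto.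
Qed.

Lemma finite_sing x : finite (sing x).
Proof.
exists omega, (succ emp); rewrite is_omega_iff; split; [reflexivity|].
split; [apply omegaS, omega0|]; exists (lam (sing x) (fun _ => emp)).
split; [apply is_injection_lam|]; try definability.
- intros; apply in_succ; auto.
- intros y z; rewrite !in_sing; congruence.
- intros y; rewrite in_succ; intros [H| ->]; [destruct (in_emp _ H)|].
  exists x; rewrite related_lam by definability; rewrite in_sing; auto.
Qed.

Lemma finite_emp : @finite M emp.
Proof.
exists omega, emp; rewrite is_omega_iff; split; [reflexivity|].
split; [apply omega0|]; exists (lam emp (fun x => x)).
split; [apply is_injection_lam; auto; definability|].
intros y H; destruct (in_emp _ H).
Qed.

End Countable.

(** * Linear orders and choice *)

Section Orders.
Context {M : structure} {HM : model ZF M}.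
Implicit Types a b c f g h k m n p q r x y z A C E F G T U V X Y Z : M.

Lemma opair_in_order_on X (R : M -> M -> Prop) x y :
  definable (fun v => R (v 0) (v 1)) ->
  opair x y ∈ order_on X R <-> x ∈ X /\ y ∈ X /\ R x y.
Proof.
intros D; unfold order_on; rewrite in_sep by definability.
rewrite opair_in_cprod, pr1_opair, pr2_opair; tauto.
Qed.

Lemma linear_order_on X (R : M -> M -> Prop) :
  definable (fun v => R (v 0) (v 1)) ->
  (forall x, x ∈ X -> R x x) ->
  (forall x y, x ∈ X -> y ∈ X -> R x y -> R y x -> x = y) ->
  (forall x y z, x ∈ X -> y ∈ X -> z ∈ X -> R x y -> R y z -> R x z) ->
  (forall x y, x ∈ X -> y ∈ X -> R x y \/ R y x) ->
  linear_order (order_on X R) X.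
Proof.
intros D R1 R2 R3 R4; split; [apply no_atom|].
assert (E : forall x y, related (order_on X R) x y <-> x ∈ X /\ y ∈ X /\ R x y).
{ intros x y; rewrite related_iff; apply opair_in_order_on, D. }
repeat split.
- intros p; unfold order_on; rewrite in_sep, in_cprod by definability.
  intros [(x & y & Hx & Hy & ->) _]; exists x, y; rewrite is_opair_iff; auto.
- intros x Hx; apply E; auto.
- intros x y; rewrite !E; intros (? & ? & ?) (? & ? & ?); auto.
- intros x y z; rewrite !E; intros (? & ? & ?) (? & ? & ?); eauto.
- intros x y Hx Hy; rewrite !E; destruct (R4 x y); auto.
Qed.

Lemma linear_order_elim r X : linear_order r X ->
  (forall x y, opair x y ∈ r -> x ∈ X /\ y ∈ X) /\
  (forall x, x ∈ X -> opair x x ∈ r) /\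
  (forall x y, opair x y ∈ r -> opair y x ∈ r -> x = y) /\
  (forall x y z, opair x y ∈ r -> opair y z ∈ r -> opair x z ∈ r) /\
  (forall x y, x ∈ X -> y ∈ X -> opair x y ∈ r \/ opair y x ∈ r).
Proof.
intros (_ & H1 & H2 & H3 & H4 & H5).
setoid_rewrite <- related_iff.
split; [|split; [exact H2|split; [exact H3|split; [exact H4|exact H5]]]].
intros x y (p & Hp & e); destruct (H1 p Hp) as (x' & y' & Hx & Hy & e').
rewrite is_opair_iff in e, e'; subst; apply opair_inj in e'; destruct e'; subst; auto.
Qed.

(** Trades the internal sequence for definable class functions on omega, so that later constructions
    index by [n] without decoding pairs. *)
Lemma sequence_elim (Q : M -> M -> Prop) G F : sequence_of_linear_orders Q G F ->
  exists X r : M -> M,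
    definable_term (fun v => X (v 0)) /\ definable_term (fun v => r (v 0)) /\
    (forall n, n ∈ omega -> linear_order (r n) (X n) /\ Q (X n) (r n)) /\
    (forall Y, Y ∈ F <-> exists n, n ∈ omega /\ Y = X n).
Proof.
intros (w & Hw & HG & H1 & H2); rewrite is_omega_iff in Hw; subst w.
exists (fun n => pr1 (ap G n)), (fun n => pr2 (ap G n)).
split; [definability|split; [definability|split]].
- intros n Hn; destruct (H1 n (ap G n)) as (X & r & e & _ & HX & HQ).
  + apply (related_ap G omega); auto.
  + rewrite is_opair_iff in e; rewrite e, pr1_opair, pr2_opair; auto.
- intros Y; rewrite is_set_of_iff in H2; rewrite H2; split.
  + intros (n & q & r & H & e); rewrite is_opair_iff in e; subst q.
    apply (related_ap G omega) in H; [|exact HG]; destruct H as [Hn e].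
    exists n; rewrite <- e, pr1_opair; auto.
  + intros (n & Hn & ->).
    assert (K : related G n (ap G n)) by (apply (related_ap G omega); auto).
    destruct (H1 n _ K) as (X & r & e & _).
    exists n, (ap G n), r; split; [exact K|].
    rewrite is_opair_iff in *; rewrite e, pr1_opair; reflexivity.
Qed.

Lemma sequence_intro (Q : M -> M -> Prop) (X r : M -> M) :
  definable_term (fun v => X (v 0)) -> definable_term (fun v => r (v 0)) ->
  (forall n, n ∈ omega -> linear_order (r n) (X n) /\ Q (X n) (r n)) ->
  sequence_of_linear_orders Q (lam omega (fun n => opair (X n) (r n)))
    (image omega X).
Proof.
intros DX Dr H; exists omega; rewrite is_omega_iff; split; [reflexivity|].
split; [apply is_fun_lam; definability|split].
- intros n q; rewrite related_lam by definability; intros [Hn ->].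
  destruct (H n Hn); exists (X n), (r n); rewrite is_opair_iff.
  repeat split; auto; try apply no_atom; apply H, Hn.
- apply is_set_of_iff; intros Y; rewrite in_image by definability; split.
  + intros (n & Hn & ->); exists n, (opair (X n) (r n)), (r n).
    rewrite is_opair_iff, related_lam by definability; auto.
  + intros (n & q & r' & K & e); rewrite is_opair_iff in e.
    rewrite related_lam in K by definability; destruct K as [Hn K].
    rewrite K in e; apply opair_inj in e; destruct e; eauto.
Qed.

Lemma choice_function_iff F :
  has_choice_function F <-> exists c, forall X, X ∈ F -> ap c X ∈ X.
Proof.
split.
- intros (c & H1 & H2); exists c; intros X HX; apply H2, (related_ap c F); auto.
- intros (c & H); exists (lam F (fun X => ap c X)).
  split; [apply is_fun_lam; definability|].
  intros a x; rewrite related_lam by definability; intros [Ha ->]; auto.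
Qed.

(** The [X n] may repeat, so [F] need not be denumerable; the tagged copies [Y n] are pairwise
    distinct because they are nonempty. The given orders are carried over to them. *)
Lemma CAC_LO_CAC_DLO : CAC_LO M -> CAC_DLO M.
Proof.
intros CAC G F (X & r & DX & Dr & H & HF)%sequence_elim.
set (Y n := cprod (sing n) (X n)).
assert (HY : forall n p, p ∈ Y n <-> exists x, x ∈ X n /\ p = opair n x).
{ intros n p; unfold Y; rewrite in_cprod; setoid_rewrite in_sing; split.
  - intros (m & x & -> & Hx & e); eauto.
  - intros (x & Hx & e); eauto 6. }
assert (DY : definable_term (fun v => Y (v 0))) by (unfold Y; definability).
assert (Yinj : forall n m, n ∈ omega -> Y n = Y m -> n = m).
{ intros n m Hn e; destruct (H n Hn) as [_ [x Hx]].
  assert (K : opair n x ∈ Y m) by (rewrite <- e, HY; eauto).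
  rewrite HY in K; destruct K as (y & _ & e'); apply opair_inj in e'; apply e'. }
assert (K : has_choice_function (image omega Y));
  [apply CAC|apply choice_function_iff in K; destruct K as [c Hc]].
- exists omega; rewrite is_omega_iff; split; [reflexivity|].
  exists (image omega (fun n => opair (Y n) n)).
  assert (E : forall y n, related (image omega (fun n => opair (Y n) n)) y n <->
    n ∈ omega /\ y = Y n).
  { intros y n; rewrite related_iff, in_image by definability; split.
    - intros (m & Hm & e); apply opair_inj in e; destruct e; subst; auto.
    - intros [Hn ->]; eauto. }
  split; [split; [split; [split; [apply no_atom|split]|]|]|].
  + intros p; rewrite in_image by definability; intros (n & Hn & ->).
    exists (Y n), n; rewrite is_opair_iff, in_image by definability; eauto.
  + intros y; rewrite in_image by definability; intros (n & Hn & ->).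
    exists n; split; [apply E; auto|].
    intros m [Hm e]%E; apply Yinj; auto.
  + intros y n [Hn _]%E; exact Hn.
  + intros y y' n [_ ->]%E [_ ->]%E; reflexivity.
  + intros n Hn; exists (Y n); apply E; auto.
- intros Z; rewrite in_image by definability; intros (n & Hn & ->).
  destruct (H n Hn) as [L [x Hx]]; split.
  + exists (opair n x); apply HY; eauto.
  + split; [apply no_atom|].
    apply linear_order_elim in L; destruct L as (_ & L1 & L2 & L3 & L4).
    exists (order_on (Y n) (fun p q => opair (pr2 p) (pr2 q) ∈ r n)).
    apply linear_order_on; [definability| | | |]; repeat setoid_rewrite HY.
    * intros p (y & Hy & ->); rewrite pr2_opair; auto.
    * intros p q (y & Hy & ->) (y' & Hy' & ->); rewrite !pr2_opair.
      intros; f_equal; auto.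
    * intros p q s (y & Hy & ->) (y' & Hy' & ->) (y2 & Hy2 & ->).
      rewrite !pr2_opair; eauto.
    * intros p q (y & Hy & ->) (y' & Hy' & ->); rewrite !pr2_opair; auto.
(* A member of [F] can occur at several indices; its chosen element is read off at the least one. *)
- set (S Z := sep omega (fun n => Z = X n)).
  assert (DS : definable_term (fun v => S (v 0))) by (unfold S; definability).
  apply choice_function_iff.
  exists (lam F (fun Z => pr2 (ap c (Y (least (S Z)))))); intros Z HZ.
  rewrite ap_lam by (assumption || definability).
  assert (HS : forall n, n ∈ S Z <-> n ∈ omega /\ Z = X n).
  { intros n; unfold S; rewrite in_sep by definability; reflexivity. }
  apply HF in HZ; destruct HZ as (n & Hn & e).
  assert (K : least (S Z) ∈ S Z).
  { apply (least_spec _ n); [|apply HS; auto].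
    intros m Hm; apply HS in Hm; apply Hm. }
  apply HS in K; destruct K as [K e'].
  specialize (Hc (Y (least (S Z)))); rewrite in_image in Hc by definability.
  specialize (Hc ltac:(eauto)); apply HY in Hc; destruct Hc as (x & Hx & ->).
  rewrite pr2_opair, e' at 1; exact Hx.
Qed.

Lemma CAC_DLO_choice (X r : M -> M) : CAC_DLO M ->
  definable_term (fun v => X (v 0)) -> definable_term (fun v => r (v 0)) ->
  (forall n, n ∈ omega -> linear_order (r n) (X n) /\ nonempty (X n)) ->
  exists c, forall n, n ∈ omega -> ap c n ∈ X n.
Proof.
intros CAC DX Dr H.
pose proof (CAC _ _ (sequence_intro (fun X _ => nonempty X) X r DX Dr H))
  as (c & Hc)%choice_function_iff.
exists (lam omega (fun n => ap c (X n))); intros n Hn.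
rewrite ap_lam by (assumption || definability).
apply Hc; rewrite in_image by definability; eauto.
Qed.

(* Countable subsets of [X] cannot be linearly ordered in general, but partial
   injections from [X] to omega can, lexicographically. *)
Section PartialInjections.
Variables X r : M.
Hypothesis Hr : linear_order r X.

(** A point may carry several numbers; what counts is that each column, the set of points with a
    given number, has at most one element. *)
Definition partial_injections : M :=
  sep (power (cprod X omega)) (fun g => forall n x y,
    opair x n ∈ g -> opair y n ∈ g -> x = y).

(** The first column in which the relations differ decides, and an empty column precedes a filled
    one. *)
Definition lex_lt g h : Prop :=
  exists n, n ∈ omega /\
    (forall m, m ∈ n -> forall x, opair x m ∈ g <-> opair x m ∈ h) /\
    exists y, opair y n ∈ h /\
      forall x, opair x n ∈ g -> opair x y ∈ r /\ x <> y.

Lemma in_partial_injections g : g ∈ partial_injections <->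
  (forall p, p ∈ g -> p ∈ cprod X omega) /\
  forall n x y, opair x n ∈ g -> opair y n ∈ g -> x = y.
Proof.
unfold partial_injections; rewrite in_sep by definability.
rewrite in_power; reflexivity.
Qed.

Lemma lex_lt_irrefl g : ~ lex_lt g g.
Proof. intros (n & _ & _ & y & Hy & K); apply (K y Hy); reflexivity. Qed.

Lemma lex_lt_trans g h k : lex_lt g h -> lex_lt h k -> lex_lt g k.
Proof.
intros (n & Hn & A1 & y & Hy & K1) (m & Hm & A2 & z & Hz & K2).
apply linear_order_elim in Hr; destruct Hr as (_ & _ & L2 & L3 & _).
destruct (omega_trichotomy n m Hn Hm) as [H|[<-|H]].
- exists n; split; [exact Hn|split].
  + intros i Hi x; rewrite A1, A2 by eauto using nat_transitive; reflexivity.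
  + exists y; split; [apply (A2 n H), Hy|exact K1].
- exists n; split; [exact Hn|split].
  + intros i Hi x; rewrite A1, A2 by auto; reflexivity.
  + exists z; split; [exact Hz|]; intros x Hx.
    destruct (K1 x Hx) as [H1 H2], (K2 y Hy) as [H3 H4]; split; [eauto|].
    intros <-; apply H2, L2; assumption.
- exists m; split; [exact Hm|split].
  + intros i Hi x; rewrite A1, A2 by eauto using nat_transitive; reflexivity.
  + exists z; split; [exact Hz|]; intros x Hx; apply K2, (A1 m H), Hx.
Qed.

Lemma lex_lt_total g h : g ∈ partial_injections -> h ∈ partial_injections ->
  g = h \/ lex_lt g h \/ lex_lt h g.
Proof.
intros [G1 G2]%in_partial_injections [H1 H2]%in_partial_injections.
apply linear_order_elim in Hr; destruct Hr as (_ & _ & _ & _ & L4).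
destruct (classic (g = h)) as [e|ne]; [auto|right].
(* The columns in which the two relations differ; the least of them decides the comparison. *)
set (D := sep omega (fun n => ~ forall x, opair x n ∈ g <-> opair x n ∈ h)).
assert (HD : forall n, n ∈ D <->
  n ∈ omega /\ ~ forall x, opair x n ∈ g <-> opair x n ∈ h).
{ intros n; unfold D; rewrite in_sep by definability; reflexivity. }
assert (N : exists n, n ∈ D).
{ apply NNPP; intros N; apply ne, ext_eq; intros p.
  assert (K : forall x n, n ∈ omega -> opair x n ∈ g <-> opair x n ∈ h).
  { intros x n Hn; apply NNPP; intros C; apply N; exists n; apply HD; auto. }
  split; intros Hp; [pose proof (G1 p Hp) as L|pose proof (H1 p Hp) as L];
    rewrite in_cprod in L; destruct L as (x & n & _ & Hn & ->); apply K; auto. }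
destruct N as [n Hn].
destruct (least_spec D n) as [K1 K2].
{ intros m Hm; apply HD in Hm; apply Hm. }
{ exact Hn. }
clear n Hn; revert K1 K2; generalize (least D); intros n K1 K2.
apply HD in K1; destruct K1 as [Hn K1].
assert (A : forall m, m ∈ n -> forall x, opair x m ∈ g <-> opair x m ∈ h).
{ intros m Hm; apply NNPP; intros C.
  destruct (K2 m) as [K|<-].
  - apply HD; split; [apply (omega_transitive n); auto|exact C].
  - apply (mem_asym _ _ K Hm).
  - apply (mem_irrefl _ Hm). }
assert (A' : forall m, m ∈ n -> forall x, opair x m ∈ h <-> opair x m ∈ g).
{ intros m Hm x; symmetry; auto. }
destruct (classic (exists x, opair x n ∈ g)) as [[x Hx]|Ng].
- destruct (classic (exists y, opair y n ∈ h)) as [[y Hy]|Nh].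
  + assert (xy : x <> y).
    { intros <-; apply K1; intros z; split; intros Hz.
      - rewrite (G2 n z x); auto.
      - rewrite (H2 n z x); auto. }
    assert (x ∈ X /\ y ∈ X) as [].
    { pose proof (G1 _ Hx) as L; pose proof (H1 _ Hy) as L'.
      rewrite opair_in_cprod in L, L'; tauto. }
    destruct (L4 x y) as [L|L]; auto; [left|right];
      exists n; (split; [exact Hn|split; [assumption|]]).
    * exists y; split; [exact Hy|]; intros x' Hx'; rewrite (G2 n x' x); auto.
    * exists x; split; [exact Hx|]; intros y' Hy'; rewrite (H2 n y' y); auto.
  + right; exists n; split; [exact Hn|split; [assumption|]].
    exists x; split; [exact Hx|]; intros y Hy; destruct Nh; eauto.
- left; exists n; split; [exact Hn|split; [assumption|]].
  assert (Nh : exists y, opair y n ∈ h).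
  { apply NNPP; intros Nh; apply K1; intros z; split; intros Hz;
      [destruct Ng|destruct Nh]; eauto. }
  destruct Nh as [y Hy]; exists y; split; [exact Hy|].
  intros x Hx; destruct Ng; eauto.
Qed.

Lemma lex_linear_order Y : (forall g, g ∈ Y -> g ∈ partial_injections) ->
  linear_order (order_on Y (fun g h => g = h \/ lex_lt g h)) Y.
Proof.
intros HY; apply linear_order_on.
- unfold lex_lt; definability.
- auto.
- intros g h _ _ [|H]; [auto|]; intros [|K]; [auto|].
  destruct (lex_lt_irrefl g (lex_lt_trans _ _ _ H K)).
- intros g h k _ _ _ [-> |H]; [auto|]; intros [<-|K]; [auto|].
  right; apply (lex_lt_trans _ _ _ H K).
- intros g h Hg Hh; destruct (lex_lt_total g h) as [|[|]]; auto.
Qed.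

(** One application of choice picks relations whose domains satisfy [Phi n], and [z] is the union of
    these domains. A pair of an index [n] and a number [k] determines at most one point of [z], so
    [z] is countable. *)
Lemma countable_subsets_choice (Phi : M -> M -> Prop) : CAC_DLO M ->
  definable (fun v => Phi (v 0) (v 1)) ->
  (forall n, n ∈ omega ->
    exists z, (forall x, x ∈ z -> x ∈ X) /\ countable z /\ Phi n z) ->
  exists z, (forall x, x ∈ z -> x ∈ X) /\ countable z /\
    (forall n, n ∈ omega -> exists u, (forall x, x ∈ u -> x ∈ z) /\ Phi n u) /\
    (forall x, x ∈ z -> exists n u, n ∈ omega /\ Phi n u /\ x ∈ u).
Proof.
intros CAC DPhi H.
set (dm g := sep X (fun x => exists k, opair x k ∈ g)).
assert (Hdm : forall g x, x ∈ dm g <-> x ∈ X /\ exists k, opair x k ∈ g).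
{ intros g x; unfold dm; rewrite in_sep by definability; reflexivity. }
assert (Ddm : definable_term (fun v => dm (v 0))) by (unfold dm; definability).
set (Y n := sep partial_injections (fun g => Phi n (dm g))).
assert (HY : forall n g, g ∈ Y n <-> g ∈ partial_injections /\ Phi n (dm g)).
{ intros n g; unfold Y; rewrite in_sep by definability; reflexivity. }
assert (DY : definable_term (fun v => Y (v 0))) by (unfold Y; definability).
destruct (CAC_DLO_choice Y
  (fun n => order_on (Y n) (fun g h => g = h \/ lex_lt g h)) CAC) as (c & Hc).
- definability.
- unfold lex_lt; definability.
- intros n Hn; split.
  + apply lex_linear_order; intros g Hg; apply HY in Hg; apply Hg.
  + destruct (H n Hn) as (z & Hz & (f & f1 & f2)%countable_iff & K).
    exists (lam z (fun x => ap f x)); apply HY; split.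
    * apply in_partial_injections; split.
      -- intros p; unfold lam; rewrite in_image by definability.
         intros (x & Hx & ->); apply opair_in_cprod; auto.
      -- intros m x y; rewrite !opair_in_lam by definability.
         intros [Hx e] [Hy e']; apply f2; congruence.
    * replace (dm (lam z (fun x => ap f x))) with z; [exact K|].
      apply ext_eq; intros x; rewrite Hdm; setoid_rewrite opair_in_lam;
        [|definability]; split; [eauto 6|].
      intros (_ & k & Hx & _); exact Hx.
- set (z := sep X (fun x => exists n k, n ∈ omega /\ opair x k ∈ ap c n)).
  assert (Hz : forall x, x ∈ z <->
    x ∈ X /\ exists n k, n ∈ omega /\ opair x k ∈ ap c n).
  { intros x; unfold z; rewrite in_sep by definability; reflexivity. }
  assert (Hcn : forall n, n ∈ omega -> ap c n ∈ partial_injections /\ Phi n (dm (ap c n))).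
  { intros n Hn; apply HY, Hc, Hn. }
  exists z; split; [|split; [|split]].
  + intros x Hx; apply Hz in Hx; apply Hx.
  + apply (countable_of_relation (fun p x => exists n k, p = opair n k /\
      opair x k ∈ ap c n) _ (cprod omega omega)).
    * definability.
    * apply countable_omega2.
    * intros x Hx; apply Hz in Hx; destruct Hx as (Hx & n & k & Hn & K).
      exists (opair n k); split; [|eauto].
      apply opair_in_cprod; split; [exact Hn|].
      destruct (proj1 (in_partial_injections _) (proj1 (Hcn n Hn))) as [L _].
      apply L, opair_in_cprod in K; apply K.
    * intros p x x' Hp _ _ (n & k & -> & K) (n' & k' & e & K').
      apply opair_inj in e; destruct e; subst n' k'.
      apply opair_in_cprod in Hp.
      apply (proj1 (in_partial_injections _) (proj1 (Hcn n (proj1 Hp)))) with k; auto.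
  + intros n Hn; exists (dm (ap c n)); split; [|apply Hcn, Hn].
    intros x Hx; apply Hdm in Hx; apply Hz; split; [apply Hx|]; destruct Hx as (_ & k & K); eauto.
  + intros x Hx; apply Hz in Hx; destruct Hx as (Hx & n & k & Hn & K).
    exists n, (dm (ap c n)); split; [exact Hn|split; [apply Hcn, Hn|]].
    apply Hdm; eauto.
Qed.

End PartialInjections.

End Orders.

(** * The spaces *)

Section Spaces.
Context {M : structure} {HM : model ZF M}.
Implicit Types a b c f g h k m n p q r x y z A C E F G T U V X Y Z : M.

Definition countable_subsets X : M := sep (power X) (fun z => countable z).

Lemma in_countable_subsets X z :
  z ∈ countable_subsets X <-> (forall x, x ∈ z -> x ∈ X) /\ countable z.
Proof.
unfold countable_subsets; rewrite in_sep, in_power by definability; reflexivity.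
Qed.

Lemma is_countable_subsets_iff Z X :
  is_countable_subsets Z X <-> Z = countable_subsets X.
Proof.
assert (E : forall z, z ∈ countable_subsets X <-> subset z X /\ countable z).
{ intros z; rewrite in_countable_subsets, subset_iff; reflexivity. }
unfold is_countable_subsets; rewrite is_set_of_iff; split.
- intros H; apply ext_eq; intros z; rewrite H, E; reflexivity.
- intros ->; exact E.
Qed.

(* [Near x z y] says that [y] lies in the basic neighbourhood of [x] given by
   the countable set [z], which is subject to the condition [Adm x z]. *)
Lemma P_space_of_basis (Adm : M -> M -> Prop) (Near : M -> M -> M -> Prop)
    X r A T :
  CAC_DLO M -> linear_order r X ->
  (forall x, definable (fun v => Adm x (v 0))) ->
  (forall x, definable (fun v => Near x (v 0) (v 1))) ->
  (forall x, x ∈ A -> exists z, z ∈ countable_subsets X /\ Adm x z) ->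
  (forall x z z', z ∈ countable_subsets X ->
    (exists u, (forall i, i ∈ u -> i ∈ z) /\ Adm x u) ->
    (forall i, i ∈ z -> exists u, Adm x u /\ i ∈ u) -> Adm x z) ->
  (forall x y z z', (forall i, i ∈ z -> i ∈ z') -> Near x z' y -> Near x z y) ->
  (forall V, V ∈ T <-> (forall x, x ∈ V -> x ∈ A) /\
    forall x, x ∈ V -> exists z, z ∈ countable_subsets X /\ Adm x z /\
      forall y, y ∈ A -> Near x z y -> y ∈ V) ->
  P_space A T.
Proof.
intros CAC Hr DA DN HA HU HN HT.
split; [split; [apply no_atom|split; [|split; [|split]]]|].
- intros V HV; apply subset_iff; apply HT, HV.
- apply HT; split; [auto|]; intros x Hx; destruct (HA x Hx) as (z & Hz & Az); eauto.
- intros F U HF HU'; rewrite subset_iff in HF.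
  unfold is_union in HU'; rewrite is_set_of_iff in HU'; apply HT; split.
  + intros x Hx; apply HU' in Hx; destruct Hx as (V & HV & Hx).
    apply HF, HT in HV; apply HV, Hx.
  + intros x Hx; apply HU' in Hx; destruct Hx as (V & HV & Hx).
    destruct (proj2 (proj1 (HT V) (HF V HV)) x Hx) as (z & Hz & Az & K).
    exists z; split; [exact Hz|split; [exact Az|]].
    intros y Hy L; apply HU'; eauto.
- intros V W I HV HW HI; rewrite is_set_of_iff in HI; apply HT; split.
  + intros x Hx; apply HI in Hx; apply HT in HV; apply HV, Hx.
  + intros x Hx; apply HI in Hx; destruct Hx as [H1 H2].
    destruct (proj2 (proj1 (HT V) HV) x H1) as (z & Hz & Az & K).
    destruct (proj2 (proj1 (HT W) HW) x H2) as (z' & Hz' & Az' & K').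
    assert (C : cup z z' ∈ countable_subsets X).
    { apply in_countable_subsets in Hz, Hz'; apply in_countable_subsets; split.
      - intros i; rewrite in_cup; intros [H|H]; [apply Hz|apply Hz']; exact H.
      - apply countable_cup; [apply Hz|apply Hz']. }
    exists (cup z z'); split; [exact C|split].
    (* [HU] is shaped to cover two conditions at once: disjointness from [x], which unions preserve,
       and nonemptiness, which supersets preserve. *)
    * apply (HU x (cup z z') z C).
      -- exists z; split; [intros i; rewrite in_cup; auto|exact Az].
      -- intros i; rewrite in_cup; intros [H|H]; eauto.
    * intros y Hy L; apply HI; split.
      -- apply K; [exact Hy|]; revert L; apply HN; intros i; rewrite in_cup; auto.
      -- apply K'; [exact Hy|]; revert L; apply HN; intros i; rewrite in_cup; auto.
- intros G (w & g & Hw & [Hg1 Hg2] & HG).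
  rewrite is_omega_iff in Hw; subst w; rewrite is_set_of_iff in HG.
  assert (E : forall x, x ∈ G <->
    x ∈ A /\ forall n, n ∈ omega -> x ∈ ap g n).
  { intros x; rewrite HG; split; intros [H K]; (split; [exact H|]).
    - intros n Hn; apply (K n), (related_ap g omega); auto.
    - intros n U; rewrite (related_ap g omega) by assumption.
      intros [Hn ->]; auto. }
  apply HT; split; [intros x Hx; apply E in Hx; apply Hx|].
  intros x Hx; apply E in Hx; destruct Hx as [Hx K].
  pose proof (DA x) as D1; pose proof (DN x) as D2.
  (* The sets eligible at index [n] give basic neighbourhoods of [x] inside the open set [ap g n];
     the union [z] of the chosen ones gives a neighbourhood inside all of them. *)
  destruct (countable_subsets_choice X r Hr (fun n z => Adm x z /\
    forall y, y ∈ A -> Near x z y -> y ∈ ap g n) CAC) as (z & Z1 & Z2 & Z3 & Z4).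
  + definability.
  + intros n Hn.
    assert (L : ap g n ∈ T).
    { apply (Hg2 n), (related_ap g omega); auto. }
    destruct (proj2 (proj1 (HT _) L) x (K n Hn)) as (z & Hz & Az & N).
    apply in_countable_subsets in Hz; exists z; split; [apply Hz|].
    split; [apply Hz|]; auto.
  + assert (C : z ∈ countable_subsets X) by (apply in_countable_subsets; auto).
    exists z; split; [exact C|split].
    * apply (HU x z z C).
      -- destruct (Z3 emp omega0) as (u & U1 & U2 & _); eauto.
      -- intros i Hi; destruct (Z4 i Hi) as (n & u & _ & [U _] & L); eauto.
    * intros y Hy N; apply E; split; [exact Hy|]; intros n Hn.
      destruct (Z3 n Hn) as (u & U1 & _ & U2).
      apply U2; [exact Hy|]; revert N; apply HN, U1.
Qed.

Lemma countable_emp : @countable M emp.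
Proof. apply countable_finite, finite_emp. Qed.

(** Stated for any family [A] of subsets of [X], to serve the finite subsets and the full power set
    alike. *)
Lemma S_P_space X r A : CAC_DLO M -> linear_order r X ->
  (forall a, a ∈ A -> forall i, i ∈ a -> i ∈ X) ->
  exists T, is_S_topology T A X (countable_subsets X) /\ P_space A T.
Proof.
intros CAC Hr HA.
set (Adm x z := forall i, ~ (i ∈ x /\ i ∈ z)).
set (Near x z y := (forall i, i ∈ x -> i ∈ y) /\
  forall i, i ∈ y -> i ∈ X /\ ~ i ∈ z).
set (T := sep (power A) (fun V => forall x, x ∈ V -> exists z,
  z ∈ countable_subsets X /\ Adm x z /\ forall y, y ∈ A -> Near x z y -> y ∈ V)).
assert (HT : forall V, V ∈ T <-> (forall x, x ∈ V -> x ∈ A) /\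
    forall x, x ∈ V -> exists z, z ∈ countable_subsets X /\ Adm x z /\
      forall y, y ∈ A -> Near x z y -> y ∈ V).
{ intros V; unfold T; rewrite in_sep by (unfold Adm, Near; definability).
  rewrite in_power; reflexivity. }
exists T; split.
- unfold is_S_topology; rewrite is_set_of_iff; intros V; rewrite HT, subset_iff.
  apply and_iff_compat_l; split; intros H x Hx;
    destruct (H x Hx) as (z & H1 & H2 & H3); exists z;
    (split; [exact H1|split; [exact H2|]]).
  + intros y Hy H4 H5; apply H3; [|split]; assumption.
  + intros y Hy [H4 H5]; apply H3; assumption.
- apply (P_space_of_basis Adm Near X r); try assumption.
  + intros x; unfold Adm; definability.
  + intros x; unfold Near; definability.
  + intros x Hx; exists emp; split.
    * apply in_countable_subsets; split; [|apply countable_emp].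
      intros i H; destruct (in_emp _ H).
    * intros i [_ H]; destruct (in_emp _ H).
  + intros x z _ _ _ H i [H1 H2]; destruct (H i H2) as (u & K & L); apply (K i); auto.
  + intros x y z z' H [H1 H2]; split; [exact H1|].
    intros i Hi; split; [apply H2, Hi|]; intros K; apply (H2 i Hi), H, K.
Qed.

Lemma S_fin_is_P_space_of X r : CAC_DLO M -> linear_order r X -> S_fin_is_P_space X.
Proof.
intros CAC Hr.
set (A := sep (power X) (fun a => finite a)).
assert (HA : forall a, a ∈ A <-> (forall i, i ∈ a -> i ∈ X) /\ finite a).
{ intros a; unfold A; rewrite in_sep, in_power by definability; reflexivity. }
destruct (S_P_space X r A CAC Hr) as (T & H1 & H2).
- intros a Ha; apply HA, Ha.
- exists (countable_subsets X), A, T; rewrite is_countable_subsets_iff.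
  split; [reflexivity|split; [|auto]].
  unfold is_finite_subsets; rewrite is_set_of_iff; intros a.
  rewrite subset_iff; apply HA.
Qed.

Lemma S_pow_is_P_space_of X r : CAC_DLO M -> linear_order r X -> S_pow_is_P_space X.
Proof.
intros CAC Hr; destruct (S_P_space X r (power X) CAC Hr) as (T & H1 & H2).
- intros a; rewrite in_power; auto.
- exists (countable_subsets X), (power X), T; rewrite is_countable_subsets_iff.
  split; [reflexivity|split; [|auto]].
  unfold is_powerset; rewrite is_set_of_iff; intros a.
  rewrite subset_iff; apply in_power.
Qed.

Lemma is_two_iff (t : M) : is_two t <-> t = upair emp (succ emp).
Proof.
unfold is_two; split.
- intros (e & o & He & Ho & H).
  rewrite is_empty_iff in He; rewrite is_succ_iff in Ho; rewrite is_upair_iff in H.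
  congruence.
- intros ->; exists emp, (succ emp).
  rewrite is_empty_iff, is_succ_iff, is_upair_iff; auto.
Qed.

Lemma fun_subset_iff f g X Y : is_fun_on f X -> is_fun_on g Y ->
  (forall x, x ∈ X -> x ∈ Y) ->
  subset f g <-> forall x, x ∈ X -> ap g x = ap f x.
Proof.
intros Hf Hg H; rewrite subset_iff; split.
- intros K x Hx.
  assert (L : related f x (ap f x)) by (apply (related_ap f X); auto).
  rewrite related_iff in L; apply K in L; rewrite <- related_iff in L.
  symmetry; apply (related_ap g Y) in L; [apply L|exact Hg].
- intros K p Hp; destruct (proj1 (proj2 Hf) p Hp) as (x & y & Hx & e).
  rewrite is_opair_iff in e; subst p; rewrite <- related_iff in Hp |- *.
  apply (related_ap f X) in Hp; [|exact Hf]; destruct Hp as [_ ->].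
  apply (related_ap g Y); [exact Hg|]; rewrite K; auto.
Qed.

Lemma two_power_is_P_space_of X r : CAC_DLO M -> linear_order r X ->
  infinite X -> two_power_is_P_space X.
Proof.
intros CAC Hr HX.
set (two := @upair M emp (succ emp)).
set (C := sep (power (cprod X two)) (fun f => is_fun f X two)).
assert (HC : forall f, f ∈ C <-> is_fun f X two).
{ intros f; unfold C; rewrite in_sep, in_power by definability; split; [tauto|].
  intros Hf; split; [|exact Hf]; intros p Hp; destruct Hf as [Hf1 Hf2].
  destruct (proj1 (proj2 Hf1) p Hp) as (x & y & Hx & e).
  rewrite is_opair_iff in e; subst p; apply opair_in_cprod; split; [exact Hx|].
  apply (Hf2 x), related_iff, Hp. }
set (Adm (f : M) z := exists i, i ∈ z).
(* The partial function [p] of the definition is always the restriction of [f] to [z], so agreement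
   with [f] on [z] replaces it. *)
set (Near f z h := forall i, i ∈ z -> ap h i = ap f i).
set (T := sep (power C) (fun V => forall f, f ∈ V -> exists z,
  z ∈ countable_subsets X /\ Adm f z /\ forall h, h ∈ C -> Near f z h -> h ∈ V)).
assert (HT : forall V, V ∈ T <-> (forall x, x ∈ V -> x ∈ C) /\
    forall x, x ∈ V -> exists z, z ∈ countable_subsets X /\ Adm x z /\
      forall y, y ∈ C -> Near x z y -> y ∈ V).
{ intros V; unfold T; rewrite in_sep by (unfold Adm, Near; definability).
  rewrite in_power; reflexivity. }
exists (countable_subsets X), C, T; rewrite is_countable_subsets_iff.
split; [reflexivity|split; [|split]].
- exists two; rewrite is_two_iff; split; [reflexivity|].
  apply is_set_of_iff, HC.
- unfold is_two_power_topology; rewrite is_set_of_iff; intros V.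
  rewrite HT, subset_iff; split; intros [HV H]; (split; [exact HV|]); intros f Hf.
  + destruct (H f Hf) as (z & Hz & Az & K).
    assert (Hz' := proj1 (in_countable_subsets X z) Hz).
    destruct (proj1 (HC f) (HV f Hf)) as [F1 F2].
    exists z, (lam z (fun x => ap f x)), two; rewrite is_two_iff.
    assert (L : is_fun_on (lam z (fun x => ap f x)) z) by (apply is_fun_lam; definability).
    split; [exact Hz|split; [exact Az|split; [reflexivity|split; [|split]]]].
    * split; [exact L|]; intros x y; rewrite related_lam by definability.
      intros [Hx ->]; apply (F2 x), (related_ap f X); [exact F1|].
      split; [apply Hz', Hx|reflexivity].
    * apply (fun_subset_iff _ _ z X); try assumption; [apply Hz'|].
      intros x Hx; rewrite ap_lam by (assumption || definability); reflexivity.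
    * intros h Hh S; apply K; [exact Hh|]; intros x Hx.
      rewrite (fun_subset_iff _ _ z X) in S; [|exact L|apply HC, Hh|apply Hz'].
      rewrite (S x Hx), ap_lam by (assumption || definability); reflexivity.
  + destruct (H f Hf) as (z & p & t & Hz & Az & Ht & [P1 P2] & S & K).
    assert (Hz' := proj1 (in_countable_subsets X z) Hz).
    exists z; split; [exact Hz|split; [exact Az|]].
    intros h Hh N; apply K; [exact Hh|].
    rewrite (fun_subset_iff _ _ z X) in S; [|exact P1|apply HC, HV, Hf|apply Hz'].
    apply (fun_subset_iff _ _ z X); [exact P1|apply HC, Hh|apply Hz'|].
    intros x Hx; rewrite (N x Hx); apply S, Hx.
- apply (P_space_of_basis Adm Near X r); try assumption.
  + intros x; unfold Adm; definability.
  + intros x; unfold Near; definability.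
  + intros f _.
    (* The topology wants a nonempty [z], so a point of [X] must be found; an infinite set is not
       empty. *)
    assert (N : exists x, x ∈ X).
    { apply NNPP; intros N; apply (proj2 HX).
      replace X with (@emp M); [apply finite_emp|].
      apply ext_eq; intros x; split; intros H; [destruct (in_emp _ H)|].
      destruct N; eauto. }
    destruct N as [x Hx]; exists (sing x); split.
    * apply in_countable_subsets; split.
      -- intros i; rewrite in_sing; intros ->; exact Hx.
      -- apply countable_finite, finite_sing.
    * exists x; apply in_sing; reflexivity.
  + intros f z _ _ (u & U & i & Hi) _; exists i; auto.
  + intros f h z z' H N i Hi; auto.
Qed.

Lemma CAC_DLO_LO_P_spaces : CAC_DLO M -> LO_P_spaces M.
Proof.
intros CAC X HX [_ [r Hr]]; split; [|split].
- apply (S_fin_is_P_space_of X r); assumption.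
- apply (S_pow_is_P_space_of X r); assumption.
- apply (two_power_is_P_space_of X r); assumption.
Qed.

Lemma LO_S_fin_P_space_CUC_DLO : LO_S_fin_P_space M -> CUC_DLO M.
Proof.
intros HS G F U (X & r & DX & Dr & H & HF)%sequence_elim HU.
(* The [X n] may overlap and their orders need not agree; tagging with the index makes an order by
   index, then within the fibre, possible. *)
set (D := sep (cprod omega (union F)) (fun p => pr2 p ∈ X (pr1 p))).
assert (HD : forall p, p ∈ D <-> exists n x, n ∈ omega /\ x ∈ X n /\ p = opair n x).
{ intros p; unfold D; rewrite in_sep, in_cprod by definability; split.
  - intros [(n & x & Hn & _ & ->) K]; rewrite pr1_opair, pr2_opair in K; eauto.
  - intros (n & x & Hn & Hx & ->); rewrite pr1_opair, pr2_opair; split; [|exact Hx].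
    exists n, x; split; [exact Hn|split; [|reflexivity]].
    apply in_union; exists (X n); split; [apply HF; eauto|exact Hx]. }
assert (HDp : forall n x, opair n x ∈ D <-> n ∈ omega /\ x ∈ X n).
{ intros n x; rewrite HD; split; [|intros []; eauto].
  intros (n' & x' & Hn & Hx & e); apply opair_inj in e; destruct e; subst; auto. }
enough (CD : countable D).
{ apply (countable_of_relation (fun p x => x = pr2 p) _ D); [definability|exact CD| |].
  - intros x Hx; unfold is_union in HU; rewrite is_set_of_iff in HU; apply HU in Hx.
    destruct Hx as (Y & HY & Hx); apply HF in HY; destruct HY as (n & Hn & ->).
    exists (opair n x); rewrite pr2_opair, HDp; auto.
  - intros; congruence. }
(* The hypothesis speaks of infinite sets only, so a finite [D] is treated apart. *)
destruct (classic (finite D)) as [fin|inf]; [apply countable_finite, fin|].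
assert (fiber : forall n, n ∈ omega ->
  exists z, (forall p, p ∈ z <-> exists x, x ∈ X n /\ p = opair n x) /\ countable z).
{ intros n Hn; exists (cprod (sing n) (X n)).
  assert (E : forall p, p ∈ cprod (sing n) (X n) <-> exists x, x ∈ X n /\ p = opair n x).
  { intros p; rewrite in_cprod; setoid_rewrite in_sing; split.
    - intros (m & x & -> & Hx & e); eauto.
    - intros (x & Hx & e); eauto 6. }
  split; [exact E|].
  apply (countable_of_relation (fun x p => p = opair n x) _ (X n)); 
    [definability|apply H, Hn| |intros; congruence].
  intros p (x & Hx & e)%E; eauto. }
destruct (HS D) as (Z & A & T & HZ & HA & HT & HP).
- split; [apply no_atom|exact inf].
- split; [apply no_atom|].
  exists (order_on D (fun p q => pr1 p ∈ pr1 q \/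
    pr1 p = pr1 q /\ opair (pr2 p) (pr2 q) ∈ r (pr1 p))).
  assert (L : forall n, n ∈ omega -> linear_order (r n) (X n)) by (intros; apply H; auto).
  apply linear_order_on; [definability| | | |].
  + intros p (n & x & Hn & Hx & ->)%HD; right; split; [reflexivity|].
    rewrite pr1_opair, pr2_opair; apply (linear_order_elim _ _ (L n Hn)), Hx.
  + intros p q (n & x & Hn & Hx & ->)%HD (m & y & Hm & Hy & ->)%HD.
    rewrite !pr1_opair, !pr2_opair; intros [K1|[<- K1]] [K2|[e K2]].
    * destruct (mem_asym _ _ K1 K2).
    * subst; destruct (mem_irrefl _ K1).
    * destruct (mem_irrefl _ K2).
    * f_equal; apply (linear_order_elim _ _ (L n Hn)); assumption.
  + intros p q s (n & x & Hn & Hx & ->)%HD (m & y & Hm & Hy & ->)%HD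
      (k & z & Hk & Hz & ->)%HD.
    rewrite !pr1_opair, !pr2_opair; intros [K1|[<- K1]] [K2|[<- K2]]; auto.
    * left; apply (nat_transitive k m); auto.
    * right; split; [reflexivity|].
      destruct (linear_order_elim _ _ (L n Hn)) as (_ & _ & _ & L3 & _); eauto.
  + intros p q (n & x & Hn & Hx & ->)%HD (m & y & Hm & Hy & ->)%HD.
    rewrite !pr1_opair, !pr2_opair.
    destruct (omega_trichotomy n m Hn Hm) as [K|[<-|K]]; auto.
    destruct (linear_order_elim _ _ (L n Hn)) as (_ & _ & _ & _ & L4).
    destruct (L4 x y Hx Hy); auto.
- rewrite is_countable_subsets_iff in HZ; subst Z.
  unfold is_finite_subsets, is_S_topology in HA, HT; rewrite is_set_of_iff in HA, HT.
  setoid_rewrite subset_iff in HA; setoid_rewrite subset_iff in HT.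
  (* [W n] collects the finite sets that miss the fibre over [n]. It is open because the fibre is
     itself a countable set that a neighbourhood may avoid, and the [W n] have only [emp] in
     common. *)
  set (W n := sep A (fun y => forall x, ~ opair n x ∈ y)).
  assert (HW : forall n y, y ∈ W n <-> y ∈ A /\ forall x, ~ opair n x ∈ y).
  { intros n y; unfold W; rewrite in_sep by definability; reflexivity. }
  assert (DW : definable_term (fun v => W (v 0))) by (unfold W; definability).
  assert (K : sing emp ∈ T).
  { apply (proj2 HP); exists omega, (lam omega W); rewrite is_omega_iff.
    split; [reflexivity|split; [split; [apply is_fun_lam, DW|]|]].
    - intros n V; rewrite related_lam by assumption; intros [Hn ->].
      apply HT; split; [intros y Hy; apply HW in Hy; apply Hy|].
      intros y [Hy K]%HW; destruct (fiber n Hn) as (z & Hz & Cz).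
      exists z; split; [apply in_countable_subsets; split; [|exact Cz]|split].
      + intros p (x & Hx & ->)%Hz; apply HDp; auto.
      + intros i [I1 I2]; apply Hz in I2; destruct I2 as (x & _ & ->); apply (K x I1).
      + intros y' Hy' _ K'; apply HW; split; [exact Hy'|]; intros x Hx.
        destruct (K' _ Hx) as [L1 L2]; apply L2, Hz.
        apply HDp in L1; destruct L1; eauto.
    - apply is_set_of_iff; intros y; rewrite in_sing; split.
      + intros ->; split.
        * apply HA; split; [intros x Hx; destruct (in_emp _ Hx)|apply finite_emp].
        * intros n V; rewrite related_lam by assumption; intros [Hn ->].
          apply HW; split; [|intros x; apply in_emp].
          apply HA; split; [intros x Hx; destruct (in_emp _ Hx)|apply finite_emp].
      + intros [Hy K]; apply ext_eq; intros p; split; intros Hp; [|destruct (in_emp _ Hp)].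
        assert (L : p ∈ D) by (apply HA in Hy; apply Hy, Hp).
        apply HD in L; destruct L as (n & x & Hn & Hx & ->).
        specialize (K n (W n)); rewrite related_lam in K by assumption.
        destruct (proj2 (proj1 (HW n y) (K (conj Hn eq_refl))) x Hp). }
  destruct (proj2 (proj1 (HT _) K) emp) as (z & Hz & _ & N).
  { apply in_sing; reflexivity. }
  apply in_countable_subsets in Hz; apply (countable_subset _ z); [apply Hz|].
  intros p Hp; apply NNPP; intros C.
  (* The neighbourhood of [emp] given by [z] lies in the singleton of [emp], yet a point [p] outside
     [z] would put [sing p] into it. *)
  assert (B : sing p ∈ sing emp).
  { apply N.
    - apply HA; split; [|apply finite_sing].
      intros i; rewrite in_sing; intros ->; exact Hp.
    - intros i Hi; destruct (in_emp _ Hi).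
    - intros i; rewrite in_sing; intros ->; auto. }
  apply in_sing in B; apply (in_emp p); rewrite <- B; apply in_sing; reflexivity.
Qed.

End Spaces.

(** * Countable unions and the regularity of omega_1 *)

Section UnionsOfLinearOrders.
Context {M : structure} {HM : model ZF M}.
Implicit Types a b c d f g h i k m n p q r s w x y z F G X Y Z : M.

Lemma CUC_DLO_union (X r : M -> M) : CUC_DLO M ->
  definable_term (fun v => X (v 0)) -> definable_term (fun v => r (v 0)) ->
  (forall n, n ∈ omega ->
    linear_order (r n) (X n) /\ nonempty (X n) /\ countable (X n)) ->
  countable (union (image omega X)).
Proof.
intros CUC DX Dr H.
apply (CUC _ _ _ (sequence_intro (fun X _ => nonempty X /\ countable X) X r DX Dr H)).
unfold is_union; rewrite is_set_of_iff; apply in_union.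
Qed.

Lemma integers_countable X r : isomorphic_to_integers X r ->
  nonempty X /\ countable X.
Proof.
intros (Z & s & (w & e & o & Hw & He & Ho & HZ) & _ & f & [Hf Sf] & _).
rewrite is_omega_iff in Hw; rewrite is_empty_iff in He; rewrite is_succ_iff in Ho.
subst w e o; rewrite is_set_of_iff in HZ; split.
- destruct (Sf (opair emp emp)) as [x Hx].
  + apply HZ; exists emp, emp; rewrite is_opair_iff; auto using omega0.
  + exists x; apply (related_ap f X) in Hx; [apply Hx|apply Hf].
- destruct (is_injection_ap f X Z Hf) as [F1 F2].
  apply (countable_of_relation (fun z x => z = ap f x) _ Z).
  + definability.
  (* The two sign tags are the numbers 0 and 1, so the coded integers are pairs of natural
     numbers. *)
  + apply (countable_subset _ (cprod omega omega)); [apply countable_omega2|].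
    intros q Hq; apply HZ in Hq; destruct Hq as (t & n & Ht & Hn & e).
    rewrite is_opair_iff in e; subst q; apply opair_in_cprod; split; [|exact Hn].
    destruct Ht as [-> | ->]; auto using omega0, omegaS.
  + intros x Hx; exists (ap f x); auto.
  + intros z x x' _ Hx Hx' e e'; apply F2; congruence.
Qed.

(** An injection of the whole union into omega singles out, in each [X n], the element with the
    least number. *)
Lemma CUC_DLO_vDCP : CUC_DLO M -> vDCP_omega M.
Proof.
intros CUC G F (X & r & DX & Dr & H & HF)%sequence_elim.
assert (HX : forall n, n ∈ omega -> nonempty (X n) /\ countable (X n)).
{ intros n Hn; apply (integers_countable _ (r n)), H, Hn. }
assert (C : countable (union (image omega X))).
{ apply (CUC_DLO_union X r); try assumption.
  intros n Hn; split; [apply H|apply HX]; assumption. }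
apply countable_iff in C; destruct C as (f & f1 & f2).
set (N Y := image Y (fun x => ap f x)).
apply choice_function_iff.
exists (lam F (fun Y => the Y (fun y => ap f y = least (N Y)))).
intros Y HY; rewrite ap_lam by ((unfold N; definability) || assumption).
apply HF in HY; destruct HY as (n & Hn & ->).
assert (HU : forall x, x ∈ X n -> x ∈ union (image omega X)).
{ intros x Hx; apply in_union; exists (X n).
  rewrite in_image by definability; eauto. }
destruct (HX n Hn) as [[x Hx] _].
assert (HN : forall m, m ∈ N (X n) <-> exists x, x ∈ X n /\ m = ap f x).
{ intros m; unfold N; rewrite in_image by definability; reflexivity. }
destruct (least_spec (N (X n)) (ap f x)) as [L _].
- intros m (y & Hy & ->)%HN; auto.
- apply HN; eauto.
- apply HN in L; destruct L as (y & Hy & e).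
  rewrite (the_eq _ _ y); [exact Hy|definability|exact Hy|auto|].
  intros y' Hy' e'; apply f2; auto; congruence.
Qed.

End UnionsOfLinearOrders.

(** * Ordinals and the first uncountable one *)

Section Ordinals.
Context {M : structure} {HM : model ZF M}.
Implicit Types a b c d f g h i k m n p q r s w x y z F G X Y Z : M.

Lemma mem_no_cycle x y z : x ∈ y -> y ∈ z -> ~ z ∈ x.
Proof.
intros H1 H2 H3.
destruct (foundation (fun _ => True) (cup (sing x) (upair y z)) x)
  as (m & K1 & _ & K2); auto.
- definability.
- rewrite in_cup, in_sing; auto.
- rewrite in_cup, in_sing, in_upair in K1.
  destruct K1 as [-> |[-> | ->]];
    [apply (K2 z)|apply (K2 x)|apply (K2 y)]; auto;
    rewrite in_cup, in_sing, in_upair; auto.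
Qed.

(** Foundation supplies the other clauses: membership has no cycles of length at most three, and
    every nonempty set has a minimal element. *)
Lemma is_ordinal_iff a : is_ordinal a <->
  (forall x y, x ∈ a -> y ∈ x -> y ∈ a) /\
  (forall x y, x ∈ a -> y ∈ a -> x ∈ y \/ x = y \/ y ∈ x).
Proof.
split.
- intros (_ & H1 & H2 & _); split; [|exact H2].
  intros x y Hx; apply subset_iff, H1, Hx.
- intros [H1 H2]; split; [apply no_atom|].
  split; [|split; [exact H2|split; [|split]]].
  + intros x Hx; apply subset_iff; eauto.
  + intros x y z Hx Hy Hz K1 K2; destruct (H2 x z Hx Hz) as [|[->|K3]]; auto.
    * destruct (mem_asym _ _ K1 K2).
    * destruct (mem_no_cycle _ _ _ K1 K2 K3).
  + intros x _; apply mem_irrefl.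
  + intros s Hs [x Hx]; rewrite subset_iff in Hs.
    destruct (foundation (fun _ => True) s x) as (m & K1 & _ & K2); auto.
    { definability. }
    exists m; split; [exact K1|]; intros y Hy.
    destruct (H2 m y) as [|[|K]]; auto; destruct (K2 y Hy I K).
Qed.

Lemma ordinal_transitive a x y : is_ordinal a -> x ∈ a -> y ∈ x -> y ∈ a.
Proof. intros [H _]%is_ordinal_iff; eauto. Qed.

Lemma ordinal_mem a x : is_ordinal a -> x ∈ a -> is_ordinal x.
Proof.
intros [H1 H2]%is_ordinal_iff Hx; apply is_ordinal_iff; split; [|eauto].
intros y z Hy Hz; destruct (H2 z x) as [|[->|K]]; eauto.
- destruct (mem_asym _ _ Hy Hz).
- destruct (mem_no_cycle _ _ _ Hz Hy K).
Qed.

(** If they differ, a membership-minimal element of [b] outside [a] is [a] itself. *)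
Lemma ordinal_subset a b : is_ordinal a -> is_ordinal b ->
  (forall x, x ∈ a -> x ∈ b) -> a = b \/ a ∈ b.
Proof.
intros [A1 A2]%is_ordinal_iff [B1 B2]%is_ordinal_iff H.
destruct (classic (a = b)) as [|ne]; [auto|right].
assert (N : exists m, m ∈ b /\ ~ m ∈ a).
{ apply NNPP; intros N; apply ne, ext_eq; intros x; split; auto.
  intros Hx; apply NNPP; eauto. }
destruct N as (m & Hm & Nm).
destruct (foundation (fun x => ~ x ∈ a) b m) as (k & K1 & K2 & K3); auto.
{ definability. }
replace a with k; [exact K1|].
apply ext_eq; intros x; split; intros Hx.
- apply NNPP; intros Nx; apply (K3 x); eauto.
- destruct (B2 x k) as [|[->|L]]; auto; destruct K2; eauto.
Qed.

(** The intersection of the two is an ordinal contained in both; were it different from each, it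
    would belong to both and hence to itself. *)
Lemma ordinal_trichotomy a b : is_ordinal a -> is_ordinal b ->
  a ∈ b \/ a = b \/ b ∈ a.
Proof.
intros Ha Hb.
set (c := sep a (fun x => x ∈ b)).
assert (Hc : forall x, x ∈ c <-> x ∈ a /\ x ∈ b).
{ intros x; unfold c; rewrite in_sep by definability; reflexivity. }
assert (Oc : is_ordinal c).
{ apply is_ordinal_iff; split.
  - intros x y [H1 H2]%Hc K; apply Hc; split.
    + apply (ordinal_transitive a x); assumption.
    + apply (ordinal_transitive b x); assumption.
  - apply is_ordinal_iff in Ha; intros x y [H1 _]%Hc [H2 _]%Hc; apply Ha; auto. }
destruct (ordinal_subset c a) as [e|K]; auto; [intros x Hx; apply Hc, Hx| |].
- destruct (ordinal_subset a b) as [|]; auto.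
  intros x Hx; rewrite <- e in Hx; apply Hc, Hx.
- destruct (ordinal_subset c b) as [e|L]; auto; [intros x Hx; apply Hc, Hx| |].
  + rewrite e in K; auto.
  + destruct (mem_irrefl c); apply Hc; auto.
Qed.

Lemma ordinal_emp : @is_ordinal M emp.
Proof.
apply is_ordinal_iff; split; intros x y H; destruct (in_emp _ H).
Qed.

(** Uniqueness makes the epsilon operator harmless: the graph of the selected function is the
    relation itself, hence definable. *)
Lemma definable_description (R : M -> M -> Prop) :
  definable (fun v => R (v 0) (v 1)) ->
  (forall x, exists y, R x y /\ forall y', R x y' -> y' = y) ->
  exists F : M -> M, definable_term (fun v => F (v 0)) /\ forall x, R x (F x).
Proof.
intros D H.
set (F x := epsilon (dom_inhabited M) (fun y => R x y)).
assert (HF : forall x, R x (F x)).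
{ intros x; apply epsilon_spec; destruct (H x) as (y & Hy & _); eauto. }
exists F; split; [|exact HF].
apply (definable_equiv (fun v => R (v 1) (v 0))); [|definability].
intros v; split; [intros ->; apply HF|intros K].
destruct (H (v 1)) as (y & _ & U); rewrite (U _ K); symmetry; apply U, HF.
Qed.

(* [w] is the transport of the order of the ordinal [a] along an injection of
   [a] into omega; as [w] determines [a], replacement applied to the power set
   of omega x omega collects all countable ordinals. *)
Definition codes w a : Prop :=
  is_ordinal a /\ exists f,
    (forall x, x ∈ a -> ap f x ∈ omega) /\
    (forall x y, x ∈ a -> y ∈ a -> ap f x = ap f y -> x = y) /\
    (forall p, p ∈ w <-> exists x y, x ∈ a /\ y ∈ a /\ (x ∈ y \/ x = y) /\
      p = opair (ap f x) (ap f y)).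

Lemma codes_subset w a b : codes w a -> codes w b -> forall x, x ∈ a -> x ∈ b.
Proof.
intros (Oa & f & f1 & f2 & Hf) (Ob & g & g1 & g2 & Hg).
assert (E : forall x, x ∈ a -> exists y, y ∈ b /\ ap f x = ap g y).
{ intros x Hx.
  assert (K : opair (ap f x) (ap f x) ∈ w) by (apply Hf; exists x, x; auto).
  apply Hg in K; destruct K as (y & y' & Hy & _ & _ & e).
  apply opair_inj in e; exists y; split; [exact Hy|apply e]. }
(* By induction on membership: elements of [a] and [b] with equal numbers have the same elements,
   because [w] records which numbers precede which. *)
assert (C : forall x, x ∈ a -> forall y, y ∈ b -> ap f x = ap g y -> x = y).
{ intros x0 Hx0; apply NNPP; intros N0.
  destruct (foundation (fun x => ~ forall y, y ∈ b -> ap f x = ap g y -> x = y)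
    a x0) as (x & Hx & N & IH); auto; [definability|].
  assert (IH' : forall z, z ∈ x -> forall y, y ∈ b -> ap f z = ap g y -> z = y).
  { intros z Hz; apply NNPP; intros K; apply (IH z); auto.
    apply (ordinal_transitive a x); auto. }
  clear x0 Hx0 N0 IH; apply N; intros y Hy e; apply ext_eq; intros z; split; intros Hz.
  - assert (Hza : z ∈ a) by (apply (ordinal_transitive a x); auto).
    assert (K : opair (ap f z) (ap f x) ∈ w) by (apply Hf; exists z, x; auto).
    apply Hg in K; destruct K as (z' & y' & Hz' & Hy' & L & e').
    apply opair_inj in e'; destruct e' as [e1 e2].
    assert (y' = y) by (apply g2; congruence); subst y'.
    rewrite (IH' z Hz z' Hz' e1); destruct L as [L|L]; [exact L|].
    subst z'; assert (z = x) by (apply f2; congruence); subst z.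
    destruct (mem_irrefl _ Hz).
  - assert (Hzb : z ∈ b) by (apply (ordinal_transitive b y); auto).
    assert (K : opair (ap g z) (ap g y) ∈ w) by (apply Hg; exists z, y; auto).
    apply Hf in K; destruct K as (z' & x' & Hz' & Hx' & L & e').
    apply opair_inj in e'; destruct e' as [e1 e2].
    assert (x' = x) by (apply f2; congruence); subst x'.
    destruct L as [L|L].
    + rewrite <- (IH' z' L z Hzb); auto.
    + subst z'; assert (z = y) by (apply g2; congruence); subst z.
      destruct (mem_irrefl _ Hz). }
intros x Hx; destruct (E x Hx) as (y & Hy & e); rewrite (C x Hx y Hy e); exact Hy.
Qed.

Lemma codes_inj w a b : codes w a -> codes w b -> a = b.
Proof.
intros H K; apply ext_eq; intros x; split; apply (codes_subset w); assumption.
Qed.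

Lemma countable_ordinals :
  exists k, forall a, a ∈ k <-> is_ordinal a /\ countable a.
Proof.
(* Sets that code nothing are sent to [emp], so that replacement receives a total function. *)
destruct (definable_description (fun w a => codes w a \/
  (~ exists b, codes w b) /\ a = emp)) as (F & DF & HF).
- unfold codes; definability.
- intros w; destruct (classic (exists a, codes w a)) as [[a Ha]|N].
  + exists a; split; [auto|]; intros b [Hb|[N _]]; [|destruct N; eauto].
    apply (codes_inj w); assumption.
  + exists emp; split; [auto|]; intros b [Hb|[_ e]]; [destruct N; eauto|exact e].
- exists (sep (image (power (cprod omega omega)) F)
    (fun a => is_ordinal a /\ countable a)).
  intros a; rewrite in_sep, in_image by definability.
  split; [tauto|intros [Oa Ca]; split; [|auto]].
  assert (Cf := proj1 (countable_iff a) Ca); destruct Cf as (f & f1 & f2).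
  set (w := sep (cprod omega omega) (fun p => exists x y, x ∈ a /\ y ∈ a /\
    (x ∈ y \/ x = y) /\ p = opair (ap f x) (ap f y))).
  assert (Hw : codes w a).
  { split; [exact Oa|]; exists f; split; [exact f1|split; [exact f2|]].
    intros p; unfold w; rewrite in_sep by definability; split; [tauto|].
    intros (x & y & Hx & Hy & K & ->); split; [apply opair_in_cprod; auto|].
    exists x, y; auto. }
  exists w; split.
  + apply in_power; intros p; unfold w; rewrite in_sep by definability; tauto.
  + destruct (HF w) as [K|[N _]]; [apply (codes_inj w); assumption|].
    destruct N; eauto.
Qed.

Lemma CUC_DLO_omega1_regular : CUC_DLO M -> omega1_regular M.
Proof.
intros CUC; destruct countable_ordinals as [k Hk]; exists k.
assert (Ok : is_ordinal k).
{ apply is_ordinal_iff; split.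
  - intros x y [Ox Cx]%Hk Hy; apply Hk; split; [apply (ordinal_mem x); assumption|].
    apply (countable_subset _ x); [exact Cx|]; intros z Hz.
    apply (ordinal_transitive x y); assumption.
  - intros x y [Ox _]%Hk [Oy _]%Hk; apply ordinal_trichotomy; assumption. }
(* A countable [k] would be one of its own elements, as in the Burali-Forti paradox. *)
assert (Nk : ~ countable k).
{ intros C; apply (mem_irrefl k), Hk; auto. }
split; [split; [exact Ok|split; [exact Nk|]]|split; [exact Ok|split]].
- intros a Ha; apply Hk, Ha.
- exists (lam k (fun x => x)); split; [split; [apply is_fun_lam; definability|]|].
  + intros x y; rewrite related_lam by definability; intros [Hx ->]; exact Hx.
  + intros b Hb; exists b, b; rewrite related_lam by definability; auto.
- intros d f [_ (i & i1 & i2)%countable_iff]%Hk ((F1 & F2) & F3).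
  assert (Ff : forall x, x ∈ d -> ap f x ∈ k).
  { intros x Hx; apply (F2 x), (related_ap f d); auto. }
  (* The initial segment up to the value of [f] at the point numbered [n]; [emp] is adjoined so that
     a number without a point still gives a nonempty set. If [f] is cofinal, these countable
     segments cover [k]. *)
  set (X n := cup (sing emp) (sep k (fun b => exists x, x ∈ d /\ ap i x = n /\
    (b ∈ ap f x \/ b = ap f x)))).
  assert (HX : forall n b, b ∈ X n <-> b = emp \/ b ∈ k /\
    exists x, x ∈ d /\ ap i x = n /\ (b ∈ ap f x \/ b = ap f x)).
  { intros n b; unfold X; rewrite in_cup, in_sing, in_sep by definability; reflexivity. }
  assert (OX : forall n b, b ∈ X n -> is_ordinal b).
  { intros n b [-> |[Hb _]]%HX; [apply ordinal_emp|apply Hk, Hb]. }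
  apply Nk, (countable_subset _ (union (image omega X))).
  + apply (CUC_DLO_union X (fun n => order_on (X n) (fun x y => x ∈ y \/ x = y)));
      [exact CUC|unfold X; definability|unfold X; definability|].
    intros n Hn; split; [|split].
    * apply linear_order_on; [definability|auto| | |].
      -- intros x y _ _ [H|H] [K|K]; auto; destruct (mem_asym _ _ H K).
      -- intros x y z _ _ Hz [H| ->] [K| <-]; auto.
         left; apply (ordinal_transitive z y); eauto.
      -- intros x y Hx Hy; destruct (ordinal_trichotomy x y) as [|[|]]; eauto.
    * exists emp; apply HX; auto.
    * destruct (classic (exists x, x ∈ d /\ ap i x = n)) as [(x & Hx & e)|N].
      -- apply (countable_subset _ (cup (sing emp) (succ (ap f x)))).
         ++ apply countable_cup; [apply countable_finite, finite_sing|].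
            apply countable_cup; [apply Hk, Ff, Hx|apply countable_finite, finite_sing].
         ++ intros b [-> |(_ & x' & Hx' & e' & K)]%HX; rewrite in_cup, in_sing, in_succ;
              [auto|]; right; rewrite (i2 x x'); auto; congruence.
      -- apply (countable_subset _ (sing emp)); [apply countable_finite, finite_sing|].
         intros b [-> |(_ & x' & Hx' & e' & _)]%HX; [apply in_sing; reflexivity|].
         destruct N; eauto.
  + intros b Hb; destruct (F3 b Hb) as (x & y & K & L).
    apply (related_ap f d) in K; [|exact F1]; destruct K as [Hx ->].
    apply in_union; exists (X (ap i x)); split.
    * rewrite in_image by (unfold X; definability); exists (ap i x); auto.
    * apply HX; right; split; [exact Hb|exists x; auto].
Qed.

End Ordinals.

(** * The second Fraenkel model *)

(** Sets in the style of Aczel: a node stands for the set of its children, which are indexed by an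
    arbitrary type. *)
Inductive tree : Type :=
| Leaf (n : nat) (b : bool)
| Node (A : Type) (f : A -> tree).

Fixpoint eqv (s t : tree) : Prop :=
  match s, t with
  | Leaf n b, Leaf m c => n = m /\ b = c
  | Node A f, Node B g =>
      (forall i, exists j, eqv (f i) (g j)) /\ (forall j, exists i, eqv (f i) (g j))
  | _, _ => False
  end.

Lemma eqv_refl t : eqv t t.
Proof. induction t; simpl; eauto. Qed.

Lemma eqv_sym s : forall t, eqv s t -> eqv t s.
Proof.
induction s as [n b|A f IH]; intros [m c|B g]; simpl; try tauto.
- intros []; auto.
- intros [H K]; split.
  + intros j; destruct (K j); eauto.
  + intros i; destruct (H i); eauto.
Qed.

Lemma eqv_trans s : forall t u, eqv s t -> eqv t u -> eqv s u.
Proof.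
induction s as [n b|A f IH]; intros [m c|B g] [k d|L h]; simpl; try tauto.
- intros [] []; split; congruence.
- intros [H1 H2] [K1 K2]; split.
  + intros i; destruct (H1 i) as [j ?], (K1 j) as [l ?]; eauto.
  + intros l; destruct (K2 l) as [j ?], (H2 j) as [i ?]; eauto.
Qed.

(** Satisfaction reads [f_eq] as equality of the metatheory, so extensionally equal trees have to be
    identified: an element is an equivalence class, held as a predicate. *)
Definition univ : Type := {P : tree -> Prop | exists t, P = eqv t}.
Definition cls (t : tree) : univ := exist _ (eqv t) (ex_intro _ t eq_refl).

Lemma univ_eq (x y : univ) : proj1_sig x = proj1_sig y -> x = y.
Proof.
destruct x as [P HP], y as [Q HQ]; simpl; intros <-.
f_equal; apply proof_irrelevance.
Qed.

Lemma cls_eq s t : cls s = cls t <-> eqv s t.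
Proof.
split.
- intros H; apply (f_equal (@proj1_sig _ _)) in H; simpl in H.
  rewrite H; apply eqv_refl.
- intros H; apply univ_eq; simpl; apply functional_extensionality; intros u.
  apply propositional_extensionality; split; intros K.
  + apply (eqv_trans _ s); [apply eqv_sym, H|exact K].
  + apply (eqv_trans _ t); assumption.
Qed.

Lemma cls_ex (x : univ) : exists t, cls t = x.
Proof. destruct x as [P [t ->]]; exists t; apply univ_eq; reflexivity. Qed.

Definition rep (x : univ) : tree :=
  proj1_sig (constructive_indefinite_description _ (cls_ex x)).

Lemma cls_rep x : cls (rep x) = x.
Proof. unfold rep; destruct constructive_indefinite_description; assumption. Qed.

Definition urelt (n : nat) (b : bool) : univ := cls (Leaf n b).
Definition node (A : Type) (f : A -> univ) : univ := cls (Node A (fun i => rep (f i))).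

Lemma cls_Node A (f : A -> tree) : cls (Node A f) = node A (fun i => cls (f i)).
Proof.
apply cls_eq; simpl; split; intros i; exists i; apply cls_eq;
  rewrite cls_rep; reflexivity.
Qed.

Lemma univ_ind (P : univ -> Prop) :
  (forall n b, P (urelt n b)) ->
  (forall A f, (forall i, P (f i)) -> P (node A f)) -> forall x, P x.
Proof.
intros H K x; destruct (cls_ex x) as [t <-].
induction t as [n b|A f IH]; [apply H|rewrite cls_Node; auto].
Qed.

Lemma univ_cases x : (exists n b, x = urelt n b) \/ (exists A f, x = node A f).
Proof. revert x; apply univ_ind; intros; [left|right]; eauto. Qed.

Lemma node_eq A f B g : node A f = node B g <->
  (forall i, exists j, f i = g j) /\ (forall j, exists i, f i = g j).
Proof.
unfold node; rewrite cls_eq; simpl.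
assert (E : forall i j, eqv (rep (f i)) (rep (g j)) <-> f i = g j).
{ intros i j; rewrite <- cls_eq, !cls_rep; reflexivity. }
setoid_rewrite E; reflexivity.
Qed.

Lemma urelt_neq_node n b A f : urelt n b <> node A f.
Proof. intros H; apply cls_eq in H; exact H. Qed.

Lemma urelt_inj n b m c : urelt n b = urelt m c -> n = m /\ b = c.
Proof. intros H; apply cls_eq in H; exact H. Qed.

Definition elt (x y : univ) : Prop := exists A f, y = node A f /\ exists i, x = f i.

Lemma elt_node x A f : elt x (node A f) <-> exists i, x = f i.
Proof.
split; [|intros H; exists A, f; auto].
intros (B & g & e & j & ->); apply node_eq in e.
destruct (proj2 e j) as [i Hi]; eauto.
Qed.

Lemma elt_urelt x n b : ~ elt x (urelt n b).
Proof. intros (A & f & e & _); apply urelt_neq_node in e; exact e. Qed.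

(* A permutation of the urelements that exchanges, for each [n] with
   [g n = true], the two urelements of index [n]. *)
Definition perm : Type := nat -> bool.

Fixpoint tact (g : perm) (t : tree) : tree :=
  match t with
  | Leaf n b => Leaf n (xorb (g n) b)
  | Node A f => Node A (fun i => tact g (f i))
  end.

Lemma eqv_tact g s : forall t, eqv s t -> eqv (tact g s) (tact g t).
Proof.
induction s as [n b|A f IH]; intros [m c|B h]; simpl; try tauto.
- intros [-> ->]; auto.
- intros [H K]; split.
  + intros i; destruct (H i); eauto.
  + intros j; destruct (K j); eauto.
Qed.

Definition act (g : perm) (x : univ) : univ := cls (tact g (rep x)).

Lemma act_cls g t : act g (cls t) = cls (tact g t).
Proof. apply cls_eq, eqv_tact, cls_eq, cls_rep. Qed.

Lemma act_urelt g n b : act g (urelt n b) = urelt n (xorb (g n) b).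
Proof. apply act_cls. Qed.

Lemma act_node g A f : act g (node A f) = node A (fun i => act g (f i)).
Proof. unfold node at 1; rewrite act_cls; simpl; apply cls_Node. Qed.

Lemma act_act g x : act g (act g x) = x.
Proof.
revert x; apply univ_ind; intros.
- rewrite !act_urelt, <- xorb_assoc, xorb_nilpotent, xorb_false_l; reflexivity.
- rewrite !act_node; apply node_eq; split; intros i; exists i; auto.
Qed.

(** The group is abelian, so a translate of an element keeps the same support; in general the
    support would be moved along. *)
Lemma act_comm g h x : act g (act h x) = act h (act g x).
Proof.
revert x; apply univ_ind; intros.
- rewrite !act_urelt, <- !xorb_assoc, (xorb_comm (g n)); reflexivity.
- rewrite !act_node; apply node_eq; split; intros i; exists i; auto.
Qed.

Lemma elt_act_imp g x y : elt x y -> elt (act g x) (act g y).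
Proof.
intros (A & f & -> & i & ->); rewrite act_node; apply elt_node; eauto.
Qed.

Lemma elt_act g x y : elt (act g x) y <-> elt x (act g y).
Proof.
split; intros H; apply (elt_act_imp g) in H; rewrite act_act in H; exact H.
Qed.

(** * Finite supports and the structure of hereditarily symmetric elements *)

Definition stable (n : nat) (g : perm) : Prop := forall i, i < n -> g i = false.
(** Finite supports are taken to be initial segments of indices, so that a maximum gives a common
    support. *)
Definition supports (n : nat) (x : univ) : Prop :=
  forall g, stable n g -> act g x = x.

Lemma stable_le n m g : n <= m -> stable m g -> stable n g.
Proof. intros H K i Hi; apply K; lia. Qed.

Lemma supports_urelt n b : supports (S n) (urelt n b).
Proof. intros g Hg; rewrite act_urelt, Hg by lia; reflexivity. Qed.

Lemma supports_act n g x : supports n x -> supports n (act g x).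
Proof. intros H h Hh; rewrite act_comm, H; auto. Qed.

Inductive hsym (x : univ) : Prop :=
  Hsym : (exists n, supports n x) -> (forall y, elt y x -> hsym y) -> hsym x.

Lemma hsym_act g x : hsym x -> hsym (act g x).
Proof.
induction 1 as [x [n Hn] _ IH]; split.
- exists n; apply supports_act, Hn.
- intros y Hy; apply elt_act, IH in Hy; rewrite act_act in Hy; exact Hy.
Qed.

Lemma hsym_urelt n b : hsym (urelt n b).
Proof.
split; [exists (S n); apply supports_urelt|].
intros y Hy; destruct (elt_urelt _ _ _ Hy).
Qed.

Definition fraenkel : structure := {|
  dom := {x : univ | hsym x};
  dom_inhabited := inhabits (exist _ (urelt 0 false) (hsym_urelt 0 false));
  mem x y := elt (proj1_sig x) (proj1_sig y);
  atom x := exists n b, proj1_sig x = urelt n b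
|}.

Notation M := fraenkel.

Lemma fr_eq (x y : M) : proj1_sig x = proj1_sig y -> x = y.
Proof.
destruct x as [x Hx], y as [y Hy]; simpl; intros <-.
f_equal; apply proof_irrelevance.
Qed.

Definition move (g : perm) (x : M) : M :=
  exist _ (act g (proj1_sig x)) (hsym_act g _ (proj2_sig x)).

Lemma move_move g x : move g (move g x) = x.
Proof. apply fr_eq, act_act. Qed.

Lemma move_inj g x y : move g x = move g y -> x = y.
Proof. intros e; rewrite <- (move_move g x), e; apply move_move. Qed.

Lemma mem_move g (x y : M) : move g x ∈ move g y <-> x ∈ y.
Proof.
unfold mem; simpl; rewrite elt_act, act_act; reflexivity.
Qed.

Lemma mem_move_r g (x y : M) : x ∈ move g y <-> move g x ∈ y.
Proof. rewrite <- (mem_move g (move g x)), move_move; reflexivity. Qed.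

Lemma atom_move g (x : M) : atom (move g x) <-> atom x.
Proof.
assert (K : forall x, atom x -> atom (move g x)).
{ intros y (n & b & e); exists n, (xorb (g n) b); simpl; rewrite e.
  apply act_urelt. }
split; intros H; apply K in H; [rewrite move_move in H|]; exact H.
Qed.

Definition fixed_by (n : nat) (x : M) : Prop := forall g, stable n g -> move g x = x.

Lemma fixed_by_le n m x : n <= m -> fixed_by n x -> fixed_by m x.
Proof. intros H K g Hg; apply K, (stable_le n m); assumption. Qed.

Lemma fixed_by_ex (x : M) : exists n, fixed_by n x.
Proof.
destruct x as [x Hx]; assert (K := Hx); destruct K as [[n Hn] _].
exists n; intros g Hg; apply fr_eq, Hn, Hg.
Qed.

(** The elements of a hereditarily symmetric set belong to the model, so agreement on the members in
    [M] is agreement on all members. *)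
Lemma fr_ext (a b : M) : ~ atom a -> ~ atom b -> (forall x, x ∈ a <-> x ∈ b) -> a = b.
Proof.
intros Ha Hb H; apply fr_eq.
destruct (univ_cases (proj1_sig a)) as [K|(A & f & ea)]; [destruct (Ha K)|].
destruct (univ_cases (proj1_sig b)) as [K|(B & g & eb)]; [destruct (Hb K)|].
assert (E : forall x, elt x (proj1_sig a) <-> elt x (proj1_sig b)).
{ intros x; split; intros Hx.
  - assert (S : hsym x) by (destruct (proj2_sig a); auto).
    apply (H (exist _ x S)), Hx.
  - assert (S : hsym x) by (destruct (proj2_sig b); auto).
    apply (H (exist _ x S)), Hx. }
rewrite ea, eb in *; apply node_eq; split; intros i.
- apply elt_node, E, elt_node; eauto.
- destruct (proj1 (elt_node (g i) A f)) as [j e]; eauto.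
  apply E, elt_node; eauto.
Qed.

Lemma elements (a : M) : exists (A : Type) (h : A -> M), forall x, x ∈ a <-> exists i, x = h i.
Proof.
destruct (univ_cases (proj1_sig a)) as [(n & b & e)|(A & f & e)].
- exists False, (fun i : False => match i with end); intros x.
  unfold mem; simpl; rewrite e; split; [intros H; destruct (elt_urelt _ _ _ H)|].
  intros [[]].
- assert (S : forall i, hsym (f i)).
  { intros i; destruct (proj2_sig a) as [_ K]; apply K; rewrite e.
    apply elt_node; eauto. }
  exists A, (fun i => exist _ (f i) (S i)); intros x.
  unfold mem; simpl; rewrite e, elt_node; split; intros [i Hi]; exists i.
  + apply fr_eq, Hi.
  + rewrite Hi; reflexivity.
Qed.

(** Being covered by a family indexed by a type plays the role of being bounded by a set. *)
Definition small (P : M -> Prop) : Prop :=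
  exists (A : Type) (h : A -> M), forall x, P x -> exists i, x = h i.
Definition symmetric (P : M -> Prop) : Prop :=
  exists n, forall g, stable n g -> forall x, P x -> P (move g x).

(** The comprehension principle of the model. Closure of [P] under the permutations in one direction
    suffices, because each of them is its own inverse. *)
Lemma set_ex (P : M -> Prop) : small P -> symmetric P -> exists a, is_set_of a P.
Proof.
intros (A & h & Hh) (n & Hn).
set (f := fun i : {i | P (h i)} => proj1_sig (h (proj1_sig i))).
assert (E : forall x : M, elt (proj1_sig x) (node _ f) <-> P x).
{ intros x; rewrite elt_node; split.
  - intros [[i Hi] e]; simpl in e; apply fr_eq in e; rewrite e; exact Hi.
  - intros Hx; destruct (Hh x Hx) as [i e].
    assert (K : P (h i)) by (rewrite <- e; exact Hx).
    exists (exist _ i K); unfold f; simpl; rewrite e; reflexivity. }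
assert (S : hsym (node _ f)).
{ split.
  - exists n; intros g Hg; rewrite act_node; apply node_eq.
    assert (K : forall i, exists j, act g (f i) = f j).
    { intros [i Hi]; pose proof (Hn g Hg _ Hi) as K.
      apply E, elt_node in K; destruct K as [j e]; exists j; exact e. }
    split; [exact K|]; intros j; destruct (K j) as [i e]; exists i.
    rewrite <- e; apply act_act.
  - intros y Hy; apply elt_node in Hy; destruct Hy as [i ->]; apply proj2_sig. }
exists (exist _ (node _ f) S); split; [|exact E].
intros (m & b & e); symmetry in e; apply urelt_neq_node in e; exact e.
Qed.

Lemma small_sub (P Q : M -> Prop) : small Q -> (forall x, P x -> Q x) -> small P.
Proof. intros (A & h & H) K; exists A, h; auto. Qed.

Lemma small_mem (a : M) : small (fun x => x ∈ a).
Proof.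
destruct (elements a) as (A & h & H); exists A, h; intros x; apply H.
Qed.

Lemma small_image (R : M -> M -> Prop) (a : M) :
  (forall x y y', x ∈ a -> R x y -> R x y' -> y = y') ->
  small (fun y => exists x, x ∈ a /\ R x y).
Proof.
intros HR; destruct (elements a) as (A & h & H).
exists A, (fun i => epsilon (dom_inhabited M) (R (h i))).
intros y (x & Hx & K); destruct (proj1 (H x) Hx) as [i e]; exists i.
subst x; apply (HR (h i)); [exact Hx|exact K|].
apply epsilon_spec; eauto.
Qed.

Lemma is_set_of_unique (P : M -> Prop) a b : is_set_of a P -> is_set_of b P -> a = b.
Proof.
intros [Ha Ka] [Hb Kb]; apply fr_ext; auto.
intros x; rewrite Ka, Kb; reflexivity.
Qed.

Lemma foundation_fr (P : M -> Prop) (x : M) : P x ->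
  exists m, P m /\ forall y, y ∈ m -> ~ P y.
Proof.
intros Hx; apply NNPP; intros N.
enough (K : forall z (x : M), proj1_sig x = z -> ~ P x) by (apply (K _ x eq_refl Hx)).
clear x Hx; apply (univ_ind (fun z => forall x : M, proj1_sig x = z -> ~ P x)).
- intros n b x e Hx; apply N; exists x; split; [exact Hx|].
  intros y Hy; unfold mem in Hy; simpl in Hy; rewrite e in Hy.
  destruct (elt_urelt _ _ _ Hy).
- intros A f IH x e Hx; apply N; exists x; split; [exact Hx|].
  intros y Hy; unfold mem in Hy; simpl in Hy; rewrite e in Hy.
  apply elt_node in Hy; destruct Hy as [i Hi]; apply (IH i y Hi).
Qed.

(** Each permutation is an automorphism of the model; being its own inverse, it is onto, which
    handles the quantifier. *)
Lemma sat_move g p : forall v : nat -> M,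
  sat M (fun i => move g (v i)) p <-> sat M v p.
Proof.
induction p as [i j|i j|i| |p IHp q IHq|p IHp]; intros v; cbn [sat].
- split; [apply move_inj|congruence].
- apply mem_move.
- apply atom_move.
- reflexivity.
- rewrite IHp, IHq; reflexivity.
- assert (E : forall a, sat M (scons (move g a) (fun i => move g (v i))) p <->
    sat M (scons a v) p).
  { intros a; rewrite <- (IHp (scons a v)); apply sat_ext; intros [|i]; reflexivity. }
  split; intros H a; [apply E, H|].
  rewrite <- (move_move g a); apply E, H.
Qed.

(** An infinite environment may have no common support, but a formula sees only a finite part of it,
    whose members do have one. *)
Lemma sat_finite p : exists k, forall v w : nat -> M,
  (forall i, i < k -> v i = w i) -> sat M v p <-> sat M w p.
Proof.
induction p as [i j|i j|i| |p [k IHp] q [l IHq]|p [k IHp]]; cbn [sat].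
- exists (S (max i j)); intros v w H; rewrite !H by lia; reflexivity.
- exists (S (max i j)); intros v w H; rewrite !H by lia; reflexivity.
- exists (S i); intros v w H; rewrite !H by lia; reflexivity.
- exists 0; reflexivity.
- exists (max k l); intros v w H.
  rewrite (IHp v w), (IHq v w); [reflexivity| |]; intros; apply H; lia.
- exists k; intros v w H.
  assert (E : forall a, sat M (scons a v) p <-> sat M (scons a w) p).
  { intros a; apply IHp; intros [|i] Hi; [reflexivity|]; apply H; lia. }
  split; intros K a; apply E, K.
Qed.

Lemma fixed_by_env (v : nat -> M) k : exists n, forall i, i < k -> fixed_by n (v i).
Proof.
induction k as [|k [n IH]]; [exists 0; lia|].
destruct (fixed_by_ex (v k)) as [m Hm]; exists (max n m); intros i Hi.
destruct (Nat.eq_dec i k) as [->|].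
- apply (fixed_by_le m); [lia|exact Hm].
- apply (fixed_by_le n); [lia|apply IH; lia].
Qed.

Lemma sat_symmetric p (w : nat -> M) : exists n, forall g, stable n g ->
  forall x y, sat M (scons x (scons y w)) p <->
    sat M (scons (move g x) (scons (move g y) w)) p.
Proof.
destruct (sat_finite p) as [k Hk], (fixed_by_env w k) as [n Hn].
exists n; intros g Hg x y; rewrite <- (sat_move g); apply Hk.
intros [|[|i]] Hi; try reflexivity; simpl; apply Hn; [lia|exact Hg].
Qed.

Lemma upair_fr_ex (a b : M) : exists c, is_upair c a b.
Proof.
apply set_ex.
- exists bool, (fun i : bool => if i then a else b).
  intros x [-> | ->]; [exists true|exists false]; reflexivity.
- destruct (fixed_by_ex a) as [n Hn], (fixed_by_ex b) as [m Hm].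
  exists (max n m); intros g Hg x [-> | ->].
  + left; apply Hn, (stable_le n (max n m)); [lia|exact Hg].
  + right; apply Hm, (stable_le m (max n m)); [lia|exact Hg].
Qed.

Lemma succ_fr_ex (a : M) : exists s, is_succ s a.
Proof.
apply set_ex.
- destruct (small_mem a) as (A & h & H).
  exists (option A), (fun i => match i with Some i => h i | None => a end).
  intros x [Hx| ->]; [|exists None; reflexivity].
  destruct (H x Hx) as [i Hi]; exists (Some i); exact Hi.
- destruct (fixed_by_ex a) as [n Hn]; exists n; intros g Hg x.
  rewrite <- (mem_move g x), (Hn g Hg).
  intros [H|<-]; [auto|right; apply Hn, Hg].
Qed.

Lemma empty_fr_ex : exists e : M, is_empty e.
Proof.
apply set_ex.
- exists False, (fun i : False => match i with end); intros x [].
- exists 0; intros g _ x [].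
Qed.

Definition numeral (n : nat) : M :=
  Nat.iter n (fun a => epsilon (dom_inhabited M) (fun s => is_succ s a))
    (epsilon (dom_inhabited M) is_empty).

Lemma numeral_0 : is_empty (numeral 0).
Proof. exact (epsilon_spec (dom_inhabited M) (@is_empty M) empty_fr_ex). Qed.

Lemma numeral_S n : is_succ (numeral (S n)) (numeral n).
Proof.
exact (epsilon_spec (dom_inhabited M) (fun s => is_succ s (numeral n)) (succ_fr_ex _)).
Qed.

Lemma move_is_set_of g (a : M) P :
  is_set_of a P -> is_set_of (move g a) (fun x => P (move g x)).
Proof.
intros [Ha H]; split; [rewrite atom_move; exact Ha|].
intros x; rewrite mem_move_r; apply H.
Qed.

Lemma move_empty g (e : M) : is_empty e -> move g e = e.
Proof.
intros H; apply (is_set_of_unique (fun _ => False)); [|exact H].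
apply (move_is_set_of g _ _ H).
Qed.

Lemma move_succ g (s a : M) : is_succ s a -> move g a = a -> move g s = s.
Proof.
intros [Hs H] e; apply fr_ext; [rewrite atom_move; exact Hs|exact Hs|].
intros x; rewrite mem_move_r, !H, <- (mem_move g x a), e.
split; (intros [K|K]; [auto|right]).
- rewrite <- e, <- K, move_move; reflexivity.
- congruence.
Qed.

Lemma move_numeral g n : move g (numeral n) = numeral n.
Proof.
induction n as [|n IH].
- apply move_empty, numeral_0.
- apply (move_succ g _ (numeral n)); [apply numeral_S|exact IH].
Qed.

Lemma omega_fr_ex : exists w : M, is_set_of w (fun x => exists n, x = numeral n).
Proof.
apply set_ex.
- exists nat, numeral; auto.
- exists 0; intros g _ x [n ->]; exists n; apply move_numeral.
Qed.

Lemma numerals_is_omega (w : M) :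
  is_set_of w (fun x => exists n, x = numeral n) -> is_omega w.
Proof.
intros [Hw H]; split; [exact Hw|split; [split|]].
- exists (numeral 0); split; [apply numeral_0|apply H; eauto].
- intros x Hx; apply H in Hx; destruct Hx as [n ->].
  exists (numeral (S n)); split; [apply numeral_S|apply H; eauto].
- intros v [(e & He & Hv) K]; split; [exact Hw|].
  intros x Hx; apply H in Hx; destruct Hx as [n ->].
  induction n as [|n IH].
  + rewrite (is_set_of_unique _ _ _ numeral_0 He); exact Hv.
  + destruct (K _ IH) as (s & Hs & L).
    rewrite (is_set_of_unique _ _ _ (numeral_S n) Hs); exact L.
Qed.

Lemma fraenkel_ZFA : model ZFA M.
Proof.
intros p Hp w; destruct Hp.
- intros a (n & b & e) x Hx; change (proj1_sig a = urelt n b) in e.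
  change (elt (proj1_sig x) (proj1_sig a)) in Hx; rewrite e in Hx.
  apply (elt_urelt _ _ _ Hx).
- apply sat_ex.
  destruct (set_ex (fun x : M => atom x)) as (a & Ha & K).
  + exists (nat * bool)%type, (fun i =>
      exist _ (urelt (fst i) (snd i)) (hsym_urelt (fst i) (snd i))).
    intros x (n & b & e); exists (n, b); apply fr_eq, e.
  + exists 0; intros g _ x; apply atom_move.
  + exists a; apply sat_and; split; [exact Ha|]; intros x; apply sat_iff, K.
- intros a b Ha Hb H; apply fr_ext; [exact Ha|exact Hb|].
  intros x; apply (sat_iff (scons x (scons b (scons a w))) (f_mem 0 2) (f_mem 0 1)), H.
- intros a b; apply sat_ex; destruct (upair_fr_ex a b) as (c & _ & K).
  exists c; intros x; apply sat_iff; rewrite sat_or; apply K.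
- intros a; apply sat_ex.
  destruct (set_ex (fun x => exists y, y ∈ a /\ x ∈ y)) as (b & Hb & K).
  + destruct (small_mem a) as (A & h & H).
    (* Each member of [a] has its own members presented by some index type; one presentation per
       index of [a] is selected, and the sum of these types bounds the union. *)
    set (B i := {C : Type & {k : C -> M | forall x, x ∈ h i <-> exists j, x = k j}}).
    assert (HB : forall i, inhabited (B i)).
    { intros i; destruct (elements (h i)) as (C & k & L); constructor.
      exists C, k; exact L. }
    set (e i := epsilon (HB i) (fun _ => True)).
    exists {i : A & projT1 (e i)}, (fun ij => proj1_sig (projT2 (e (projT1 ij))) (projT2 ij)).
    intros x (y & Hy & Hx); destruct (H y Hy) as [i ->].
    apply (proj2_sig (projT2 (e i))) in Hx; destruct Hx as [j Hj].
    exists (existT _ i j); exact Hj.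
  + destruct (fixed_by_ex a) as [n Hn]; exists n; intros g Hg x (y & Hy & Hx).
    exists (move g y); rewrite mem_move, <- (Hn g Hg), mem_move; auto.
  + exists b; apply sat_and; split; [exact Hb|]; intros x.
    rewrite sat_iff, sat_ex; split.
    * intros Hx; apply K in Hx; destruct Hx as (y & L); exists y; apply sat_and, L.
    * intros (y & L); apply K; exists y; apply sat_and in L; exact L.
- intros a; apply sat_ex.
  destruct (set_ex (fun x => subset x a)) as (b & Hb & K).
  + destruct (elements a) as (A & h & H).
    (* A subset is determined by the predicate it cuts out on the index type, so predicates bound
       the power set; a predicate that gives no set of the model gets a junk value. *)
    exists (A -> Prop), (fun P => epsilon (dom_inhabited M) (fun b =>
      is_set_of b (fun x => exists i, P i /\ x = h i))).
    intros x [Hx1 Hx2]; exists (fun i => h i ∈ x).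
    assert (E : is_set_of x (fun y => exists i, h i ∈ x /\ y = h i)).
    { split; [exact Hx1|]; intros y; split.
      - intros Hy; destruct (proj1 (H y) (Hx2 y Hy)) as [i ->]; eauto.
      - intros (i & Hi & ->); exact Hi. }
    apply (is_set_of_unique _ _ _ E).
    apply (epsilon_spec (dom_inhabited M) (fun b =>
      is_set_of b (fun y => exists i, h i ∈ x /\ y = h i))); eauto.
  + destruct (fixed_by_ex a) as [n Hn]; exists n; intros g Hg x [Hx1 Hx2].
    split; [rewrite atom_move; exact Hx1|].
    intros y Hy; rewrite mem_move_r in Hy; apply Hx2 in Hy.
    rewrite <- mem_move_r, (Hn g Hg) in Hy; exact Hy.
  + exists b; apply sat_and; split; [exact Hb|]; intros x.
    rewrite sat_iff, sat_and; apply K.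
- destruct omega_fr_ex as (o & Ho & K).
  apply sat_ex; exists o; apply sat_and; split.
  + apply sat_ex; exists (numeral 0); rewrite !sat_and.
    destruct numeral_0 as [E1 E2].
    split; [exact E1|split; [|apply K; exists 0; reflexivity]].
    intros x Hx; apply E2 in Hx; exact Hx.
  + intros x Hx; change (x ∈ o) in Hx; apply K in Hx; destruct Hx as [n ->]; apply sat_ex.
    destruct (numeral_S n) as [E1 E2].
    exists (numeral (S n)); rewrite !sat_and.
    split; [exact E1|split; [|apply K; exists (S n); reflexivity]].
    intros x; rewrite sat_iff, sat_or; apply E2.
- intros a H; apply sat_ex in H; destruct H as [x Hx]; apply sat_ex.
  destruct (foundation_fr (fun x => x ∈ a) x Hx) as (m & Hm & K).
  exists m; rewrite sat_and, sat_not, sat_ex; split; [exact Hm|].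
  intros (y & Hy); apply sat_and in Hy; apply (K y); apply Hy.
- intros a; apply sat_ex.
  assert (E : forall b x, sat M (scons x (scons b (scons a w)))
    (rename (scons 0 (fun i => i + 3)) p) <-> sat M (scons x w) p).
  { intros b x; rewrite sat_rename; apply sat_ext; intros [|i]; [reflexivity|].
    simpl; rewrite Nat.add_comm; reflexivity. }
  destruct (set_ex (fun x => x ∈ a /\ sat M (scons x w) p)) as (b & Hb & K).
  + apply (small_sub _ (fun x => x ∈ a)); [apply small_mem|tauto].
  (* [sat_symmetric] singles out two variables where separation has one; the second is filled with a
     copy of [x] and skipped by the renaming. *)
  + destruct (sat_symmetric (rename (scons 0 (fun i => i + 2)) p) w) as [n Hn].
    assert (E' : forall x, sat M (scons x (scons x w))
      (rename (scons 0 (fun i => i + 2)) p) <-> sat M (scons x w) p).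
    { intros x; rewrite sat_rename; apply sat_ext; intros [|i]; [reflexivity|].
      simpl; rewrite Nat.add_comm; reflexivity. }
    destruct (fixed_by_ex a) as [m Hm]; exists (max n m); intros g Hg x [H1 H2].
    split.
    * rewrite <- (Hm g), mem_move by (apply (stable_le m (max n m)); [lia|exact Hg]).
      exact H1.
    * apply E', Hn; [apply (stable_le n (max n m)); [lia|exact Hg]|apply E', H2].
  + exists b; apply sat_and; split; [exact Hb|]; intros x.
    rewrite sat_iff, sat_and, E; apply K.
- set (R x y := sat M (scons y (scons x w)) p).
  assert (E : forall x y v r, v (r 0) = y -> v (r 1) = x ->
    (forall i, v (r (S (S i))) = w i) -> sat M v (rename r p) <-> R x y).
  { intros x y v r e0 e1 e2; rewrite sat_rename; apply sat_ext.
    intros [|[|i]]; simpl; auto. }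
  intros F a; apply sat_ex.
  assert (HR : forall x y y', R x y -> R x y' -> y = y').
  { intros x y y' H1 H2; apply (F x y y').
    - apply (E x y); try reflexivity; [|exact H1].
      intros i; simpl; rewrite Nat.add_comm; reflexivity.
    - apply (E x y'); try reflexivity; [|exact H2].
      intros i; simpl; rewrite Nat.add_comm; reflexivity. }
  destruct (set_ex (fun y => exists x, x ∈ a /\ R x y)) as (b & Hb & K).
  + apply small_image; intros x y y' _; apply HR.
  + destruct (sat_symmetric p w) as [n Hn], (fixed_by_ex a) as [m Hm].
    exists (max n m); intros g Hg y (x & Hx & H).
    exists (move g x); split.
    * rewrite <- (Hm g), mem_move by (apply (stable_le m (max n m)); [lia|exact Hg]).
      exact Hx.
    * apply Hn; [apply (stable_le n (max n m)); [lia|exact Hg]|exact H].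
  + assert (E' : forall x y, sat M (scons x (scons y (scons b (scons a w))))
      (rename (scons 1 (scons 0 (fun i => i + 4))) p) <-> R x y).
    { intros x y; apply E; try reflexivity.
      intros i; simpl; rewrite Nat.add_comm; reflexivity. }
    exists b; apply sat_and; split; [exact Hb|]; intros y.
    rewrite sat_iff, sat_ex; split.
    * intros Hy; apply K in Hy; destruct Hy as (x & Hx & H).
      exists x; apply sat_and; rewrite E'; auto.
    * intros (x & Hx); apply sat_and in Hx; rewrite E' in Hx; apply K; exists x; exact Hx.
Qed.

(** * Choice in the second Fraenkel model *)

Lemma move_eq_iff g (x y : M) : move g x = y <-> x = move g y.
Proof. split; [intros <-|intros ->]; rewrite move_move; reflexivity. Qed.

Lemma opair_fr_ex (a b : M) : exists p, is_opair p a b.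
Proof.
destruct (upair_fr_ex a a) as [s Hs], (upair_fr_ex a b) as [t Ht].
destruct (upair_fr_ex s t) as [p Hp]; exists p, s, t; auto.
Qed.

Definition pair_fr (a b : M) : M := epsilon (dom_inhabited M) (fun p => is_opair p a b).

Lemma pair_frP a b : is_opair (pair_fr a b) a b.
Proof. exact (epsilon_spec (dom_inhabited M) (fun p => is_opair p a b) (opair_fr_ex a b)). Qed.

Lemma opair_fr_unique (p q a b : M) : is_opair p a b -> is_opair q a b -> p = q.
Proof.
intros (s & t & Hs & Ht & Hp) (s' & t' & Hs' & Ht' & Hq).
rewrite (is_set_of_unique _ _ _ Hs' Hs), (is_set_of_unique _ _ _ Ht' Ht) in Hq.
apply (is_set_of_unique _ _ _ Hp Hq).
Qed.

Lemma opair_fr_inj (p a b a' b' : M) :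
  is_opair p a b -> is_opair p a' b' -> a = a' /\ b = b'.
Proof.
intros (s & t & [_ Hs] & [_ Ht] & [_ Hp]) (s' & t' & [_ Hs'] & [_ Ht'] & [_ Hp']).
assert (e : a' = a).
{ assert (L : s ∈ p) by (apply Hp; auto).
  assert (K : a' ∈ s).
  { apply Hp' in L; destruct L as [-> | ->]; [apply Hs'|apply Ht']; auto. }
  apply Hs in K; tauto. }
subst a'; split; [reflexivity|].
assert (L : t ∈ p) by (apply Hp; auto).
assert (L' : t' ∈ p) by (apply Hp'; auto).
assert (K : b' ∈ t') by (apply Ht'; auto).
assert (K' : b ∈ t) by (apply Ht; auto).
apply Hp' in L; apply Hp in L'; destruct L as [L|L].
- subst t; apply Hs' in K'; assert (b = a) by tauto; subst b.
  destruct L' as [-> | ->]; [apply Hs in K|apply Ht in K]; destruct K; auto.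
- subst t; apply Ht in K; apply Ht' in K'; destruct K, K'; congruence.
Qed.

Lemma move_upair g (p a b : M) : is_upair p a b -> is_upair (move g p) (move g a) (move g b).
Proof.
intros [H K]; split; [rewrite atom_move; exact H|].
intros x; rewrite mem_move_r, K, !move_eq_iff; reflexivity.
Qed.

Lemma move_opair g (p a b : M) : is_opair p a b -> is_opair (move g p) (move g a) (move g b).
Proof.
intros (s & t & Hs & Ht & Hp); exists (move g s), (move g t).
auto using move_upair.
Qed.

Lemma move_related g (r x y : M) : related r x y -> related (move g r) (move g x) (move g y).
Proof.
intros (p & Hp & H); exists (move g p); rewrite mem_move; auto using move_opair.
Qed.

Lemma move_related_fixed g (r x y : M) :
  move g r = r -> related r x y -> related r (move g x) (move g y).
Proof. intros e H; rewrite <- e; apply move_related, H. Qed.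

(** The elements of [w] fixed by every permutation form an inductive set, and [w] is contained in
    every such set. *)
Lemma move_omega g (w k : M) : is_omega w -> k ∈ w -> move g k = k.
Proof.
intros (_ & Hw & Hmin) Hk.
destruct (set_ex (fun k => k ∈ w /\ forall h, move h k = k)) as (v & Hv & K).
- apply (small_sub _ (fun k => k ∈ w)); [apply small_mem|tauto].
- exists 0; intros h _ x [Hx L]; rewrite L; auto.
- destruct Hw as [(e & He & H0) HS].
  apply K, Hmin; [|exact Hk]; split.
  + exists e; split; [exact He|]; apply K; split; [exact H0|].
    intros h; apply move_empty, He.
  + intros x Hx; apply K in Hx; destruct Hx as [Hx L].
    destruct (HS x Hx) as (s & Hs & Hsw).
    exists s; split; [exact Hs|]; apply K; split; [exact Hsw|].
    intros h; apply (move_succ h s x); auto.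
Qed.

(** If [x] is below its image, applying [g] puts the image below [x], and antisymmetry concludes;
    the other case is symmetric. *)
Lemma move_linear_order g (r X x : M) :
  linear_order r X -> move g r = r -> move g X = X -> x ∈ X -> move g x = x.
Proof.
intros (_ & _ & _ & anti & _ & tot) er eX Hx.
assert (Hg : move g x ∈ X) by (rewrite <- eX, mem_move; exact Hx).
destruct (tot _ _ Hx Hg) as [H|H]; pose proof (move_related_fixed g _ _ _ er H) as K;
  rewrite move_move in K; auto.
Qed.

Lemma fraenkel_CAC_DLO : CAC_DLO M.
Proof.
intros G F (w & Hw & HG & HL & [HF1 HF2]).
destruct (fixed_by_ex G) as [n Hn].
assert (HFX : forall X, X ∈ F -> nonempty X /\ ~ atom X /\ 
  forall g, stable n g -> move g X = X /\ forall x, x ∈ X -> move g x = x).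
{ intros X HX; apply HF2 in HX; destruct HX as (k & q & r & Hkq & Hq).
  destruct (HL k q Hkq) as (X' & r' & Hq' & HX & Hr & HN).
  destruct (opair_fr_inj _ _ _ _ _ Hq Hq'); subst X' r'.
  split; [exact HN|split; [exact HX|]]; intros g Hg.
  assert (Hk : k ∈ w).
  { destruct Hkq as (p & Hp & e); destruct (proj1 (proj2 HG) p Hp) as (k' & q' & Hk & e').
    destruct (opair_fr_inj _ _ _ _ _ e e'); congruence. }
  (* [q] is the value of the fixed function [G] at the fixed number [k], hence fixed; so are then
     its two components, the set and its order. *)
  assert (eq : move g q = q).
  { destruct (proj2 (proj2 HG) k Hk) as (q0 & _ & U).
    transitivity q0; [symmetry; apply U|apply U, Hkq].
    pose proof (move_related g _ _ _ Hkq) as K.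
    rewrite (Hn g Hg), (move_omega g w k Hw Hk) in K; exact K. }
  assert (K := move_opair g _ _ _ Hq); rewrite eq in K.
  destruct (opair_fr_inj _ _ _ _ _ Hq K) as [eX er].
  split; [auto|]; intros x Hx; apply (move_linear_order g r X); auto. }
(* The choice is made outside the model; its graph is nevertheless symmetric, because permutations
   that are stable up to [n] fix every [X] and each of its members. *)
set (c X := epsilon (dom_inhabited M) (fun x => x ∈ X)).
assert (Hc : forall X, X ∈ F -> c X ∈ X).
{ intros X HX; apply epsilon_spec, HFX, HX. }
destruct (set_ex (fun p => exists X, X ∈ F /\ is_opair p X (c X))) as (f & Hf1 & Hf2).
- apply small_image; intros X p p' _; apply opair_fr_unique.
- exists n; intros g Hg p (X & HX & Hp); exists X; split; [exact HX|].
  destruct (HFX X HX) as (_ & _ & K); destruct (K g Hg) as [K1 K2].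
  apply (move_opair g) in Hp; rewrite K1, (K2 _ (Hc X HX)) in Hp; exact Hp.
- assert (E : forall X x, related f X x <-> X ∈ F /\ x = c X).
  { intros X x; split.
    - intros (p & Hp & e); apply Hf2 in Hp; destruct Hp as (Y & HY & e').
      destruct (opair_fr_inj _ _ _ _ _ e e'); subst; auto.
    - intros [HX ->]; exists (pair_fr X (c X)); split; [|apply pair_frP].
      apply Hf2; exists X; split; [exact HX|apply pair_frP]. }
  exists f; split; [split; [exact Hf1|split]|].
  + intros p Hp; apply Hf2 in Hp; destruct Hp as (X & HX & e); eauto.
  + intros X HX; exists (c X); split; [apply E; auto|].
    intros y Hy; apply E in Hy; symmetry; apply Hy.
  + intros X x Hx; apply E in Hx; destruct Hx as [HX ->]; auto.
Qed.

(** * The pairs of atoms, a family without a choice function *)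

Definition fr_atom (n : nat) (b : bool) : M := exist _ (urelt n b) (hsym_urelt n b).

Lemma move_fr_atom g n b : move g (fr_atom n b) = fr_atom n (xorb (g n) b).
Proof. apply fr_eq, act_urelt. Qed.

Lemma fr_atom_inj n b m c : fr_atom n b = fr_atom m c -> n = m /\ b = c.
Proof. intros e; apply (f_equal (@proj1_sig _ _)) in e; apply urelt_inj, e. Qed.

Definition atom_pair (n : nat) : M :=
  epsilon (dom_inhabited M) (fun p => is_upair p (fr_atom n false) (fr_atom n true)).

Lemma atom_pairP n : is_set_of (atom_pair n) (fun x => exists b, x = fr_atom n b).
Proof.
destruct (epsilon_spec (dom_inhabited M) (fun p => is_upair p (fr_atom n false)
  (fr_atom n true)) (upair_fr_ex _ _)) as [H K].
split; [exact H|]; intros x; rewrite (K x); split.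
- intros [-> | ->]; eauto.
- intros [[] ->]; auto.
Qed.

Lemma move_atom_pair g n : move g (atom_pair n) = atom_pair n.
Proof.
destruct (atom_pairP n) as [H K].
apply fr_ext; [rewrite atom_move; exact H|exact H|]; intros x.
rewrite mem_move_r, !K; split; intros [b e].
- apply move_eq_iff in e; rewrite move_fr_atom in e; eauto.
- rewrite e, move_fr_atom; eauto.
Qed.

Lemma atom_pair_inj n m : atom_pair n = atom_pair m -> n = m.
Proof.
intros e; assert (K : fr_atom n true ∈ atom_pair n) by (apply atom_pairP; eauto).
rewrite e in K; apply atom_pairP in K; destruct K as [b K]; apply (fr_atom_inj _ _ _ _ K).
Qed.

(** Permutations that fix the indices up to and including [n] fix both atoms, so an order on the
    pair lies in the model. The support [S n] grows with the pair: none serves all pairs at once. *)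
Lemma atom_pair_linearly_orderable n : linearly_orderable (atom_pair n).
Proof.
destruct (atom_pairP n) as [Hn Kn]; split; [exact Hn|].
set (R x y := exists b c, (b = true -> c = true) /\ x = fr_atom n b /\ y = fr_atom n c).
destruct (set_ex (fun p => exists x y, R x y /\ is_opair p x y)) as (r & Hr & K).
- exists (bool * bool)%type,
    (fun i => pair_fr (fr_atom n (fst i)) (fr_atom n (snd i))).
  intros p (x & y & (b & c & _ & -> & ->) & Hp); exists (b, c).
  apply (opair_fr_unique _ _ _ _ Hp), pair_frP.
- exists (S n); intros g Hg p (x & y & HR & Hp); exists x, y; split; [exact HR|].
  apply (move_opair g) in Hp; destruct HR as (b & c & _ & -> & ->).
  rewrite !move_fr_atom, Hg in Hp by lia; exact Hp.
- assert (E : forall x y, related r x y <-> R x y).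
  { intros x y; split.
    - intros (p & Hp & e); apply K in Hp; destruct Hp as (x' & y' & HR & e').
      destruct (opair_fr_inj _ _ _ _ _ e e'); subst; exact HR.
    - intros HR; exists (pair_fr x y); split; [|apply pair_frP].
      apply K; exists x, y; split; [exact HR|apply pair_frP]. }
  exists r; split; [exact Hr|split; [|split; [|split; [|split]]]].
  + intros p Hp; apply K in Hp; destruct Hp as (x & y & (b & c & _ & -> & ->) & Hp).
    exists (fr_atom n b), (fr_atom n c); rewrite !Kn; eauto.
  + intros x Hx; apply Kn in Hx; destruct Hx as [b ->]; apply E; exists b, b; auto.
  + intros x y H1 H2; apply E in H1, H2.
    destruct H1 as (b & c & L & -> & ->), H2 as (b' & c' & L' & e & e').
    apply fr_atom_inj in e, e'; destruct e as [_ <-], e' as [_ <-].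
    destruct b, c; try reflexivity; [discriminate (L eq_refl)|discriminate (L' eq_refl)].
  + intros x y z H1 H2; apply E in H1, H2; apply E.
    destruct H1 as (b & c & L & -> & ->), H2 as (b' & c' & L' & e & ->).
    apply fr_atom_inj in e; destruct e as [_ <-]; exists b, c'; auto.
  + intros x y Hx Hy; apply Kn in Hx, Hy; destruct Hx as [b ->], Hy as [c ->].
    destruct b; [right|left]; apply E; [exists c, true|exists false, c]; auto.
    split; [discriminate|auto].
Qed.

Lemma numeral_mem_le n m : n < m -> numeral n ∈ numeral m.
Proof.
induction 1 as [|m _ IH]; apply numeral_S; auto.
Qed.

Lemma numeral_inj n m : numeral n = numeral m -> n = m.
Proof.
assert (K : forall k : M, ~ k ∈ k).
{ intros k Hk; destruct (foundation_fr (fun x => x = k) k eq_refl) as (m' & -> & L).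
  apply (L k Hk eq_refl). }
intros e; destruct (Nat.lt_trichotomy n m) as [H|[H|H]]; [|exact H|];
  apply numeral_mem_le in H; rewrite e in H; destruct (K _ H).
Qed.

Lemma fraenkel_not_CAC_LO : ~ CAC_LO M.
Proof.
intros CAC.
destruct (set_ex (fun X => exists n, X = atom_pair n)) as (F & HF1 & HF2).
{ exists nat, atom_pair; auto. }
{ exists 0; intros g _ X [n ->]; exists n; apply move_atom_pair. }
destruct omega_fr_ex as (w & Hw1 & Hw2).
(* The numbering of the pairs is fixed by the whole group, since each pair is preserved as a set and
   numerals never move; so the family is denumerable inside the model. *)
destruct (set_ex (fun p => exists n, is_opair p (atom_pair n) (numeral n)))
  as (f & Hf1 & Hf2).
{ exists nat, (fun n => pair_fr (atom_pair n) (numeral n)); intros p [n Hp]; exists n.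
  apply (opair_fr_unique _ _ _ _ Hp), pair_frP. }
{ exists 0; intros g _ p [n Hp]; exists n.
  apply (move_opair g) in Hp; rewrite move_atom_pair, move_numeral in Hp; exact Hp. }
assert (E : forall X k, related f X k <-> exists n, X = atom_pair n /\ k = numeral n).
{ intros X k; split.
  - intros (p & Hp & e); apply Hf2 in Hp; destruct Hp as [n e'].
    exists n; apply (opair_fr_inj _ _ _ _ _ e e').
  - intros (n & -> & ->); exists (pair_fr (atom_pair n) (numeral n)).
    split; [|apply pair_frP]; apply Hf2; exists n; apply pair_frP. }
destruct (CAC F) as (c & (Hc1 & _ & Hc2) & Hc3).
- exists w; split; [apply numerals_is_omega; split; assumption|]; exists f.
  split; [split; [split; [split; [exact Hf1|split]|]|]|].
  + intros p Hp; apply Hf2 in Hp; destruct Hp as [n Hp].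
    exists (atom_pair n), (numeral n); split; [apply HF2; eauto|exact Hp].
  + intros X HX; apply HF2 in HX; destruct HX as [n ->]; exists (numeral n); split.
    * apply E; eauto.
    * intros k Hk; apply E in Hk; destruct Hk as (m & e & ->).
      f_equal; apply atom_pair_inj, e.
  + intros X k Hk; apply E in Hk; destruct Hk as (n & _ & ->); apply Hw2; eauto.
  + intros X Y k H1 H2; apply E in H1, H2.
    destruct H1 as (n & -> & ->), H2 as (m & -> & e); f_equal; apply numeral_inj, e.
  + intros k Hk; apply Hw2 in Hk; destruct Hk as [n ->]; exists (atom_pair n).
    apply E; eauto.
- intros X HX; apply HF2 in HX; destruct HX as [n ->].
  split; [|apply atom_pair_linearly_orderable].
  exists (fr_atom n true); apply atom_pairP; eauto.
- destruct (fixed_by_ex c) as [n Hn].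
  assert (HP : atom_pair n ∈ F) by (apply HF2; eauto).
  destruct (Hc2 _ HP) as (x & Hx & U).
  assert (Hb := Hc3 _ _ Hx); apply atom_pairP in Hb; destruct Hb as [b ->].
  (* Only the pair of index [n] is swapped: this respects the support of [c], which consists of the
     indices below [n], and exchanges the two possible values of [c] at that pair. *)
  set (g := Nat.eqb n).
  assert (Hg : stable n g) by (intros i Hi; apply Nat.eqb_neq; lia).
  apply (move_related_fixed g) in Hx; [|apply Hn, Hg].
  rewrite move_atom_pair in Hx; apply U in Hx.
  rewrite move_fr_atom in Hx; apply fr_atom_inj in Hx.
  unfold g in Hx; rewrite Nat.eqb_refl in Hx; destruct b; destruct Hx; discriminate.
Qed.

Theorem theorem9p2 :
  (implies_in ZF CAC_LO CAC_DLO /\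
   implies_in ZF CAC_DLO LO_P_spaces /\
   implies_in ZF LO_P_spaces LO_S_fin_P_space /\
   implies_in ZF LO_S_fin_P_space CUC_DLO /\
   implies_in ZF CUC_DLO (fun M => vDCP_omega M /\ omega1_regular M)) /\
  not_implies_in ZFA CAC_DLO CAC_LO.
Proof.
split; [split; [|split; [|split; [|split]]]|].
- intros M HM; apply CAC_LO_CAC_DLO.
- intros M HM; apply CAC_DLO_LO_P_spaces.
- intros M HM H X inf lo; apply H; assumption.
- intros M HM; apply LO_S_fin_P_space_CUC_DLO.
- intros M HM CUC; split.
  + apply CUC_DLO_vDCP, CUC.
  + apply CUC_DLO_omega1_regular, CUC.
- intros _; exists fraenkel; split; [apply fraenkel_ZFA|].
  split; [apply fraenkel_CAC_DLO|apply fraenkel_not_CAC_LO].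
Qed.
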